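(* For every even integer $w\ge 8$, the function $G_w$ is positive, i.e. $G_w(it)>0$ for all real $t>0$.
   Context: Let $z$ be in the upper half-plane, $q^{r}=e^{2\pi i r z}$, $\sigma_k(n)=\sum_{m\mid n}m^k$, $E_2=1-24\sum_{n\ge1}\sigma_1(n)q^n$, $E_4=1+240\sum_{n\ge1}\sigma_3(n)q^n$, $E_6=1-504\sum_{n\ge1}\sigma_5(n)q^n$, $\Delta=(E_4^3-E_6^2)/1728$. Put $D=\frac1{2\pi i}\frac{d}{dz}$, $\partial_kF=DF-\frac{k}{12}E_2F$, $\partial_k^2=\partial_{k+2}\partial_k$. Let $H_2=\Theta_2^4$, $H_4=\Theta_4^4$ with $\Theta_2(z)=\sum_{n\in\mathbb{Z}}q^{\frac12(n+\frac12)^2}$, $\Theta_4(z)=\sum_{n\in\mathbb{Z}}(-1)^nq^{n^2/2}$. Let $\mathcal{L}_S=\log\lambda_S$ be the holomorphic logarithm on the upper half-plane of $\lambda_S=1-\lambda=H_4/(H_2+H_4)$ (where $\lambda=H_2/(H_2+H_4)$) with expansion $\mathcal{L}_S=-16\sum_{k\ge0}\frac{\sigma_1(2k+1)}{2k+1}q^{k+1/2}$. The functions $G_w$ ($w\ge4$ even) (Feigenbaum--Grabner--Hardin, normalized) are defined by $G_4=\frac{H_2}{2^5}(H_2+2H_4)$, $G_6=\frac{H_2}{2^4}(H_2^2+H_2H_4+H_4^2)$, $G_8=\frac{H_2^3}{2^{13}}(H_2+2H_4)$, $G_{10}=\frac{H_2^3}{2^{12}\cdot5}(2H_2^2+5H_2H_4+5H_4^2)$,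 $G_{12}=\frac{3\Delta\mathcal{L}_S}{2^{11}\cdot7}+\frac{3H_2^3}{2^{20}\cdot7}(H_2^3+3H_2^2H_4+3H_2H_4^2+2H_4^3)$, $G_{14}=\frac{H_2^5}{2^{20}\cdot7}(2H_2^2+7H_2H_4+7H_4^2)$, $G_{16}=\frac{5E_4\Delta\mathcal{L}_S}{2^{18}\cdot11}+\frac{5H_2^3}{2^{29}\cdot3\cdot11}(5H_2^5+20H_2^4H_4+42H_2^3H_4^2+68H_2^2H_4^3+60H_2H_4^4+24H_4^5)$, $G_{18}=-\frac{5E_6\Delta\mathcal{L}_S}{2^{17}\cdot11\cdot13}+\frac{5H_2^3}{2^{27}\cdot3\cdot11\cdot13}(10H_2^6+45H_2^5H_4+68H_2^4H_4^2+34H_2^3H_4^3-13H_2^2H_4^4-36H_2H_4^5-12H_4^6)$, and, for $w\equiv0\pmod4$, $$G_{w+2}=\frac{3(w-6)(w-2)}{16(w-16)(w-5)(w-4)(w-3)}\left(\frac{(w-9)(w-8)}{36}E_4G_{w-2}-\partial_{w-2}^2G_{w-2}\right)\quad(w\ge20),$$ $$G_{w+4}=\frac{3(w-2)(w+2)}{16(w-8)(w-3)(w-1)(w+4)}\left(\frac{(w-4)(w-3)}{36}E_4G_w-\partial_w^2G_w\right)\quad(w\ge16).$$ *)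

(* Defs.v *)
From Stdlib Require Import Reals ZArith Arith List.
From Coquelicot Require Import Coquelicot.

Open Scope C_scope.

Definition Cexp (z : C) : C :=
  (exp (Re z) * cos (Im z), exp (Re z) * sin (Im z))%R.

(* Like Coquelicot's [Series], meaningful only when the series converges. *)
Definition CSeries (a : nat -> C) : C :=
  (Series (fun n => Re (a n)), Series (fun n => Im (a n))).

Definition CSeriesZ (a : Z -> C) : C :=
  CSeries (fun n => a (Z.of_nat n)) + CSeries (fun n => a (- Z.of_nat (S n))%Z).

(* All functions below live on the upper half-plane [upper]; they are total on
   [C], and their values at other points are irrelevant. *)
Definition upper (z : C) : Prop := (0 < Im z)%R.

(* [qpow r z] is q^r = exp (2 pi i r z). *)
Definition qpow (r : R) (z : C) : C := Cexp (2 * PI * Ci * r * z).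

Definition sigma (k n : nat) : nat :=
  list_sum (map (fun m => Nat.pow m k)
                (filter (fun m => Nat.eqb (Nat.modulo n m) 0) (seq 1 n))).

(* sum_(n >= 1) sigma_k(n) q^n *)
Definition sigma_series (k : nat) (z : C) : C :=
  CSeries (fun n => INR (sigma k (S n)) * qpow (INR (S n)) z).

Definition E2 (z : C) : C := 1 - 24 * sigma_series 1 z.
Definition E4 (z : C) : C := 1 + 240 * sigma_series 3 z.
Definition E6 (z : C) : C := 1 - 504 * sigma_series 5 z.
Definition Delta (z : C) : C := (E4 z ^ 3 - E6 z ^ 2) / 1728.

(* [C_derive] is the complex derivative at points of complex differentiability
   (see [C_derive_correct]). *)
Definition D (F : C -> C) (z : C) : C := / (2 * PI * Ci) * C_derive F z.

Definition serre (k : nat) (F : C -> C) (z : C) : C :=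
  D F z - INR k / 12 * E2 z * F z.

Definition serre2 (k : nat) (F : C -> C) : C -> C := serre (k + 2) (serre k F).

Definition Theta2 (z : C) : C :=
  CSeriesZ (fun n => qpow ((IZR n + 1 / 2) ^ 2 / 2)%R z).

Definition Theta4 (z : C) : C :=
  CSeriesZ (fun n => (if Z.even n then 1 else -1) * qpow (IZR n ^ 2 / 2)%R z).

Definition H2 (z : C) : C := Theta2 z ^ 4.
Definition H4 (z : C) : C := Theta4 z ^ 4.

Definition lambda (z : C) : C := H2 z / (H2 z + H4 z).
Definition lambdaS (z : C) : C := 1 - lambda z.

(* [L] is the holomorphic logarithm of lambda_S on the upper half-plane whose
   expansion is -16 sum_(k >= 0) sigma_1(2k+1)/(2k+1) q^(k+1/2); the expansion
   selects the branch, so [L] is unique on the upper half-plane. *)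
Definition is_LS (L : C -> C) : Prop :=
  forall z : C, upper z ->
    @ex_derive C_AbsRing C_NormedModule L z /\
    Cexp (L z) = lambdaS z /\
    is_series (fun k : nat =>
      -16 * (INR (sigma 1 (2 * k + 1)) / INR (2 * k + 1)
               * qpow (INR k + 1 / 2)%R z) : C) (L z).

Definition G4 (z : C) : C :=
  let h2 := H2 z in let h4 := H4 z in
  h2 / 2 ^ 5 * (h2 + 2 * h4).

Definition G6 (z : C) : C :=
  let h2 := H2 z in let h4 := H4 z in
  h2 / 2 ^ 4 * (h2 ^ 2 + h2 * h4 + h4 ^ 2).

Definition G8 (z : C) : C :=
  let h2 := H2 z in let h4 := H4 z in
  h2 ^ 3 / 2 ^ 13 * (h2 + 2 * h4).

Definition G10 (z : C) : C :=
  let h2 := H2 z in let h4 := H4 z in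
  h2 ^ 3 / (2 ^ 12 * 5) * (2 * h2 ^ 2 + 5 * h2 * h4 + 5 * h4 ^ 2).

Definition G12 (L : C -> C) (z : C) : C :=
  let h2 := H2 z in let h4 := H4 z in
  3 * Delta z * L z / (2 ^ 11 * 7)
  + 3 * h2 ^ 3 / (2 ^ 20 * 7)
    * (h2 ^ 3 + 3 * h2 ^ 2 * h4 + 3 * h2 * h4 ^ 2 + 2 * h4 ^ 3).

Definition G14 (z : C) : C :=
  let h2 := H2 z in let h4 := H4 z in
  h2 ^ 5 / (2 ^ 20 * 7) * (2 * h2 ^ 2 + 7 * h2 * h4 + 7 * h4 ^ 2).

Definition G16 (L : C -> C) (z : C) : C :=
  let h2 := H2 z in let h4 := H4 z in
  5 * E4 z * Delta z * L z / (2 ^ 18 * 11)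
  + 5 * h2 ^ 3 / (2 ^ 29 * 3 * 11)
    * (5 * h2 ^ 5 + 20 * h2 ^ 4 * h4 + 42 * h2 ^ 3 * h4 ^ 2
       + 68 * h2 ^ 2 * h4 ^ 3 + 60 * h2 * h4 ^ 4 + 24 * h4 ^ 5).

Definition G18 (L : C -> C) (z : C) : C :=
  let h2 := H2 z in let h4 := H4 z in
  - (5 * E6 z * Delta z * L z / (2 ^ 17 * 11 * 13))
  + 5 * h2 ^ 3 / (2 ^ 27 * 3 * 11 * 13)
    * (10 * h2 ^ 6 + 45 * h2 ^ 5 * h4 + 68 * h2 ^ 4 * h4 ^ 2
       + 34 * h2 ^ 3 * h4 ^ 3 - 13 * h2 ^ 2 * h4 ^ 4
       - 36 * h2 * h4 ^ 5 - 12 * h4 ^ 6).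

(* G_(w+2) from F = G_(w-2), for w = 0 mod 4, w >= 20 *)
Definition step2 (w : nat) (F : C -> C) (z : C) : C :=
  let x := INR w in
  (3 * (x - 6) * (x - 2)
     / (16 * (x - 16) * (x - 5) * (x - 4) * (x - 3)))%R
  * (((x - 9) * (x - 8) / 36)%R * E4 z * F z - serre2 (w - 2) F z).

(* G_(w+4) from F = G_w, for w = 0 mod 4, w >= 16 *)
Definition step4 (w : nat) (F : C -> C) (z : C) : C :=
  let x := INR w in
  (3 * (x - 2) * (x + 2)
     / (16 * (x - 8) * (x - 3) * (x - 1) * (x + 4)))%R
  * (((x - 4) * (x - 3) / 36)%R * E4 z * F z - serre2 w F z).

(* In both recurrences the weight grows by 4.  The value 0 for odd w and for
   w < 4 is a dummy. *)
Fixpoint G (L : C -> C) (w : nat) : C -> C :=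
  match w with
  | 4 => G4 | 6 => G6 | 8 => G8 | 10 => G10
  | 12 => G12 L | 14 => G14 | 16 => G16 L | 18 => G18 L
  | S (S (S (S v))) =>
      if Nat.eqb (Nat.modulo v 4) 0 then step4 v (G L v)
      else if Nat.eqb (Nat.modulo v 4) 2 then step2 (v + 2) (G L v)
      else fun _ => RtoC 0
  | _ => fun _ => RtoC 0
  end%nat.

(* Main.v *)
Require Import Defs.
From Stdlib Require Import Reals Arith ZArith List Permutation Lia Lra Psatz.
From Stdlib Require Import QArith Qreals FunctionalExtensionality IndefiniteDescription Classical.
From Coquelicot Require Import Coquelicot.

(* Everything is a power series with real coefficients in the nome x = q^(1/2).

   The identities between theta functions and divisor sums needed here are obtained
   without modularity: if F(x) - G(x) is unchanged by x -> x^2 it is constant, and the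
   lattice identities for theta_3(x)^2, theta_3 theta_4 and theta_2^2 (the arithmetic-
   geometric mean) describe how every function behaves under x -> x^2.  Divisor sums
   enter through a Liouville-type involution, which expresses the moments of
   theta_4 through Lambert series.

   For w = 0 mod 4 the functions satisfy d_w G_w = (w-3)/6 G_(w+2), a third-order
   modular equation with exponents 0, 1, (w-2)/4 at infinity, and
   c G_(w+6) = E_4 G_(w+2) - E_6 G_w with c > 0.  Positivity of (G_w, G_(w+2)) thus
   passes to G_(w+6) below i, where E_6 <= 0.  Above i, where E_4, E_6 >= 0, the
   equation for G_(w+4) is cooperative, so that G_(w+4), G_(w+6) keep the sign of the
   leading coefficient of G_(w+4), and this sign is positive because G_(w+6)(i) > 0.
   Finally G_(w+4) / Delta^((w+4)/12) is monotone, as its derivative is a positive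
   multiple of G_(w+6), so that G_(w+4) is positive below i as well. *)

(** * Formal power series *)

Close Scope Q_scope.
Close Scope C_scope.
Open Scope R_scope.

(** The obstacle is the end t -> 0 of the imaginary axis, where the nome tends to 1 and no expansion
    at infinity gives a sign. The sign change of E_6 at i suits both halves of the argument: below i
    both terms of E_4 G_(w+2) - E_6 G_w are nonnegative, above i all coefficients of the
    differential equation are.

    The exponents matter because G_w is divisible by q^(3/2). This excludes 0 and 1, so the leading
    term sits at (w-2)/4, and there two successive Serre derivatives multiply its coefficient by
    (w-3)/6 and (w-4)/6, both positive. The sign of that coefficient need not be computed: if it
    were negative, the cooperative argument applied to -G_w would make the Serre derivative of G_w
    negative at i as well.

    Invariance under x -> x^2 forces a series to be constant because its coefficient of index n is
    then the one of index n/2, and 0 for odd n. The arithmetic-geometric mean formulas make this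
    invariance checkable by polynomial algebra. *)

Record ps := Ps { coef :> nat -> R }.

Declare Scope ps_scope.
Delimit Scope ps_scope with ps.
Bind Scope ps_scope with ps.

Lemma ps_ext (a b : ps) : (forall n, a n = b n) -> a = b.
Proof.
  destruct a as [a], b as [b]; simpl; intro H; f_equal.
  now apply functional_extensionality.
Qed.

Definition K (r : R) : ps := Ps (fun n => if (n =? 0)%nat then r else 0).
Definition X : ps := Ps (fun n => if (n =? 1)%nat then 1 else 0).
Definition padd (a b : ps) : ps := Ps (fun n => a n + b n).
Definition popp (a : ps) : ps := Ps (fun n => - a n).
Definition psub (a b : ps) : ps := padd a (popp b).
Definition pmul (a b : ps) : ps :=
  Ps (fun n => sum_f_R0 (fun k => a k * b (n - k)%nat) n).
Fixpoint ppow (a : ps) (n : nat) : ps :=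
  match n with O => K 1 | S n => pmul a (ppow a n) end.

Infix "+" := padd : ps_scope.
Infix "*" := pmul : ps_scope.
Infix "-" := psub : ps_scope.
Notation "- x" := (popp x) : ps_scope.
Infix "^" := ppow : ps_scope.
(** Rational constants are kept apart from [K] so that [ring] can compute with coefficients in Q. *)
Definition kq (q : Q) : ps := K (Q2R q).
Notation "Q[ q ]" := (kq q%Q) (format "Q[ q ]") : ps_scope.

Lemma sum_f_R0_triangle (f : nat -> nat -> R) (n : nat) :
  sum_f_R0 (fun i => sum_f_R0 (fun j => f i j) (n - i)) n
  = sum_f_R0 (fun k => sum_f_R0 (fun i => f i (k - i)%nat) k) n.
Proof.
  induction n as [|n IH]; [reflexivity|].
  rewrite (tech5 (fun k => sum_f_R0 (fun i => f i (k - i)%nat) k)), <- IH.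
  rewrite (tech5 (fun i => sum_f_R0 (fun j => f i j) (S n - i))).
  rewrite (tech5 (fun i => f i (S n - i)%nat)).
  rewrite !Nat.sub_diag; simpl (sum_f_R0 _ 0).
  rewrite <- Rplus_assoc; f_equal.
  rewrite <- plus_sum.
  apply sum_eq; intros i Hi.
  now replace (S n - i)%nat with (S (n - i)) by lia.
Qed.

Lemma padd_comm (a b : ps) : padd a b = padd b a.
Proof. apply ps_ext; intro n; simpl; ring. Qed.

Lemma padd_assoc (a b c : ps) : padd a (padd b c) = padd (padd a b) c.
Proof. apply ps_ext; intro n; simpl; ring. Qed.

Lemma padd_0_l (a : ps) : padd (K 0) a = a.
Proof. apply ps_ext; intro n; simpl; destruct (n =? 0)%nat; ring. Qed.

Lemma padd_opp (a : ps) : padd a (popp a) = K 0.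
Proof. apply ps_ext; intro n; simpl; destruct (n =? 0)%nat; ring. Qed.

Lemma sum_f_R0_rev (f : nat -> R) (n : nat) :
  sum_f_R0 (fun k => f (n - k)%nat) n = sum_f_R0 f n.
Proof.
  induction n as [|n IH]; [reflexivity|].
  rewrite decomp_sum by lia; simpl pred.
  rewrite tech5, <- IH, Nat.sub_0_r, Rplus_comm; reflexivity.
Qed.

Lemma pmul_comm (a b : ps) : pmul a b = pmul b a.
Proof.
  apply ps_ext; intro n; simpl.
  rewrite <- sum_f_R0_rev.
  apply sum_eq; intros k Hk.
  replace (n - (n - k))%nat with k by lia; ring.
Qed.

Lemma pmul_assoc (a b c : ps) : pmul a (pmul b c) = pmul (pmul a b) c.
Proof.
  apply ps_ext; intro n; simpl.
  transitivity (sum_f_R0 (fun i => sum_f_R0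
                  (fun j => a i * (b j * c (n - i - j)%nat)) (n - i)) n).
  { apply sum_eq; intros i Hi. now rewrite scal_sum; apply sum_eq; intros; ring. }
  rewrite (sum_f_R0_triangle (fun i j => a i * (b j * c (n - i - j)%nat))).
  apply sum_eq; intros k Hk.
  rewrite Rmult_comm, scal_sum; apply sum_eq; intros i Hi.
  replace (n - i - (k - i))%nat with (n - k)%nat by lia; ring.
Qed.

Lemma pmul_distr_l (a b c : ps) : pmul (padd a b) c = padd (pmul a c) (pmul b c).
Proof.
  apply ps_ext; intro n; simpl; rewrite <- plus_sum.
  apply sum_eq; intros; ring.
Qed.

Lemma sum_f_R0_zero (f : nat -> R) (n : nat) :
  (forall k, (k <= n)%nat -> f k = 0) -> sum_f_R0 f n = 0.
Proof.
  intro H. rewrite (sum_eq f (fun _ => 0) n H), sum_cte; ring.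
Qed.

Lemma sum_f_R0_single (f : nat -> R) (n j : nat) : (j <= n)%nat ->
  (forall k, (k <= n)%nat -> k <> j -> f k = 0) -> sum_f_R0 f n = f j.
Proof.
  intros Hj H. induction n as [|n IH].
  - now replace j with 0%nat by lia.
  - rewrite tech5. destruct (Nat.eq_dec j (S n)) as [->|E].
    + rewrite sum_f_R0_zero; [ring|]; intros; apply H; lia.
    + rewrite IH, (H (S n)); [ring|lia|lia|lia|]; intros; apply H; lia.
Qed.

Lemma K_mul_coef (r : R) (a : ps) (n : nat) : pmul (K r) a n = r * a n.
Proof.
  simpl. rewrite (sum_f_R0_single _ n 0); [simpl; now rewrite Nat.sub_0_r|lia|].
  intros k _ Hk. simpl. destruct k; [easy|simpl; ring].
Qed.

Lemma pmul_1_l (a : ps) : pmul (K 1) a = a.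
Proof. apply ps_ext; intro n; rewrite K_mul_coef; ring. Qed.

Lemma ps_ring_theory :
  ring_theory (K 0) (K 1) padd pmul psub popp (@eq ps).
Proof.
  constructor; intros; auto using padd_0_l, padd_comm, padd_assoc, pmul_1_l,
    pmul_comm, pmul_assoc, pmul_distr_l, padd_opp.
Qed.

Lemma K_add (r s : R) : K (r + s) = padd (K r) (K s).
Proof. apply ps_ext; intro n; simpl; destruct (n =? 0)%nat; ring. Qed.

Lemma K_opp (r : R) : K (- r) = popp (K r).
Proof. apply ps_ext; intro n; simpl; destruct (n =? 0)%nat; ring. Qed.

Lemma K_sub (r s : R) : K (r - s) = psub (K r) (K s).
Proof. unfold Rminus, psub; now rewrite K_add, K_opp. Qed.

Lemma K_mul (r s : R) : K (r * s) = pmul (K r) (K s).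
Proof.
  apply ps_ext; intro n; rewrite K_mul_coef; simpl; destruct (n =? 0)%nat; ring.
Qed.

(** The primed operations of Q reduce fractions, which keeps the coefficients small during
    normalisation. *)
Lemma kq_morph :
  ring_morph (K 0) (K 1) padd pmul psub popp (@eq ps)
    0%Q 1%Q Qplus' Qmult' Qminus' Qopp Qeq_bool kq.
Proof.
  constructor; intros; unfold kq.
  - now rewrite RMicromega.Q2R_0.
  - now rewrite RMicromega.Q2R_1.
  - now rewrite <- K_add, <- Q2R_plus, (Qeq_eqR _ _ (Qplus'_correct x y)).
  - now rewrite <- K_sub, <- Q2R_minus, (Qeq_eqR _ _ (Qminus'_correct x y)).
  - now rewrite <- K_mul, <- Q2R_mult, (Qeq_eqR _ _ (Qmult'_correct x y)).
  - now rewrite Q2R_opp, K_opp.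
  - f_equal; apply Qeq_eqR; now apply Qeq_bool_eq.
Qed.

Lemma ppow_add (a : ps) (m n : nat) : ppow a (m + n) = pmul (ppow a m) (ppow a n).
Proof.
  induction m as [|m IH]; simpl; [now rewrite pmul_1_l|].
  now rewrite IH, pmul_assoc.
Qed.

Lemma ppow_theory : power_theory (K 1) pmul (@eq ps) N.to_nat ppow.
Proof.
  constructor; intros r [|p]; [reflexivity|].
  change (ppow r (Pos.to_nat p) = pow_pos pmul r p).
  assert (H1 : ppow r 1 = r) by (simpl; now rewrite pmul_comm, pmul_1_l).
  induction p as [p IH|p IH|]; cbn [pow_pos].
  - replace (Pos.to_nat p~1) with (1 + (Pos.to_nat p + Pos.to_nat p))%nat by lia.
    now rewrite !ppow_add, H1, IH.
  - replace (Pos.to_nat p~0) with (Pos.to_nat p + Pos.to_nat p)%nat by lia.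
    now rewrite ppow_add, IH.
  - exact H1.
Qed.

(** Separates literal weights from variable ones: [kq (Z.of_nat k # 12)] is a coefficient for [ring]
    when [k] is a numeral, and an atom otherwise. *)
Ltac closed_Z z :=
  match z with
  | Z.of_nat ?n => isnatcst n
  | _ => isZcst z
  end.

Ltac closed_Q q :=
  match q with
  | Qmake ?a ?b => closed_Z a
  | inject_Z ?a => closed_Z a
  | Qopp ?a => closed_Q a
  | Qpower ?a _ => closed_Q a
  | Qdiv ?a ?b => match closed_Q a with true => closed_Q b | _ => constr:(false) end
  | Qmult ?a ?b => match closed_Q a with true => closed_Q b | _ => constr:(false) end
  | _ => constr:(false)
  end.

Ltac ps_cst t :=
  match t with
  | kq ?q =>
      match closed_Q q with
      | true => q
      | _ => constr:(InitialRing.NotConstant)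
      end
  | _ => constr:(InitialRing.NotConstant)
  end.

Ltac ps_pow_cst t :=
  match isnatcst t with
  | true => constr:(N.of_nat t)
  | _ => constr:(InitialRing.NotConstant)
  end.

Add Ring ps_ring : ps_ring_theory
  (morphism kq_morph, constants [ps_cst], power_tac ppow_theory [ps_pow_cst]).

(** * The operators q d/dq, q -> q^2 and q -> -q *)

(** The variable is the nome x with q = x^2, so [th] is x d/dx, twice the operator D of the
    statement. *)
Definition th (a : ps) : ps := Ps (fun n => INR n * a n).
Definition V (a : ps) : ps :=
  Ps (fun n => if Nat.even n then a (Nat.div2 n) else 0).
Definition Sg (a : ps) : ps := Ps (fun n => (-1) ^ n * a n).

Lemma th_add (a b : ps) : (th (a + b) = th a + th b)%ps.
Proof. apply ps_ext; intro n; simpl; ring. Qed.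

Lemma th_opp (a : ps) : (th (- a) = - th a)%ps.
Proof. apply ps_ext; intro n; simpl; ring. Qed.

Lemma th_sub (a b : ps) : (th (a - b) = th a - th b)%ps.
Proof. unfold psub; now rewrite th_add, th_opp. Qed.

Lemma th_K (r : R) : th (K r) = K 0.
Proof. apply ps_ext; intros [|n]; simpl; ring. Qed.

Lemma th_kq (q : Q) : th (kq q) = K 0.
Proof. apply th_K. Qed.

Lemma th_mul (a b : ps) : (th (a * b) = th a * b + a * th b)%ps.
Proof.
  apply ps_ext; intro n; simpl.
  rewrite scal_sum, <- plus_sum; apply sum_eq; intros k Hk.
  rewrite (minus_INR n k Hk); ring.
Qed.

Lemma th_X : th X = X.
Proof.
  apply ps_ext; intro n; simpl; destruct (Nat.eqb_spec n 1) as [->|];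
    [simpl; ring | ring].
Qed.

Lemma V_add (a b : ps) : (V (a + b) = V a + V b)%ps.
Proof. apply ps_ext; intro n; simpl; destruct (Nat.even n); ring. Qed.

Lemma V_opp (a : ps) : (V (- a) = - V a)%ps.
Proof. apply ps_ext; intro n; simpl; destruct (Nat.even n); ring. Qed.

Lemma V_sub (a b : ps) : (V (a - b) = V a - V b)%ps.
Proof. unfold psub; now rewrite V_add, V_opp. Qed.

Lemma V_K (r : R) : V (K r) = K r.
Proof. apply ps_ext; intros [|[|n]]; simpl; try destruct (Nat.even n); reflexivity. Qed.

Lemma V_kq (q : Q) : V (kq q) = kq q.
Proof. apply V_K. Qed.

Lemma V_coef_double (a : ps) (n : nat) : V a (2 * n)%nat = a n.
Proof.
  change (V a (2 * n)%nat)
    with (if Nat.even (2 * n) then a (Nat.div2 (2 * n)) else 0).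
  now rewrite Nat.even_mul, Nat.div2_double.
Qed.

Lemma V_coef_odd (a : ps) (n : nat) : V a (S (2 * n)) = 0.
Proof.
  change (V a (S (2 * n)))
    with (if Nat.even (S (2 * n)) then a (Nat.div2 (S (2 * n))) else 0).
  now rewrite Nat.even_succ, Nat.odd_mul.
Qed.

Lemma even_odd_dec (n : nat) : {m | n = (2 * m)%nat} + {m | n = S (2 * m)}.
Proof.
  destruct (Nat.even n) eqn:E.
  - left; exists (Nat.div2 n). apply Nat.even_spec in E.
    rewrite <- Nat.double_twice. now apply Nat.Even_double.
  - right; exists (Nat.div2 n).
    assert (O : Nat.Odd n) by (apply Nat.odd_spec; now rewrite <- Nat.negb_even, E).
    rewrite <- Nat.double_twice. now apply Nat.Odd_double.
Qed.

Lemma sum_f_R0_evens (f : nat -> R) (m : nat) :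
  (forall k, f (S (2 * k)%nat) = 0) ->
  sum_f_R0 f (2 * m)%nat = sum_f_R0 (fun k => f (2 * k)%nat) m.
Proof.
  intro H. induction m as [|m IH]; [reflexivity|].
  replace (2 * S m)%nat with (S (S (2 * m))) by lia.
  rewrite !tech5, IH, H. replace (2 * S m)%nat with (S (S (2 * m))) by lia. ring.
Qed.

Lemma V_mul (a b : ps) : (V (a * b) = V a * V b)%ps.
Proof.
  apply ps_ext; intro n.
  destruct (even_odd_dec n) as [[m ->]|[m ->]].
  - rewrite V_coef_double. change ((a * b)%ps m) with (sum_f_R0 (fun k => a k * b (m - k)%nat) m).
    change ((V a * V b)%ps (2 * m)%nat) with
      (sum_f_R0 (fun k => V a k * V b (2 * m - k)%nat) (2 * m)).
    rewrite sum_f_R0_evens.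
    + apply sum_eq; intros k Hk.
      replace (2 * m - 2 * k)%nat with (2 * (m - k))%nat by lia.
      now rewrite !V_coef_double.
    + intro k. rewrite V_coef_odd; ring.
  - rewrite V_coef_odd. symmetry. apply sum_f_R0_zero. intros k Hk.
    destruct (even_odd_dec k) as [[j ->]|[j ->]].
    + replace (S (2 * m) - 2 * j)%nat with (S (2 * (m - j))) by lia.
      rewrite V_coef_odd; ring.
    + rewrite V_coef_odd; ring.
Qed.

Lemma V_pow (a : ps) (n : nat) : V (a ^ n)%ps = (V a ^ n)%ps.
Proof. induction n as [|n IH]; simpl; [apply V_K|now rewrite V_mul, IH]. Qed.

Lemma V_X : V X = (X ^ 2)%ps.
Proof.
  apply ps_ext; intro n. simpl ppow.
  replace (X * (X * K 1))%ps with (X * X)%ps by ring.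
  destruct (even_odd_dec n) as [[m ->]|[m ->]].
  - rewrite V_coef_double. symmetry. destruct m as [|m]; [simpl; ring|].
    unfold pmul, coef at 1. rewrite (sum_f_R0_single _ _ 1); [|lia|].
    + simpl. destruct m; simpl; [ring|].
      replace (m + S (S (m + 0)))%nat with (S (S (m + m))) by lia. simpl; ring.
    + intros k _ Hk. simpl. destruct (Nat.eqb_spec k 1); [easy|ring].
  - rewrite V_coef_odd. symmetry. destruct m as [|m]; [simpl; ring|].
    unfold pmul, coef at 1. rewrite (sum_f_R0_single _ _ 1); [|lia|].
    + simpl. replace (m + S (m + 0))%nat with (S (m + m)) by lia. simpl; ring.
    + intros k _ Hk. simpl. destruct (Nat.eqb_spec k 1); [easy|ring].
Qed.

Lemma V_inj (a b : ps) : V a = V b -> a = b.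
Proof.
  intro H; apply ps_ext; intro n.
  now rewrite <- (V_coef_double a), H, V_coef_double.
Qed.

Lemma th_V (a : ps) : th (V a) = (Q[2] * V (th a))%ps.
Proof.
  apply ps_ext; intro n. unfold kq; rewrite K_mul_coef.
  destruct (even_odd_dec n) as [[m ->]|[m ->]].
  - unfold th at 1, coef at 1. rewrite !V_coef_double.
    unfold th, coef at 2. rewrite mult_INR. unfold Q2R; simpl; field.
  - unfold th at 1, coef at 1. rewrite !V_coef_odd; ring.
Qed.

Lemma Sg_add (a b : ps) : (Sg (a + b) = Sg a + Sg b)%ps.
Proof. apply ps_ext; intro n; simpl; ring. Qed.

Lemma Sg_X : (Sg X = - X)%ps.
Proof. apply ps_ext; intros [|[|n]]; simpl; ring. Qed.

Lemma Sg_mul (a b : ps) : (Sg (a * b) = Sg a * Sg b)%ps.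
Proof.
  apply ps_ext; intro n; simpl.
  rewrite scal_sum; apply sum_eq; intros k Hk.
  replace ((-1) ^ n) with ((-1) ^ k * (-1) ^ (n - k)) by
    (rewrite <- pow_add; f_equal; lia).
  ring.
Qed.

Lemma Sg_V (a : ps) : Sg (V a) = V a.
Proof.
  apply ps_ext; intro n.
  destruct (even_odd_dec n) as [[m ->]|[m ->]]; unfold Sg, coef at 1.
  - rewrite pow_1_even; ring.
  - rewrite V_coef_odd; ring.
Qed.

Lemma Sg_Sg (a : ps) : Sg (Sg a) = a.
Proof.
  apply ps_ext; intro n; simpl. rewrite <- Rmult_assoc, <- Rpow_mult_distr.
  replace (-1 * -1) with 1 by ring. rewrite pow1; ring.
Qed.

Lemma th_Sg (a : ps) : th (Sg a) = Sg (th a).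
Proof. apply ps_ext; intro n; simpl; ring. Qed.

Lemma pmul_coef_0 (a b : ps) : (a * b)%ps 0%nat = a 0%nat * b 0%nat.
Proof. reflexivity. Qed.

Lemma ppow_coef_0 (a : ps) (n : nat) : (a ^ n)%ps 0%nat = a 0%nat ^ n.
Proof. induction n as [|n IH]; [reflexivity|]. simpl ppow. now rewrite pmul_coef_0, IH. Qed.

Lemma pmul_eq_0 (a b : ps) : a 0%nat <> 0 -> (a * b)%ps = K 0 -> b = K 0.
Proof.
  intros Ha H. apply ps_ext; intro n.
  induction n as [n IH] using lt_wf_ind.
  assert (E : (a * b)%ps n = K 0 n) by now rewrite H.
  unfold pmul, coef at 1 in E.
  rewrite (sum_f_R0_single _ n 0) in E; [|lia|].
  - rewrite Nat.sub_0_r in E. replace (K 0 n) with 0 in * by (simpl; now destruct n).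
    now apply Rmult_integral in E as [E|E].
  - intros k Hk Hk0. rewrite IH by lia.
    simpl. destruct (n - k =? 0)%nat; ring.
Qed.

Lemma pmul_cancel (a b c : ps) : a 0%nat <> 0 -> (a * b)%ps = (a * c)%ps -> b = c.
Proof.
  intros Ha H. assert (E : (b - c)%ps = K 0).
  { apply (pmul_eq_0 a); [exact Ha|].
    transitivity (a * b - a * c)%ps; [ring|rewrite H; ring]. }
  transitivity (b - c + c)%ps; [ring|rewrite E; ring].
Qed.

(** Coefficient n of [V a] is [a (n/2)] for even n and 0 for odd n. So every [a n] with n > 0 is a
    multiple of an earlier coefficient, and the descent ends at [a 0 = 0]. *)
Lemma V_eigen (c : R) (a : ps) :
  c <> 0 -> V a = (K c * a)%ps -> a 0%nat = 0 -> a = K 0.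
Proof.
  intros Hc H H0. apply ps_ext; intro n.
  replace (K 0 n) with 0 by (simpl; now destruct n).
  induction n as [n IH] using lt_wf_ind.
  destruct n as [|n]; [exact H0|].
  assert (E : V a (S n) = c * a (S n)) by now rewrite H, K_mul_coef.
  destruct (even_odd_dec (S n)) as [[m Hm]|[m Hm]].
  - rewrite Hm in E at 1. rewrite V_coef_double, (IH m) in E by lia.
    symmetry in E. now apply Rmult_integral in E as [E|E].
  - rewrite Hm in E at 1. rewrite V_coef_odd in E.
    symmetry in E. now apply Rmult_integral in E as [E|E].
Qed.

(** The substitute for modularity: an identity is proved by computing the effect of [V] on both
    sides and comparing constant terms. *)
Lemma V_fixed (a b : ps) : V (a - b)%ps = (a - b)%ps -> a 0%nat = b 0%nat -> a = b.
Proof.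
  intros H H0. assert (E : (a - b)%ps = K 0).
  { apply (V_eigen 1); [lra| |simpl; lra]. rewrite H; ring. }
  transitivity (a - b + b)%ps; [ring|rewrite E; ring].
Qed.

(* A V-invariant quotient [a/h] with [h] of order 1 and [a] of order >= 2
   vanishes: the two sides would have orders [m + 2] and [2 m + 1]. *)
Lemma V_quotient (a h : ps) : (a * V h = V a * h)%ps ->
  h 0%nat = 0 -> h 1%nat <> 0 -> a 0%nat = 0 -> a 1%nat = 0 -> a = K 0.
Proof.
  intros H h0 h1 a0 a1. apply ps_ext; intro n.
  replace (K 0 n) with 0 by (simpl; now destruct n).
  induction n as [n IH] using lt_wf_ind.
  destruct n as [|[|m]]; [exact a0|exact a1|].
  set (n := S (S m)) in *.
  assert (E : (a * V h)%ps (n + 2)%nat = (V a * h)%ps (n + 2)%nat) by now rewrite H.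
  unfold pmul, coef at 1 4 in E.
  rewrite (sum_f_R0_single _ _ n), (sum_f_R0_zero (fun k => V a k * _)) in E.
  - replace (n + 2 - n)%nat with (2 * 1)%nat in E by lia.
    rewrite V_coef_double in E. now apply Rmult_integral in E as [E|E].
  - intros k Hk. destruct (Nat.eq_dec k (n + 2)) as [->|].
    + rewrite Nat.sub_diag, h0; ring.
    + destruct (even_odd_dec k) as [[j ->]|[j ->]].
      * rewrite V_coef_double, IH; [ring|unfold n in *; lia].
      * rewrite V_coef_odd; ring.
  - lia.
  - intros k Hk Hkn. destruct (lt_dec k n) as [L|L]; [rewrite IH by exact L; ring|].
    assert (k = S n \/ k = n + 2)%nat as [->| ->] by lia.
    + replace (n + 2 - S n)%nat with (S (2 * 0)) by lia. rewrite V_coef_odd; ring.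
    + rewrite Nat.sub_diag. change (V h 0%nat) with (h 0%nat). rewrite h0; ring.
Qed.

(** * Generating series over finite fibres *)

Definition sumL {A : Type} (l : list A) (f : A -> R) : R :=
  fold_right (fun x s => f x + s) 0 l.

Lemma sumL_perm {A : Type} (l l' : list A) (f : A -> R) :
  Permutation l l' -> sumL l f = sumL l' f.
Proof. induction 1; simpl; lra. Qed.

Lemma sumL_app {A : Type} (l l' : list A) (f : A -> R) :
  sumL (l ++ l') f = sumL l f + sumL l' f.
Proof. induction l; simpl; lra. Qed.

Lemma sumL_ext {A : Type} (l : list A) (f g : A -> R) :
  (forall x, In x l -> f x = g x) -> sumL l f = sumL l g.
Proof.
  intro H; induction l as [|x l IH]; [reflexivity|]; simpl.
  rewrite H, IH by (try intros; try apply H; simpl; auto); reflexivity.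
Qed.

Lemma sumL_map {A B : Type} (h : A -> B) (l : list A) (f : B -> R) :
  sumL (map h l) f = sumL l (fun x => f (h x)).
Proof. induction l; simpl; lra. Qed.

Lemma sumL_plus {A : Type} (l : list A) (f g : A -> R) :
  sumL l (fun x => f x + g x) = sumL l f + sumL l g.
Proof. induction l; simpl; lra. Qed.

Lemma sumL_scal {A : Type} (l : list A) (r : R) (f : A -> R) :
  sumL l (fun x => r * f x) = r * sumL l f.
Proof. induction l; simpl; lra. Qed.

Lemma sumL_filter {A : Type} (l : list A) (p : A -> bool) (f : A -> R) :
  (forall x, p x = false -> f x = 0) -> sumL (filter p l) f = sumL l f.
Proof.
  intro H; induction l as [|x l IH]; [reflexivity|]; simpl.
  destruct (p x) eqn:E; simpl; [lra|rewrite (H x E); lra].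
Qed.

Lemma sumL_list_prod {A B : Type} (l : list A) (l' : list B) (f : A -> R) (g : B -> R) :
  sumL (list_prod l l') (fun p => f (fst p) * g (snd p)) = sumL l f * sumL l' g.
Proof.
  induction l as [|x l IH]; simpl; [ring|].
  rewrite sumL_app, IH, sumL_map; simpl. rewrite (sumL_scal l' (f x)). ring.
Qed.

Lemma sumL_seq (f : nat -> R) (n : nat) : sumL (seq 0 (S n)) f = sum_f_R0 f n.
Proof.
  induction n as [|n IH]; [simpl; ring|].
  rewrite (seq_S (S n)), sumL_app, IH, tech5; simpl; ring.
Qed.

Lemma NoDup_list_prod {A B : Type} (l : list A) (l' : list B) :
  NoDup l -> NoDup l' -> NoDup (list_prod l l').
Proof.
  intros Hl Hl'. induction Hl as [|x l Hx Hl IH]; simpl; [constructor|].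
  apply NoDup_app; [|exact IH|].
  - apply FinFun.Injective_map_NoDup; [|exact Hl']. intros y z E; now inversion E.
  - intros p Hp1 Hp2. apply in_map_iff in Hp1 as [y [<- _]].
    apply in_prod_iff in Hp2 as [Hp2 _]. now apply Hx.
Qed.

(* [gs s c a] encodes [a = sum_x c(x) X^s(x)]. *)
Definition gs {A : Type} (s : A -> nat) (c : A -> R) (a : ps) : Prop :=
  forall n, exists l, NoDup l /\ (forall x, In x l <-> s x = n) /\ a n = sumL l c.

(** Turns bijections of index sets into identities of series: once both sides are indexed by the
    same set, only exponents and weights remain to be compared. *)
Lemma gs_unique {A : Type} (s : A -> nat) (c : A -> R) (a b : ps) :
  gs s c a -> gs s c b -> a = b.
Proof.
  intros Ha Hb; apply ps_ext; intro n.
  destruct (Ha n) as [l [Nl [Il ->]]], (Hb n) as [l' [Nl' [Il' ->]]].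
  apply sumL_perm, NoDup_Permutation; auto. intro x; now rewrite Il, Il'.
Qed.

Lemma gs_ext {A : Type} (s s' : A -> nat) (c c' : A -> R) (a : ps) :
  (forall x, s x = s' x) -> (forall x, c x = c' x) -> gs s c a -> gs s' c' a.
Proof.
  intros Hs Hc H n. destruct (H n) as [l [Nl [Il E]]]. exists l. split; [exact Nl|].
  split; [intro x; now rewrite Il, Hs|]. rewrite E. apply sumL_ext; auto.
Qed.

Lemma gs_weight_add {A : Type} (s : A -> nat) (c c' : A -> R) (a b : ps) :
  gs s c a -> gs s c' b -> gs s (fun x => c x + c' x) (a + b)%ps.
Proof.
  intros Ha Hb n.
  destruct (Ha n) as [l [Nl [Il E]]], (Hb n) as [l' [Nl' [Il' E']]].
  exists l. do 2 (split; [assumption|]). simpl. rewrite sumL_plus, E, E'. f_equal.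
  apply sumL_perm, NoDup_Permutation; auto. intro x; now rewrite Il, Il'.
Qed.

Lemma gs_scal {A : Type} (s : A -> nat) (r : R) (c : A -> R) (a : ps) :
  gs s c a -> gs s (fun x => r * c x) (K r * a)%ps.
Proof.
  intros Ha n. destruct (Ha n) as [l [Nl [Il E]]].
  exists l. do 2 (split; [assumption|]). now rewrite K_mul_coef, E, sumL_scal.
Qed.

(** Reindexing by an injection whose image contains every index of nonzero weight; this is how
    indices of weight 0 are dropped. *)
Lemma gs_embed {A B : Type} (h : B -> A) (h' : A -> B)
    (s : A -> nat) (c : A -> R) (a : ps) :
  (forall x y : A, {x = y} + {x <> y}) ->
  (forall y, h' (h y) = y) -> (forall x, c x = 0 \/ h (h' x) = x) ->
  gs s c a -> gs (fun y => s (h y)) (fun y => c (h y)) a.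
Proof.
  intros dec Hh Hc Ha n. destruct (Ha n) as [l [Nl [Il E]]].
  set (p := fun x => if dec (h (h' x)) x then true else false).
  assert (Hp : forall x, p x = true <-> h (h' x) = x).
  { intro x; unfold p; destruct (dec (h (h' x)) x); split; easy. }
  exists (map h' (filter p l)). split; [|split].
  - apply NoDup_map_NoDup_ForallPairs; [|now apply NoDup_filter].
    intros x y Hx Hy Exy. apply filter_In in Hx as [_ Hx], Hy as [_ Hy].
    rewrite Hp in Hx, Hy. congruence.
  - intro y. rewrite in_map_iff. split.
    + intros [x [<- Hx]]. apply filter_In in Hx as [Hx1 Hx2].
      rewrite Hp in Hx2. rewrite Hx2. now apply Il.
    + intro Hy. exists (h y). split; [apply Hh|]. apply filter_In.
      rewrite Il, Hp, Hh. now split.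
  - rewrite E, sumL_map, <- (sumL_filter l p).
    + apply sumL_ext. intros x Hx. apply filter_In in Hx as [_ Hx].
      rewrite Hp in Hx. now rewrite Hx.
    + intros x Hx. destruct (Hc x) as [H0|H0]; [exact H0|].
      apply Hp in H0. congruence.
Qed.

Lemma gs_bij {A B : Type} (h : B -> A) (h' : A -> B)
    (s : A -> nat) (c : A -> R) (a : ps) :
  (forall y, h' (h y) = y) -> (forall x, h (h' x) = x) ->
  gs s c a -> gs (fun y => s (h y)) (fun y => c (h y)) a.
Proof.
  intros Hh Hh' Ha n. destruct (Ha n) as [l [Nl [Il E]]].
  exists (map h' l). split; [|split].
  - apply FinFun.Injective_map_NoDup; [|exact Nl]. intros x y Exy; congruence.
  - intro y. rewrite in_map_iff. split.
    + intros [x [<- Hx]]. rewrite Hh'. now apply Il.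
    + intro Hy. exists (h y). now rewrite Il.
  - rewrite E, sumL_map. apply sumL_ext. intros x _. now rewrite Hh'.
Qed.

(** Reindexing by [t] gives a = -a. Fixed points of [t] are harmless, since their weight is its own
    negative. *)
Lemma gs_involution {A : Type} (t : A -> A) (s : A -> nat) (c : A -> R) (a : ps) :
  (forall x, t (t x) = x) -> (forall x, s (t x) = s x) -> (forall x, c (t x) = - c x) ->
  gs s c a -> a = K 0.
Proof.
  intros Ht Hs Hc Ha.
  assert (E : a = (Q[-1] * a)%ps).
  { apply (gs_unique s (fun x => Q2R (-1) * c x)); [|now apply gs_scal].
    apply (gs_ext (fun x => s (t x)) s (fun x => c (t x)));
      [exact Hs| |now apply (gs_bij t t)].
    intro x; rewrite Hc; unfold Q2R; simpl; field. }
  apply ps_ext; intro n.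
  assert (E' : a n = Q2R (-1) * a n) by (rewrite E at 1; apply K_mul_coef).
  unfold Q2R in E'; simpl in *. destruct (n =? 0)%nat; lra.
Qed.

Definition sum_elim {A B C : Type} (f : A -> C) (g : B -> C) (x : A + B) : C :=
  match x with inl a => f a | inr b => g b end.

Lemma gs_sum {A B : Type} (s : A -> nat) (s' : B -> nat) (c : A -> R) (c' : B -> R)
    (a b : ps) :
  gs s c a -> gs s' c' b -> gs (sum_elim s s') (sum_elim c c') (a + b)%ps.
Proof.
  intros Ha Hb n.
  destruct (Ha n) as [l [Nl [Il E]]], (Hb n) as [l' [Nl' [Il' E']]].
  exists (map inl l ++ map inr l'). split; [|split].
  - apply NoDup_app.
    + apply FinFun.Injective_map_NoDup; [|exact Nl]. intros x y Exy; congruence.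
    + apply FinFun.Injective_map_NoDup; [|exact Nl']. intros x y Exy; congruence.
    + intros x Hx Hx'. apply in_map_iff in Hx as [y [<- _]], Hx' as [z [Hz _]]; easy.
  - intros [x|x]; rewrite in_app_iff, !in_map_iff; simpl.
    + rewrite <- Il. split; [intros [[y [H1 H2]]|[y [H1 H2]]]; congruence|eauto].
    + rewrite <- Il'. split; [intros [[y [H1 H2]]|[y [H1 H2]]]; congruence|eauto].
  - simpl. now rewrite sumL_app, !sumL_map, E, E'.
Qed.

Lemma gs_mul {A B : Type} (s : A -> nat) (s' : B -> nat) (c : A -> R) (c' : B -> R)
    (a b : ps) :
  gs s c a -> gs s' c' b ->
  gs (fun p => s (fst p) + s' (snd p))%nat (fun p => c (fst p) * c' (snd p)) (a * b)%ps.
Proof.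
  intros Ha Hb n.
  enough (H : forall m, (m <= n)%nat -> exists l, NoDup l /\
    (forall p : A * B, In p l <-> (s (fst p) + s' (snd p) = n /\ s (fst p) <= m)%nat) /\
    sum_f_R0 (fun k => a k * b (n - k)%nat) m = sumL l (fun p => c (fst p) * c' (snd p))).
  { destruct (H n (le_n n)) as [l [Nl [Il E]]]. exists l. split; [exact Nl|].
    split; [intro p; rewrite Il; lia|exact E]. }
  assert (L : forall m, exists l, NoDup l /\
    (forall p : A * B, In p l <-> s (fst p) = m /\ s' (snd p) = (n - m)%nat) /\
    a m * b (n - m)%nat = sumL l (fun p => c (fst p) * c' (snd p))).
  { intro m.
    destruct (Ha m) as [l [Nl [Il E]]], (Hb (n - m)%nat) as [l' [Nl' [Il' E']]].
    exists (list_prod l l'). split; [now apply NoDup_list_prod|]. split.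
    - intros [x y]. now rewrite in_prod_iff, Il, Il'.
    - now rewrite sumL_list_prod, E, E'. }
  intro m; induction m as [|m IH]; intro Hm.
  - destruct (L 0%nat) as [l [Nl [Il E]]]. exists l. split; [exact Nl|].
    split; [intro p; rewrite Il; lia|exact E].
  - destruct (IH ltac:(lia)) as [l [Nl [Il E]]], (L (S m)) as [l' [Nl' [Il' E']]].
    exists (l ++ l'). split; [|split].
    + apply NoDup_app; auto. intros p. rewrite Il, Il'. lia.
    + intro p. rewrite in_app_iff, Il, Il'. lia.
    + now rewrite tech5, sumL_app, E, E'.
Qed.

Lemma gs_V {A : Type} (s : A -> nat) (c : A -> R) (a : ps) :
  gs s c a -> gs (fun x => 2 * s x)%nat c (V a).
Proof.
  intros Ha n. destruct (even_odd_dec n) as [[m ->]|[m ->]].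
  - destruct (Ha m) as [l [Nl [Il E]]]. exists l. split; [exact Nl|].
    split; [intro x; rewrite Il; lia|now rewrite V_coef_double].
  - exists nil. split; [constructor|]. split; [intro x; simpl; lia|].
    now rewrite V_coef_odd.
Qed.

Lemma X_mul_coef (a : ps) (n : nat) :
  (X * a)%ps n = match n with O => 0 | S m => a m end.
Proof.
  destruct n as [|n]; [simpl; ring|].
  unfold pmul, coef at 1. rewrite (sum_f_R0_single _ _ 1); [|lia|].
  - simpl. rewrite Nat.sub_0_r. ring.
  - intros k _ Hk. simpl. destruct (Nat.eqb_spec k 1); [easy|ring].
Qed.

Lemma gs_X {A : Type} (s : A -> nat) (c : A -> R) (a : ps) :
  gs s c a -> gs (fun x => S (s x)) c (X * a)%ps.
Proof.
  intros Ha [|n].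
  - exists nil. split; [constructor|]. split; [intro x; simpl; lia|].
    now rewrite X_mul_coef.
  - destruct (Ha n) as [l [Nl [Il E]]]. exists l. split; [exact Nl|].
    split; [intro x; rewrite Il; lia|now rewrite X_mul_coef].
Qed.

Lemma gs_th {A : Type} (s : A -> nat) (c : A -> R) (a : ps) :
  gs s c a -> gs s (fun x => INR (s x) * c x) (th a).
Proof.
  intros Ha n. destruct (Ha n) as [l [Nl [Il E]]]. exists l.
  do 2 (split; [assumption|]). simpl. rewrite E, <- sumL_scal.
  apply sumL_ext; intros x Hx. apply Il in Hx. now rewrite Hx.
Qed.

Lemma gs_Sg {A : Type} (s : A -> nat) (c : A -> R) (a : ps) :
  gs s c a -> gs s (fun x => (-1) ^ s x * c x) (Sg a).
Proof.
  intros Ha n. destruct (Ha n) as [l [Nl [Il E]]]. exists l.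
  do 2 (split; [assumption|]). simpl. rewrite E, <- sumL_scal.
  apply sumL_ext; intros x Hx. apply Il in Hx. now rewrite Hx.
Qed.

(** The sum stops at m = n, so it exhausts the fibre of [s] over n only if [m <= s m], as [gs_lac]
    assumes. *)
Definition lac (s : nat -> nat) (c : nat -> R) : ps :=
  Ps (fun n => sum_f_R0 (fun m => if (s m =? n)%nat then c m else 0) n).

Lemma gs_lac (s : nat -> nat) (c : nat -> R) :
  (forall m, (m <= s m)%nat) -> gs s c (lac s c).
Proof.
  intros Hs n. exists (filter (fun m => s m =? n)%nat (seq 0 (S n))). split; [|split].
  - apply NoDup_filter, seq_NoDup.
  - intro m. rewrite filter_In, in_seq, Nat.eqb_eq. specialize (Hs m). lia.
  - simpl coef. rewrite <- sumL_seq.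
    rewrite <- (sumL_filter _ (fun m => s m =? n)%nat).
    + apply sumL_ext. intros m Hm. apply filter_In in Hm as [_ Hm]. now rewrite Hm.
    + intros m Hm. now rewrite Hm.
Qed.

(** There are k + 1 pairs with sum k, which absorbs the factor [INR (S k)]. It serves to count the
    fixed triples in [liouville]. *)
Lemma gs_antidiagonal (s : nat -> nat) (c : nat -> R) (a : ps) :
  gs s (fun k => INR (S k) * c k) a ->
  gs (fun p => s (fst p + snd p)%nat) (fun p => c (fst p + snd p)%nat) a.
Proof.
  intros Ha n. destruct (Ha n) as [l [Nl [Il E]]].
  set (d := fun k => map (fun i => (i, k - i)%nat) (seq 0 (S k))).
  assert (Hd : forall k p, In p (d k) <-> (fst p + snd p = k)%nat).
  { intros k [i j]. unfold d. rewrite in_map_iff. cbn [fst snd]. split.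
    - intros [x [Ex Hx]]. apply in_seq in Hx. inversion Ex; lia.
    - intro H. exists i. split; [f_equal; lia|apply in_seq; lia]. }
  exists (flat_map d l). split; [|split].
  - clear Il E. induction Nl as [|k l Hk Nl IH]; [constructor|].
    change (flat_map d (k :: l)) with (d k ++ flat_map d l).
    apply NoDup_app; [|exact IH|].
    + apply FinFun.Injective_map_NoDup; [|apply seq_NoDup]. intros i j H; congruence.
    + intros p Hp Hp'. apply Hd in Hp. apply in_flat_map in Hp' as [k' [Hk' Hp']].
      apply Hd in Hp'. congruence.
  - intro p. rewrite in_flat_map. split.
    + intros [k [Hk Hp]]. apply Hd in Hp. apply Il in Hk. congruence.
    + intro H. exists (fst p + snd p)%nat. split; [now apply Il|now apply Hd].
  - rewrite E. clear Il E Nl. induction l as [|k l IH]; [reflexivity|].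
    change (flat_map d (k :: l)) with (d k ++ flat_map d l).
    rewrite sumL_app, <- IH. cbn [sumL fold_right]. f_equal.
    rewrite (sumL_ext (d k) _ (fun _ => c k)).
    + unfold d. rewrite sumL_map, sumL_seq, sum_cte. ring.
    + intros p Hp. apply Hd in Hp. now rewrite Hp.
Qed.

(** The same splitting of Z as in [CSeriesZ], so that [lacZ] evaluates to such a series half by
    half. *)
Definition Z_of_sum (x : nat + nat) : Z :=
  match x with inl n => Z.of_nat n | inr n => (- Z.of_nat (S n))%Z end.

Definition sum_of_Z (k : Z) : nat + nat :=
  if (0 <=? k)%Z then inl (Z.to_nat k) else inr (Z.to_nat (- k - 1)).

Lemma Z_of_sum_of_Z (k : Z) : Z_of_sum (sum_of_Z k) = k.
Proof. unfold sum_of_Z. destruct (Z.leb_spec 0 k); cbn [Z_of_sum]; lia. Qed.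

Lemma sum_of_Z_of_sum (x : nat + nat) : sum_of_Z (Z_of_sum x) = x.
Proof.
  unfold sum_of_Z. destruct x as [n|n]; cbn [Z_of_sum].
  - destruct (Z.leb_spec 0 (Z.of_nat n)); [f_equal; lia|lia].
  - destruct (Z.leb_spec 0 (- Z.of_nat (S n))); [lia|f_equal; lia].
Qed.

Lemma gs_lacZ (s : Z -> nat) (c : Z -> R) :
  (forall m, (m <= s (Z.of_nat m))%nat) -> (forall m, (m <= s (- Z.of_nat (S m))%Z)%nat) ->
  gs s c (lac (fun m => s (Z.of_nat m)) (fun m => c (Z.of_nat m))
          + lac (fun m => s (- Z.of_nat (S m))%Z) (fun m => c (- Z.of_nat (S m))%Z))%ps.
Proof.
  intros H1 H2.
  pose proof (gs_sum _ _ _ _ _ _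
    (gs_lac _ (fun m => c (Z.of_nat m)) H1)
    (gs_lac _ (fun m => c (- Z.of_nat (S m))%Z) H2)) as H.
  apply (gs_bij sum_of_Z Z_of_sum) in H; auto using Z_of_sum_of_Z, sum_of_Z_of_sum.
  revert H. apply gs_ext; intro k;
    rewrite <- (Z_of_sum_of_Z k) at 2; now destruct (sum_of_Z k).
Qed.

(** * Theta functions and lattice identities *)

Definition lacZ (s : Z -> nat) (c : Z -> R) : ps :=
  (lac (fun m => s (Z.of_nat m)) (fun m => c (Z.of_nat m))
   + lac (fun m => s (- Z.of_nat (S m))%Z) (fun m => c (- Z.of_nat (S m))%Z))%ps.

Definition sq (k : Z) : nat := Z.to_nat (k * k).
Definition tri (k : Z) : nat := Z.to_nat (k * (k + 1) / 2).
Definition sgn (k : Z) : R := if Z.even k then 1 else -1.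

(** In the nome, theta_3 is [phi], theta_4 is [Sg phi], and theta_2 is x^(1/4) times [V psi]. Since
    [psi] runs over all of Z, each triangular number counts twice. *)
Definition phi : ps := lacZ sq (fun _ => 1).
Definition psi : ps := lacZ tri (fun _ => 1).

Lemma sq_Z (k : Z) : Z.of_nat (sq k) = (k * k)%Z.
Proof. unfold sq; apply Z2Nat.id; nia. Qed.

Lemma tri_Z (k : Z) : (2 * Z.of_nat (tri k) = k * (k + 1))%Z.
Proof.
  unfold tri. destruct (Z.Even_or_Odd k) as [[j ->]|[j ->]].
  - replace (2 * j * (2 * j + 1))%Z with (j * (2 * j + 1) * 2)%Z by ring.
    rewrite Z.div_mul by lia. rewrite Z2Nat.id by (destruct (Z.le_gt_cases 0 j); nia). ring.
  - replace ((2 * j + 1) * (2 * j + 1 + 1))%Z with ((2 * j + 1) * (j + 1) * 2)%Z by ring.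
    rewrite Z.div_mul by lia. rewrite Z2Nat.id by (destruct (Z.le_gt_cases 0 j); nia). ring.
Qed.

Lemma sgn_add (a b : Z) : sgn (a + b) = sgn a * sgn b.
Proof.
  unfold sgn; rewrite Z.even_add; destruct (Z.even a), (Z.even b); simpl; ring.
Qed.

Lemma sgn_opp (a : Z) : sgn (- a) = sgn a.
Proof. unfold sgn; now rewrite Z.even_opp. Qed.

Lemma sgn_sub (a b : Z) : sgn (a - b) = sgn a * sgn b.
Proof. unfold Z.sub; now rewrite sgn_add, sgn_opp. Qed.

Lemma sgn_double (a : Z) : sgn (2 * a) = 1.
Proof. unfold sgn. now rewrite Z.even_mul. Qed.

Lemma pow_m1_sq (k : Z) : (-1) ^ sq k = sgn k.
Proof.
  assert (H : forall n, (-1) ^ n = sgn (Z.of_nat n)).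
  { induction n as [|n IH]; [reflexivity|].
    rewrite Nat2Z.inj_succ. unfold Z.succ. rewrite sgn_add, <- IH.
    change (sgn 1) with (-1). simpl; ring. }
  rewrite H, sq_Z. unfold sgn. rewrite Z.even_mul. now destruct (Z.even k).
Qed.

Lemma le_sq_pos (m : nat) : (m <= sq (Z.of_nat m))%nat.
Proof. pose proof (sq_Z (Z.of_nat m)); nia. Qed.

Lemma le_sq_neg (m : nat) : (m <= sq (- Z.of_nat (S m)))%nat.
Proof. pose proof (sq_Z (- Z.of_nat (S m))); nia. Qed.

Lemma le_tri_pos (m : nat) : (m <= tri (Z.of_nat m))%nat.
Proof. pose proof (tri_Z (Z.of_nat m)); nia. Qed.

Lemma le_tri_neg (m : nat) : (m <= tri (- Z.of_nat (S m)))%nat.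
Proof. pose proof (tri_Z (- Z.of_nat (S m))); nia. Qed.

Lemma gs_phi : gs sq (fun _ => 1) phi.
Proof. apply gs_lacZ; auto using le_sq_pos, le_sq_neg. Qed.

Lemma gs_Sg_phi : gs sq sgn (Sg phi).
Proof.
  generalize (gs_Sg _ _ _ gs_phi). apply gs_ext; [easy|].
  intro k; rewrite pow_m1_sq; ring.
Qed.

Lemma gs_psi : gs tri (fun _ => 1) psi.
Proof. apply gs_lacZ; auto using le_tri_pos, le_tri_neg. Qed.

Ltac Zify.zify_post_hook ::= Z.to_euclidean_division_equations.

(* The pairs [(m, n)] with [m + n] even, resp. odd. *)
Definition lattice (x : Z * Z + Z * Z) : Z * Z :=
  match x with
  | inl (a, b) => (a + b, a - b)%Z
  | inr (a, b) => (a + b + 1, a - b)%Z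
  end.

Definition lattice_inv (p : Z * Z) : Z * Z + Z * Z :=
  let (m, n) := p in
  if ((m + n) mod 2 =? 0)%Z then inl ((m + n) / 2, (m - n) / 2)%Z
  else inr ((m + n - 1) / 2, (m - n - 1) / 2)%Z.

Lemma lattice_inv_l (x : Z * Z + Z * Z) : lattice_inv (lattice x) = x.
Proof.
  destruct x as [[a b]|[a b]]; unfold lattice, lattice_inv.
  - destruct (Z.eqb_spec ((a + b + (a - b)) mod 2) 0); [|lia].
    f_equal; f_equal; lia.
  - destruct (Z.eqb_spec ((a + b + 1 + (a - b)) mod 2) 0); [lia|].
    f_equal; f_equal; lia.
Qed.

Lemma lattice_inv_r (p : Z * Z) : lattice (lattice_inv p) = p.
Proof.
  destruct p as [m n]; unfold lattice_inv.
  destruct (Z.eqb_spec ((m + n) mod 2) 0); unfold lattice; f_equal; lia.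
Qed.

(** For m = a + b, n = a - b one has m^2 + n^2 = 2 (a^2 + b^2); for m = a + b + 1, n = a - b it is 1
    + 4 (tri a + tri b). The two parity classes give theta_3(x^2)^2 and theta_2(x^2)^2. *)
Lemma phi_sqr : (phi * phi = V phi * V phi + X * (V (V psi) * V (V psi)))%ps.
Proof.
  pose proof (gs_bij lattice lattice_inv _ _ _ lattice_inv_l lattice_inv_r
    (gs_mul _ _ _ _ _ _ gs_phi gs_phi)) as H1.
  pose proof (gs_V _ _ _ gs_phi) as H2.
  pose proof (gs_V _ _ _ (gs_V _ _ _ gs_psi)) as H3.
  pose proof (gs_sum _ _ _ _ _ _ (gs_mul _ _ _ _ _ _ H2 H2)
    (gs_X _ _ _ (gs_mul _ _ _ _ _ _ H3 H3))) as H4.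
  refine (gs_unique _ _ _ _ H1 _). revert H4. apply gs_ext.
  - intros [[a b]|[a b]]; cbn [sum_elim lattice fst snd]; apply Nat2Z.inj;
      rewrite ?Nat2Z.inj_succ, !Nat2Z.inj_add, !Nat2Z.inj_mul, !sq_Z.
    + lia.
    + pose proof (tri_Z a); pose proof (tri_Z b). nia.
  - intros [[a b]|[a b]]; reflexivity.
Qed.

(** Same change of variables with the sign of n = a - b, which factors as sgn a sgn b; the odd class
    then cancels. *)
Lemma phi_mul_Sg_phi : (phi * Sg phi = V (Sg phi) * V (Sg phi))%ps.
Proof.
  set (u := fun k => (4 * tri k)%nat).
  assert (Hu : gs u sgn (lacZ u sgn)).
  { apply gs_lacZ; intro m; unfold u;
      [pose proof (le_tri_pos m)|pose proof (le_tri_neg m)]; lia. }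
  pose proof (gs_X _ _ _ (gs_mul _ _ _ _ _ _ Hu Hu)) as H0.
  assert (E0 : (X * (lacZ u sgn * lacZ u sgn))%ps = K 0).
  (* The reflection b -> -b - 1 preserves triangular numbers and changes the parity of b. *)
  { revert H0. apply (gs_involution (fun p => (fst p, - snd p - 1)%Z));
      intros [a b]; cbn [fst snd].
    - f_equal; lia.
    - unfold u. pose proof (tri_Z b); pose proof (tri_Z (- b - 1)). nia.
    - rewrite !sgn_sub, sgn_opp. change (sgn 1) with (-1). ring. }
  pose proof (gs_bij lattice lattice_inv _ _ _ lattice_inv_l lattice_inv_r
    (gs_mul _ _ _ _ _ _ gs_phi gs_Sg_phi)) as H1.
  pose proof (gs_V _ _ _ gs_Sg_phi) as H2.
  pose proof (gs_sum _ _ _ _ _ _ (gs_mul _ _ _ _ _ _ H2 H2) H0) as H4.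
  rewrite E0 in H4.
  transitivity (V (Sg phi) * V (Sg phi) + K 0)%ps; [|ring].
  refine (gs_unique _ _ _ _ H1 _). revert H4. apply gs_ext.
  - intros [[a b]|[a b]]; cbn [sum_elim lattice fst snd]; apply Nat2Z.inj;
      rewrite ?Nat2Z.inj_succ, !Nat2Z.inj_add; unfold u; rewrite ?Nat2Z.inj_mul, !sq_Z.
    + lia.
    + pose proof (tri_Z a); pose proof (tri_Z b). nia.
  - intros [[a b]|[a b]]; cbn [sum_elim lattice fst snd]; rewrite sgn_sub; ring.
Qed.

(** For k = m + n, l = m - n one has tri k + tri l = 2 tri m + n^2. Pairs with k + l odd reduce to
    this by l -> -l - 1, so the same series appears twice. *)
Lemma psi_sqr : (psi * psi = V psi * phi + V psi * phi)%ps.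
Proof.
  set (h := fun x : Z * Z + Z * Z => match x with
    | inl (m, n) => (m + n, n - m - 1)%Z | inr (m, n) => (m + n, m - n)%Z end).
  set (h' := fun p : Z * Z => let (k, l) := p in
    if ((k + l) mod 2 =? 0)%Z then inr ((k + l) / 2, (k - l) / 2)%Z
    else inl ((k - l - 1) / 2, (k + l + 1) / 2)%Z).
  assert (Hh : forall x, h' (h x) = x).
  { intros [[m n]|[m n]]; unfold h, h'.
    - destruct (Z.eqb_spec ((m + n + (n - m - 1)) mod 2) 0); [lia|].
      f_equal; f_equal; lia.
    - destruct (Z.eqb_spec ((m + n + (m - n)) mod 2) 0); [|lia].
      f_equal; f_equal; lia. }
  assert (Hh' : forall p, h (h' p) = p).
  { intros [k l]; unfold h'.
    destruct (Z.eqb_spec ((k + l) mod 2) 0); unfold h; f_equal; lia. }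
  pose proof (gs_bij h h' _ _ _ Hh Hh' (gs_mul _ _ _ _ _ _ gs_psi gs_psi)) as H1.
  pose proof (gs_mul _ _ _ _ _ _ (gs_V _ _ _ gs_psi) gs_phi) as H2.
  pose proof (gs_sum _ _ _ _ _ _ H2 H2) as H3.
  refine (gs_unique _ _ _ _ H1 _). revert H3. apply gs_ext.
  - intros [[m n]|[m n]]; unfold h; cbn [sum_elim fst snd]; apply Nat2Z.inj;
      rewrite !Nat2Z.inj_add, !Nat2Z.inj_mul, !sq_Z.
    + pose proof (tri_Z m); pose proof (tri_Z (m + n)); pose proof (tri_Z (n - m - 1)). nia.
    + pose proof (tri_Z m); pose proof (tri_Z (m + n)); pose proof (tri_Z (m - n)). nia.
  - intros [[m n]|[m n]]; unfold h; reflexivity.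
Qed.

(** * A Liouville-type identity *)

(** Finiteness of the fibres depends on [s] alone, so any other weight can be summed over them. *)
Lemma gs_exists {A : Type} (s : A -> nat) (c c' : A -> R) (a : ps) :
  gs s c a -> exists a', gs s c' a'.
Proof.
  intro Ha.
  assert (L : forall n, {l : list A | NoDup l /\ (forall x, In x l <-> s x = n)}).
  { intro n. apply constructive_indefinite_description.
    destruct (Ha n) as [l [Nl [Il _]]]. now exists l. }
  exists (Ps (fun n => sumL (proj1_sig (L n)) c')). intro n.
  simpl. destruct (L n) as [l [Nl Il]]; simpl. now exists l.
Qed.

(* The triple [(k, (i, j))] stands for [k] in Z, [n = i + 1] and the odd number
   [d = 2 j + 1]; its exponent is [k^2 + n d]. *)
Definition liou (x : Z * (nat * nat)) : nat :=
  (sq (fst x) + S (fst (snd x)) * S (2 * snd (snd x)))%nat.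

Lemma liou_Z (k : Z) (i j : nat) :
  Z.of_nat (liou (k, (i, j)))
  = (k * k + (Z.of_nat i + 1) * (2 * Z.of_nat j + 1))%Z.
Proof.
  unfold liou; cbn [fst snd]. rewrite Nat2Z.inj_add, sq_Z, Nat2Z.inj_mul. lia.
Qed.

(* With [K = k + n] and [t = n + d - 2 K]: negate [K] if [d > 4 K]; otherwise
   replace [(n, d)] by [(t, 4 K - d)] if [t > 0], and [n] by [- t] if [t < 0].
   The triples with [t = 0] are fixed. *)
Definition liou_inv (x : Z * (nat * nat)) : Z * (nat * nat) :=
  let '(k, (i, j)) := x in
  let n := (Z.of_nat i + 1)%Z in
  let d := (2 * Z.of_nat j + 1)%Z in
  let k' := (k + n)%Z in
  let t := (n + d - 2 * k')%Z in
  if (4 * k' <? d)%Z then (- k - 2 * n, (i, Z.to_nat (Z.of_nat j - 2 * k')))%Z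
  else if (0 <? t)%Z then
    (k' - t, (Z.to_nat (t - 1), Z.to_nat (2 * k' - Z.of_nat j - 1)))%Z
  else if (t <? 0)%Z then (k' + t, (Z.to_nat (- t - 1), j))%Z
  else x.

(** The condition t = 0 written in terms of i, j and k. *)
Definition liou_fixed (x : Z * (nat * nat)) : bool :=
  let '(k, (i, j)) := x in
  (Z.of_nat i =? 2 * (Z.of_nat j - k))%Z.

Ltac destruct_ltb :=
  repeat match goal with
  | |- context [Z.ltb ?a ?b] => destruct (Z.ltb_spec a b); try lia
  end.

Lemma liou_inv_involutive (x : Z * (nat * nat)) : liou_inv (liou_inv x) = x.
Proof.
  destruct x as [k [i j]]. unfold liou_inv at 2.
  destruct_ltb; unfold liou_inv; destruct_ltb; repeat f_equal; lia.
Qed.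

Lemma liou_liou_inv (x : Z * (nat * nat)) : liou (liou_inv x) = liou x.
Proof.
  destruct x as [k [i j]]. apply Nat2Z.inj. unfold liou_inv.
  destruct_ltb; rewrite !liou_Z; rewrite ?Z2Nat.id by lia; ring.
Qed.

Lemma sgn_odd_diff (a b : Z) : ((a - b) mod 2 = 1)%Z -> sgn a = - sgn b.
Proof.
  intro H. replace a with (b + (2 * ((a - b) / 2) + 1))%Z by lia.
  rewrite !sgn_add, sgn_double. change (sgn 1) with (-1). ring.
Qed.

Lemma sgn_even_diff (a b : Z) : ((a - b) mod 2 = 0)%Z -> sgn a = sgn b.
Proof.
  intro H. replace a with (b + 2 * ((a - b) / 2))%Z by lia.
  rewrite sgn_add, sgn_double. ring.
Qed.

Section Liouville.

Variable p : Z -> R.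
Hypothesis p_odd : forall k, p (- k)%Z = - p k.

Definition liou_weight (x : Z * (nat * nat)) : R :=
  sgn (fst x) * p (fst x + (Z.of_nat (fst (snd x)) + 1)).

(** The weight is (-1)^k p(K). Negating K keeps the parity of k and changes the sign of p; the other
    two moves keep K and change k by 2 K - d or 2 n + d - 2 K, which is odd because d is. *)
Lemma liou_weight_inv (x : Z * (nat * nat)) :
  liou_fixed (liou_inv x) = liou_fixed x /\
  (liou_fixed x = false -> liou_weight (liou_inv x) = - liou_weight x).
Proof.
  destruct x as [k [i j]]. unfold liou_fixed at 2 3, liou_inv.
  destruct (Z.eqb_spec (Z.of_nat i) (2 * (Z.of_nat j - k))) as [E|E];
  (split; [destruct_ltb; cbn [liou_fixed]; apply Z.eqb_eq || apply Z.eqb_neq; lia|]);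
  [easy|intros _]. unfold liou_weight.
  destruct_ltb; cbn [fst snd]; rewrite ?Z2Nat.id by lia.
  - rewrite (sgn_even_diff (- k - 2 * (Z.of_nat i + 1)) k) by lia.
    replace (- k - 2 * (Z.of_nat i + 1) + (Z.of_nat i + 1))%Z
      with (- (k + (Z.of_nat i + 1)))%Z by ring.
    rewrite p_odd; ring.
  - rewrite (sgn_odd_diff _ k) by lia.
    match goal with |- _ * p ?a = - (_ * p ?b) => replace a with b by ring end. ring.
  - rewrite (sgn_odd_diff _ k) by lia.
    match goal with |- _ * p ?a = - (_ * p ?b) => replace a with b by ring end. ring.
Qed.

Lemma Z_pair_eq_dec (x y : Z * (nat * nat)) : {x = y} + {x <> y}.
Proof. repeat decide equality. Qed.

(** The involution cancels all triples except those with t = 0. On these the exponent is the square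
    K^2, which leaves a one-dimensional sum. *)
Lemma liouville (a b : ps) :
  gs liou (fun x => let n := (Z.of_nat (fst (snd x)) + 1)%Z in
    sgn (fst x) * (p (fst x + n) - p (fst x - n))) a ->
  gs sq (fun k => sgn k * (IZR k * p k)) b -> a = (- b)%ps.
Proof.
  intros Ha Hb.
  destruct (gs_exists _ _ liou_weight _ Ha) as [a1 H1].
  destruct (gs_exists _ _ (fun x => if liou_fixed x then liou_weight x else 0) _ Ha)
    as [a2 H2].
  destruct (gs_exists _ _ (fun x => if liou_fixed x then 0 else liou_weight x) _ Ha)
    as [a3 H3].
  assert (E3 : a3 = K 0).
  { revert H3. apply (gs_involution liou_inv);
      auto using liou_inv_involutive, liou_liou_inv.
    intro x. destruct (liou_weight_inv x) as [-> W].
    destruct (liou_fixed x); [ring|now apply W]. }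
  assert (E1 : a1 = a2).
  { transitivity (a2 + a3)%ps; [|rewrite E3; ring].
    apply (gs_unique _ _ _ _ H1). generalize (gs_weight_add _ _ _ _ _ H2 H3).
    apply gs_ext; [easy|]. intro x; destruct (liou_fixed x); ring. }
  (* Under k -> -k the term -p(k - n) becomes p(k + n), as p is odd, so both halves of the weight
     have the same sum. *)
  assert (E : a = (a1 + a1)%ps).
  { apply (gs_unique _ _ _ _ Ha).
    pose proof (gs_bij (fun x => (- fst x, snd x)%Z) (fun x => (- fst x, snd x)%Z)
      _ _ _ ltac:(intros [k ij]; cbn [fst snd]; f_equal; lia)
      ltac:(intros [k ij]; cbn [fst snd]; f_equal; lia) H1) as H1'.
    assert (H1'' : gs liou (fun x => liou_weight (- fst x, snd x)%Z) a1).
    { revert H1'. apply gs_ext; [|easy]. intros [k [i j]]. apply Nat2Z.inj.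
      cbn [fst snd]. rewrite !liou_Z. ring. }
    generalize (gs_weight_add _ _ _ _ _ H1 H1''). apply gs_ext; [easy|].
    intros [k [i j]]. unfold liou_weight; cbn [fst snd]. rewrite sgn_opp.
    replace (- k + (Z.of_nat i + 1))%Z with (- (k - (Z.of_nat i + 1)))%Z by ring.
    rewrite p_odd. ring. }
  set (s := fun m : nat => sq (Z.of_nat m + 1)).
  set (c := fun m : nat => sgn (Z.of_nat m) * p (Z.of_nat m + 1)).
  set (e := lac s (fun m => INR (S m) * c m)).
  assert (He : gs s (fun m => INR (S m) * c m) e).
  { apply gs_lac. intro m; unfold s. pose proof (sq_Z (Z.of_nat m + 1)). nia. }
  assert (E2 : a2 = e).
  (* Fixed triples are n = 2 i + 1, d = 2 j + 1, k = j - i, for which k^2 + n d = (i + j + 1)^2;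
     there are m + 1 of them with i + j = m. *)
  { pose proof (gs_embed
      (fun q : nat * nat => (Z.of_nat (snd q) - Z.of_nat (fst q),
                             (2 * fst q, snd q)%nat)%Z)
      (fun x => (Nat.div2 (fst (snd x)), snd (snd x)))
      liou (fun x => if liou_fixed x then liou_weight x else 0) a2 Z_pair_eq_dec) as M.
    specialize (M ltac:(intros [i j]; cbn [fst snd]; now rewrite Nat.div2_double)).
    refine (gs_unique _ _ _ _ (M _ H2) _); clear M.
    { intros [k [i j]]; cbn [fst snd]. unfold liou_fixed.
      destruct (Z.eqb_spec (Z.of_nat i) (2 * (Z.of_nat j - k))); [right|now left].
      assert (Hi : (i = 2 * Nat.div2 i)%nat).
      { destruct (even_odd_dec i) as [[m ->]|[m ->]]; [now rewrite Nat.div2_double|lia]. }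
      repeat f_equal; lia. }
    generalize (gs_antidiagonal _ _ _ He). apply gs_ext.
    - intros [i j]; cbn [fst snd]. unfold s. apply Nat2Z.inj.
      rewrite liou_Z, sq_Z. nia.
    - intros [i j]; cbn [fst snd]. unfold c, liou_fixed, liou_weight; cbn [fst snd].
      destruct (Z.eqb_spec (Z.of_nat (2 * i))
        (2 * (Z.of_nat j - (Z.of_nat j - Z.of_nat i)))); [|lia].
      rewrite (sgn_even_diff (Z.of_nat (i + j)) (Z.of_nat j - Z.of_nat i)) by lia.
      do 2 f_equal. lia. }
  (* The integers m + 1 and -(m + 1) contribute equally, 0 contributes nothing, and the sign comes
     from [sgn (m + 1) = - sgn m]. *)
  assert (Eb : b = (K (-1) * e + K (-1) * e)%ps).
  { pose proof (gs_embed
      (sum_elim (fun m => (Z.of_nat m + 1)%Z) (fun m => (- Z.of_nat m - 1)%Z))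
      (fun k => if (0 <? k)%Z then inl (Z.to_nat (k - 1)) else inr (Z.to_nat (- k - 1)))
      sq (fun k => sgn k * (IZR k * p k)) b Z.eq_dec) as M.
    assert (M1 : forall y : nat + nat, (fun k =>
        if (0 <? k)%Z then inl (Z.to_nat (k - 1)) else inr (Z.to_nat (- k - 1)))
        (sum_elim (fun m => (Z.of_nat m + 1)%Z) (fun m => (- Z.of_nat m - 1)%Z) y) = y).
    { intros [m|m]; cbn [sum_elim]; destruct_ltb; f_equal; lia. }
    specialize (M M1).
    refine (gs_unique _ _ _ _ (M _ Hb) _); clear M M1.
    { intro k. destruct (Z.eq_dec k 0) as [->|]; [left; ring|right].
      destruct_ltb; cbn [sum_elim]; lia. }
    pose proof (gs_scal _ (-1) _ _ He) as He'.
    generalize (gs_sum _ _ _ _ _ _ He' He'). apply gs_ext.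
    - intros [m|m]; cbn [sum_elim]; [reflexivity|]. unfold s.
      apply Nat2Z.inj. rewrite !sq_Z. ring.
    - intros [m|m]; cbn [sum_elim]; unfold c; rewrite S_INR, INR_IZR_INZ.
      + rewrite plus_IZR, sgn_add. change (sgn 1) with (-1). ring.
      + replace (- Z.of_nat m - 1)%Z with (- (Z.of_nat m + 1))%Z by ring.
        rewrite p_odd, opp_IZR, plus_IZR, sgn_opp, sgn_add.
        change (sgn 1) with (-1). ring. }
  rewrite E, E1, E2, Eb. change (K (-1)) with (K (- (1))). rewrite K_opp. ring.
Qed.

End Liouville.

(** * Moments of theta_4 and divisor sums *)

Definition Sig (k : nat) : ps := Ps (fun n => INR (Defs.sigma k n)).
Definition Lam (k : nat) : ps := (Sig k - V (Sig k))%ps.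

Lemma INR_list_sum_map (l : list nat) (f : nat -> nat) :
  INR (list_sum (map f l)) = sumL l (fun m => INR (f m)).
Proof.
  induction l as [|x l IH]; [reflexivity|].
  cbn [map sumL fold_right].
  change (list_sum (f x :: map f l)) with (f x + list_sum (map f l))%nat.
  now rewrite plus_INR, IH.
Qed.

Lemma gs_Sig (k : nat) :
  gs (fun p => S (fst p) * S (snd p))%nat (fun p => INR (S (fst p)) ^ k) (Sig k).
Proof.
  intro n.
  exists (map (fun m => (m - 1, n / m - 1)%nat)
            (filter (fun m => Nat.eqb (n mod m) 0) (seq 1 n))).
  assert (F : forall m, In m (filter (fun m => Nat.eqb (n mod m) 0) (seq 1 n)) <->
    (1 <= m <= n /\ exists d, n = m * S d)%nat).
  { intro m. rewrite filter_In, in_seq, Nat.eqb_eq. split.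
    - intros [H1 H2]. split; [lia|]. apply Nat.Div0.mod_divides in H2 as [d Hd].
      exists (d - 1)%nat. destruct d as [|d]; [lia|]. now rewrite Nat.sub_succ, Nat.sub_0_r.
    - intros [H1 [d Hd]]. split; [lia|]. apply Nat.Div0.mod_divides; eauto. }
  split; [|split].
  - apply NoDup_map_NoDup_ForallPairs; [|apply NoDup_filter, seq_NoDup].
    intros x y Hx Hy Exy. apply F in Hx as [Hx _], Hy as [Hy _]. inversion Exy. lia.
  - intros [i j]. rewrite in_map_iff. cbn [fst snd]. split.
    + intros [m [Em Hm]]. apply F in Hm as [Hm [d Hd]]. inversion Em; subst i j.
      replace (n / m)%nat with (S d)
        by (rewrite Hd, (Nat.mul_comm m), Nat.div_mul by lia; reflexivity).
      nia.
    + intro H. exists (S i). split.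
      * f_equal; [lia|].
        rewrite <- H, (Nat.mul_comm (S i)), Nat.div_mul by lia. lia.
      * apply F. split; [nia|eauto].
  - simpl coef. unfold Defs.sigma. rewrite INR_list_sum_map, sumL_map.
    apply sumL_ext. intros m Hm. apply F in Hm as [Hm _]. cbn [fst].
    rewrite pow_INR. do 2 f_equal. lia.
Qed.

(** [V (Sig k)] collects the factorisations n d with d even, weighted by n^k, so subtracting it from
    [Sig k] leaves odd d. This is the pair (n, d) that occurs in [liou]. *)
Lemma gs_Lam (k : nat) :
  gs (fun p => S (fst p) * S (2 * snd p))%nat (fun p => INR (S (fst p)) ^ k) (Lam k).
Proof.
  set (c := fun p : nat * nat => if Nat.even (snd p) then INR (S (fst p)) ^ k else 0).
  destruct (gs_exists _ _ c _ (gs_Sig k)) as [a Ha].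
  assert (Ha' : gs (fun p => S (fst p) * S (2 * snd p))%nat
                   (fun p => INR (S (fst p)) ^ k) a).
  { pose proof (gs_embed (fun p => (fst p, 2 * snd p)%nat)
      (fun p => (fst p, Nat.div2 (snd p)))
      (fun p => S (fst p) * S (snd p))%nat c a
      ltac:(intros x y; repeat decide equality)
      ltac:(intros [i j]; cbn [fst snd]; now rewrite Nat.div2_double)) as M.
    generalize (M ltac:(intros [i j]; unfold c; cbn [fst snd];
      destruct (Nat.even j) eqn:E; [right|now left];
      apply Nat.even_spec, Nat.Even_double in E;
      f_equal; now rewrite <- Nat.double_twice) Ha).
    apply gs_ext; intros [i j]; unfold c; cbn [fst snd]; [reflexivity|].
    now rewrite Nat.even_mul. }
  enough (E : Sig k = (a + V (Sig k))%ps).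
  { unfold Lam. rewrite E at 1. now replace (a + V (Sig k) - V (Sig k))%ps with a by ring. }
  pose proof (gs_bij
    (sum_elim (fun p => (fst p, 2 * snd p)%nat) (fun p => (fst p, 2 * snd p + 1)%nat))
    (fun p => if Nat.even (snd p) then inl (fst p, Nat.div2 (snd p))
              else inr (fst p, Nat.div2 (snd p)))
    (fun p => S (fst p) * S (snd p))%nat (fun p => INR (S (fst p)) ^ k) (Sig k)) as M.
  refine (gs_unique _ _ _ _ (M _ _ (gs_Sig k)) _); clear M.
  - intros [[i j]|[i j]]; cbn [sum_elim fst snd].
    + now rewrite Nat.even_mul, Nat.div2_double.
    + rewrite Nat.add_1_r, Nat.even_succ, Nat.odd_mul, Nat.div2_succ_double. reflexivity.
  - intros [i j]; cbn [fst snd]. destruct (even_odd_dec j) as [[m ->]|[m ->]].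
    + rewrite Nat.even_mul, Nat.div2_double. reflexivity.
    + rewrite Nat.even_succ, Nat.odd_mul, Nat.div2_succ_double.
      cbn [sum_elim fst snd Nat.odd Nat.even negb andb]. f_equal. lia.
  - generalize (gs_sum _ _ _ _ _ _ Ha' (gs_V _ _ _ (gs_Sig k))). apply gs_ext.
    + intros [[i j]|[i j]]; cbn [sum_elim fst snd]; nia.
    + intros [[i j]|[i j]]; reflexivity.
Qed.

Lemma Q2R_Z (n : Z) : Q2R (inject_Z n) = IZR n.
Proof. unfold Q2R; simpl; field. Qed.

Lemma gs_kq {A : Type} (s : A -> nat) (n : Z) (c : A -> R) (a : ps) :
  gs s c a -> gs s (fun x => IZR n * c x) (kq (inject_Z n) * a)%ps.
Proof. intro H. unfold kq. rewrite Q2R_Z. now apply gs_scal. Qed.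

Lemma INR_sq (k : Z) : INR (sq k) = IZR k * IZR k.
Proof. now rewrite INR_IZR_INZ, sq_Z, mult_IZR. Qed.

Lemma gs_Sg_phi_Lam (u : Z -> R) (a : ps) (k : nat) : gs sq u a ->
  gs liou (fun x => u (fst x) * IZR (Z.of_nat (fst (snd x)) + 1) ^ k) (a * Lam k)%ps.
Proof.
  intro H. generalize (gs_mul _ _ _ _ _ _ H (gs_Lam k)). apply gs_ext; [easy|].
  intros [m [i j]]; cbn [fst snd]. now rewrite S_INR, INR_IZR_INZ, plus_IZR.
Qed.

Lemma gs_th_Sg_phi : gs sq (fun k => IZR k ^ 2 * sgn k) (th (Sg phi)).
Proof.
  generalize (gs_th _ _ _ gs_Sg_phi). apply gs_ext; [easy|].
  intro k. rewrite INR_sq. ring.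
Qed.

Lemma gs_th2_Sg_phi : gs sq (fun k => IZR k ^ 4 * sgn k) (th (th (Sg phi))).
Proof.
  generalize (gs_th _ _ _ gs_th_Sg_phi). apply gs_ext; [easy|].
  intro k. rewrite INR_sq. ring.
Qed.

Lemma gs_th3_Sg_phi : gs sq (fun k => IZR k ^ 6 * sgn k) (th (th (th (Sg phi)))).
Proof.
  generalize (gs_th _ _ _ gs_th2_Sg_phi). apply gs_ext; [easy|].
  intro k. rewrite INR_sq. ring.
Qed.

(** The case p(k) = k, where p(k + n) - p(k - n) = 2 n. It plays the role of the product formula for
    theta_4. *)
Lemma th_Sg_phi : (th (Sg phi) = - (Q[2] * (Sg phi * Lam 1)))%ps.
Proof.
  enough (E : (kq (inject_Z 2) * (Sg phi * Lam 1) = - th (Sg phi))%ps)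
    by (change (2%Q) with (inject_Z 2); rewrite E; ring).
  apply (liouville IZR); [intro; apply opp_IZR| |].
  - generalize (gs_kq _ 2 _ _ (gs_Sg_phi_Lam _ _ 1 gs_Sg_phi)). apply gs_ext; [easy|].
    intros [k [i j]]; cbn [fst snd]. rewrite minus_IZR, (plus_IZR k). ring.
  - generalize gs_th_Sg_phi. apply gs_ext; [easy|]. intro; ring.
Qed.

(** Here (k + n)^3 - (k - n)^3 = 6 k^2 n + 2 n^3, and each factor k^2 is one application of [th] to
    theta_4. The next lemma expands fifth powers in the same way. *)
Lemma th2_Sg_phi :
  (th (th (Sg phi)) = - (Q[6] * (th (Sg phi) * Lam 1) + Q[2] * (Sg phi * Lam 3)))%ps.
Proof.
  enough (E : (kq (inject_Z 6) * (th (Sg phi) * Lam 1) + kq (inject_Z 2) * (Sg phi * Lam 3)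
               = - th (th (Sg phi)))%ps)
    by (change (2%Q) with (inject_Z 2); change (6%Q) with (inject_Z 6); rewrite E; ring).
  apply (liouville (fun k => IZR k ^ 3)); [intro; rewrite opp_IZR; ring| |].
  - generalize (gs_weight_add _ _ _ _ _
      (gs_kq _ 6 _ _ (gs_Sg_phi_Lam _ _ 1 gs_th_Sg_phi))
      (gs_kq _ 2 _ _ (gs_Sg_phi_Lam _ _ 3 gs_Sg_phi))). apply gs_ext; [easy|].
    intros [k [i j]]; cbn [fst snd]. rewrite minus_IZR, (plus_IZR k). ring.
  - generalize gs_th2_Sg_phi. apply gs_ext; [easy|]. intro; ring.
Qed.

Lemma th3_Sg_phi :
  (th (th (th (Sg phi))) = - (Q[10] * (th (th (Sg phi)) * Lam 1)
    + Q[20] * (th (Sg phi) * Lam 3) + Q[2] * (Sg phi * Lam 5)))%ps.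
Proof.
  enough (E : (kq (inject_Z 10) * (th (th (Sg phi)) * Lam 1)
      + kq (inject_Z 20) * (th (Sg phi) * Lam 3) + kq (inject_Z 2) * (Sg phi * Lam 5)
      = - th (th (th (Sg phi))))%ps)
    by (change (2%Q) with (inject_Z 2); change (10%Q) with (inject_Z 10);
        change (20%Q) with (inject_Z 20); rewrite E; ring).
  apply (liouville (fun k => IZR k ^ 5)); [intro; rewrite opp_IZR; ring| |].
  - generalize (gs_weight_add _ _ _ _ _ (gs_weight_add _ _ _ _ _
      (gs_kq _ 10 _ _ (gs_Sg_phi_Lam _ _ 1 gs_th2_Sg_phi))
      (gs_kq _ 20 _ _ (gs_Sg_phi_Lam _ _ 3 gs_th_Sg_phi)))
      (gs_kq _ 2 _ _ (gs_Sg_phi_Lam _ _ 5 gs_Sg_phi))). apply gs_ext; [easy|].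
    intros [k [i j]]; cbn [fst snd]. rewrite minus_IZR, (plus_IZR k). ring.
  - generalize gs_th3_Sg_phi. apply gs_ext; [easy|]. intro; ring.
Qed.

(** * Eisenstein series and theta functions *)

Local Open Scope ps_scope.

Ltac push_th := repeat (rewrite ?th_add, ?th_sub, ?th_opp, ?th_mul, ?th_kq, ?th_K).
Ltac push_V := repeat (rewrite ?V_add, ?V_sub, ?V_opp, ?V_mul, ?V_kq, ?V_K).

Lemma coef_0 (a b : ps) (q : Q) :
  (a + b) 0%nat = (a 0%nat + b 0%nat)%R /\ (a - b) 0%nat = (a 0%nat - b 0%nat)%R /\
  (- a) 0%nat = (- a 0%nat)%R /\ (a * b) 0%nat = (a 0%nat * b 0%nat)%R /\
  (kq q 0%nat = Q2R q)%R /\ (V a 0%nat = a 0%nat)%R /\ (th a 0%nat = 0)%R.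
Proof. repeat split. simpl; ring. Qed.

Ltac coef0 := repeat match goal with
  | |- context [coef (padd ?a ?b) 0%nat] => rewrite (proj1 (coef_0 a b 0))
  | |- context [coef (psub ?a ?b) 0%nat] => rewrite (proj1 (proj2 (coef_0 a b 0)))
  | |- context [coef (popp ?a) 0%nat] => rewrite (proj1 (proj2 (proj2 (coef_0 a a 0))))
  | |- context [coef (pmul ?a ?b) 0%nat] => rewrite (pmul_coef_0 a b)
  | |- context [coef (kq ?q) 0%nat] => change (coef (kq q) 0%nat) with (Q2R q)
  | |- context [coef (K ?r) 0%nat] => change (coef (K r) 0%nat) with r
  | |- context [coef (V ?a) 0%nat] => change (coef (V a) 0%nat) with (coef a 0%nat)
  | |- context [coef (th ?a) 0%nat] =>
      replace (coef (th a) 0%nat) with 0%R by (simpl; ring)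
  end.

(** The logarithmic derivatives of theta_4 and theta_3 for x d/dx, by [th_T4] and [th_phi]. *)
Definition A4 : ps := - (Q[2] * Lam 1).
Definition A3 : ps := Sg A4.
Definition h2 : ps := X * V psi ^ 4.
Definition h4 : ps := Sg phi ^ 4.
Definition e2 : ps := K 1 - Q[24] * V (Sig 1).
Definition e4 : ps := K 1 + Q[240] * V (Sig 3).
Definition e6 : ps := K 1 - Q[504] * V (Sig 5).

(** theta_3^2 and theta_4^2. Under [V] they pass to their arithmetic and geometric means, so [V sa]
    and [V (sb * sb)], but not [V sb], are polynomials in them. *)
Definition sa : ps := phi * phi.
Definition sb : ps := Sg phi * Sg phi.

Lemma phi_0 : phi 0%nat = 1%R.
Proof. unfold phi, lacZ; simpl; ring. Qed.

Lemma psi_0 : psi 0%nat = 2%R.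
Proof. unfold psi, lacZ; simpl; ring. Qed.

Lemma Sg_phi_0 : Sg phi 0%nat = 1%R.
Proof. change (Sg phi 0%nat) with (1 * phi 0%nat)%R. rewrite phi_0; ring. Qed.

Lemma th_T4 : th (Sg phi) = A4 * Sg phi.
Proof. rewrite th_Sg_phi. unfold A4. ring. Qed.

Lemma th_phi : th phi = A3 * phi.
Proof. rewrite <- (Sg_Sg phi), th_Sg, th_T4, Sg_mul, Sg_Sg. reflexivity. Qed.

Lemma th_sa : th sa = Q[2] * A3 * sa.
Proof. unfold sa. rewrite th_mul, th_phi. ring. Qed.

Lemma th_sb : th sb = Q[2] * A4 * sb.
Proof. unfold sb. rewrite th_mul, th_T4. ring. Qed.

Lemma sb_sqr : sb = V phi * V phi - X * (V (V psi) * V (V psi)).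
Proof.
  unfold sb. rewrite <- Sg_mul, phi_sqr, Sg_add, !Sg_mul, !Sg_V, Sg_X. ring.
Qed.

Lemma sa_add_sb : sa + sb = Q[2] * (V phi * V phi).
Proof. rewrite sb_sqr. unfold sa. rewrite phi_sqr. ring. Qed.

Lemma sa_sub_sb : sa - sb = Q[2] * (X * (V (V psi) * V (V psi))).
Proof. rewrite sb_sqr. unfold sa. rewrite phi_sqr. ring. Qed.

Lemma V_sa : V sa = Q[1/2] * (sa + sb).
Proof. rewrite sa_add_sb. unfold sa. rewrite V_mul. ring. Qed.

Lemma V_sb_sqr : V (sb * sb) = sa * sb.
Proof.
  unfold sb at 1 2. rewrite !V_mul.
  transitivity ((V (Sg phi) * V (Sg phi)) * (V (Sg phi) * V (Sg phi))); [ring|].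
  rewrite <- phi_mul_Sg_phi. unfold sa, sb. ring.
Qed.

Lemma h4_sb : h4 = sb * sb.
Proof. unfold h4, sb. ring. Qed.

(** Jacobi's quartic identity, obtained by multiplying the formulas for [sa + sb] and [sa - sb]. *)
Lemma h2_sa_sb : h2 = sa * sa - sb * sb.
Proof.
  transitivity ((sa - sb) * (sa + sb)); [|ring].
  rewrite sa_sub_sb, sa_add_sb. unfold h2.
  transitivity (X * (V psi * V psi) * (V psi * V psi)); [ring|].
  rewrite <- V_mul, psi_sqr, V_add, V_mul. ring.
Qed.

Lemma V_h2 : V h2 = Q[1/4] * (sa - sb) * (sa - sb).
Proof. rewrite sa_sub_sb. unfold h2. rewrite V_mul, V_pow, V_X. ring. Qed.

(** Logarithmic derivative of theta_3 theta_4 = theta_4(x^2)^2; the square and the chain rule give 2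
    each. *)
Lemma A_sum : A3 + A4 = Q[4] * V A4.
Proof.
  apply (pmul_cancel (V (Sg phi) * V (Sg phi))).
  - rewrite pmul_coef_0. change (V (Sg phi) 0%nat) with (Sg phi 0%nat).
    rewrite Sg_phi_0. lra.
  - transitivity (th (phi * Sg phi)).
    + rewrite th_mul, th_phi, th_T4, <- phi_mul_Sg_phi. ring.
    + rewrite phi_mul_Sg_phi, <- V_mul, th_V, th_mul, th_T4. push_V. ring.
Qed.

Lemma A3_sa_add : A3 * sa + A4 * sb = Q[2] * V A3 * (sa + sb).
Proof.
  transitivity (Q[1/2] * th (sa + sb)).
  - rewrite th_add, th_sa, th_sb. ring.
  - rewrite !sa_add_sb, th_mul, th_kq, <- V_mul, th_V, th_mul, th_phi. push_V. ring.
Qed.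

(** The quotient of A3 - A4 by [h2] is invariant under [V], hence constant. As [h2] vanishes to
    order 1, [V_quotient] is applied after subtracting the multiple that matches the coefficient of
    x. *)
Lemma A3_eq : A3 = A4 + Q[1/4] * h2.
Proof.
  assert (E : (A3 - A4) * V h2 = V (A3 - A4) * h2).
  { assert (E : (A3 - A4) * (sa - sb) = Q[4] * V (A3 - A4) * (sa + sb)).
    { transitivity (Q[2] * (A3 * sa + A4 * sb) - (A3 + A4) * (sa + sb)); [ring|].
      rewrite A3_sa_add, A_sum, V_sub. ring. }
    rewrite V_h2.
    transitivity (Q[1/4] * ((A3 - A4) * (sa - sb)) * (sa - sb)); [ring|].
    rewrite E, h2_sa_sb. ring. }
  enough (Z : A3 - A4 - Q[1/4] * h2 = K 0).
  { transitivity (A3 - A4 - Q[1/4] * h2 + A4 + Q[1/4] * h2); [ring|rewrite Z; ring]. }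
  assert (h20 : h2 0%nat = 0%R) by (unfold h2; apply X_mul_coef).
  assert (h21 : h2 1%nat = 16%R).
  { unfold h2. rewrite X_mul_coef, ppow_coef_0.
    change (V psi 0%nat) with (psi 0%nat). rewrite psi_0. ring. }
  assert (A41 : A4 1%nat = (-2)%R).
  { unfold A4. change ((- (Q[2] * Lam 1)) 1%nat) with (- (Q[2] * Lam 1)%ps 1%nat)%R.
    unfold kq. rewrite K_mul_coef.
    change (Lam 1 1%nat) with (INR (Defs.sigma 1 1) + - 0)%R.
    unfold Defs.sigma, Q2R. simpl. field. }
  assert (cf : forall n, (A3 - A4 - Q[1/4] * h2) n
    = ((-1) ^ n * A4 n - A4 n - / 4 * h2 n)%R).
  { intro n. change ((A3 - A4 - Q[1/4] * h2) n)
      with ((-1) ^ n * A4 n + - A4 n + - (Q[1/4] * h2)%ps n)%R.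
    unfold kq. rewrite K_mul_coef. unfold Q2R. simpl. field. }
  apply (V_quotient _ h2); auto.
  - rewrite !V_sub, !V_mul, V_kq.
    transitivity ((A3 - A4) * V h2 - Q[1/4] * h2 * V h2); [ring|].
    rewrite E, V_sub. ring.
  - rewrite h21. lra.
  - rewrite cf, h20. ring.
  - rewrite cf, h21, A41. field.
Qed.

Lemma A3_sasb : A3 = A4 + Q[1/4] * (sa * sa - sb * sb).
Proof. now rewrite A3_eq, h2_sa_sb. Qed.

Lemma V_A4 : V A4 = Q[1/2] * A4 + Q[1/16] * (sa * sa - sb * sb).
Proof.
  transitivity (Q[1/4] * (A3 + A4)); [rewrite A_sum|rewrite A3_sasb]; ring.
Qed.

Lemma th_h2_A : th h2 = (Q[4] * A3 + h4) * h2.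
Proof.
  apply V_inj, (pmul_cancel (Q[2] * (sa + sb))).
  - rewrite sa_add_sb, !pmul_coef_0. change (V phi 0%nat) with (phi 0%nat).
    rewrite phi_0. unfold kq, Q2R; simpl. lra.
  - transitivity ((sa + sb) * th (V h2)); [rewrite th_V; ring|].
    rewrite V_h2, V_mul, V_add, h4_sb, V_sb_sqr, V_h2. push_V. push_th.
    transitivity (Q[1/2] * (sa + sb) * sa * sb * (sa - sb) * (sa - sb)
      + (Q[2] * V A3 * (sa + sb)) * (sa - sb) * (sa - sb)); [|ring].
    rewrite <- A3_sa_add, th_sa, th_sb, A3_sasb. ring.
Qed.

(** This is 12 A4 + 2 h2 + h4, the value of E_2 that the formula [th_h4] demands. *)
Definition e2h : ps := Q[12] * A4 + Q[2] * sa * sa - sb * sb.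

Lemma e2_sub_V : e2 - V e2 = Q[12] * V A4.
Proof. unfold e2, A4, Lam. push_V. ring. Qed.

Lemma V_e2h : V e2h = Q[6] * A4 + Q[5/4] * sa * sa - Q[1/4] * sb * sb.
Proof.
  unfold e2h. rewrite V_sub, V_sb_sqr. push_V. rewrite V_A4, V_sa. ring.
Qed.

Lemma Lam_0 (k : nat) : Lam k 0%nat = 0%R.
Proof. unfold Lam, Sig, Defs.sigma; simpl; ring. Qed.

(** Both sides change by 12 [V A4] under [V]: the left by definition of [Lam], the right by the mean
    formulas. *)
Lemma e2_e2h : e2 = e2h.
Proof.
  apply V_fixed.
  - rewrite V_sub.
    transitivity (e2 - (e2 - V e2) - V e2h); [ring|].
    rewrite e2_sub_V, V_e2h, V_A4. unfold e2h. ring.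
  - unfold e2, e2h, sa, sb, A4. coef0. rewrite Lam_0, phi_0, Sg_phi_0.
    change (Sig 1 0%nat) with 0%R. unfold Q2R; simpl; field.
Qed.

Definition e4h : ps := h2 * h2 + h2 * h4 + h4 * h4.
Definition e6h : ps := Q[1/2] * (h2 + Q[2] * h4) * (Q[2] * h2 + h4) * (h4 - h2).

Lemma e4h_sasb : e4h = sa ^ 4 - sa ^ 2 * sb ^ 2 + sb ^ 4.
Proof. unfold e4h. rewrite h4_sb, h2_sa_sb. ring. Qed.

Lemma V_e4h : V e4h = Q[1/16] * sa ^ 4 + Q[7/8] * sa ^ 2 * sb ^ 2 + Q[1/16] * sb ^ 4.
Proof. unfold e4h. push_V. rewrite V_h2, h4_sb, V_sb_sqr. ring. Qed.

Ltac th_sasb := unfold ppow; push_th; rewrite ?th_sa, ?th_sb, ?A3_sasb.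

(** Ramanujan's equation for E_2. The difference of the two sides is an eigenvector of [V] with
    eigenvalue 1/4 and zero constant term; [th A4], still unknown, drops out of the comparison.
    Solving for it gives [th_A4]. *)
Lemma th_e2h : Q[6] * th e2h = e2h * e2h - e4h.
Proof.
  enough (E : Q[6] * th e2h - e2h * e2h + e4h = K 0).
  { transitivity (Q[6] * th e2h - e2h * e2h + e4h + e2h * e2h - e4h); [ring|].
    rewrite E; ring. }
  apply (V_eigen (Q2R (1/4))).
  - unfold Q2R; simpl; lra.
  - change (K (Q2R (1 / 4))) with (kq (1/4)).
    transitivity (Q[3] * th (V e2h) - V e2h * V e2h + V e4h).
    + push_V. rewrite th_V. ring.
    + rewrite V_e2h, V_e4h, e4h_sasb. unfold e2h. th_sasb. ring.
  - unfold e2h, e4h, h2, h4, sa, sb, A4. rewrite ?h4_sb. unfold sb, ppow. coef0.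
    rewrite Lam_0, phi_0, Sg_phi_0. change (X 0%nat) with 0%R.
    unfold Q2R; simpl; field.
Qed.

Lemma th_A4 : th A4 = Q[2] * A4 * A4 + Q[1/3] * A4 * (Q[2] * sa * sa - sb * sb)
  + Q[1/72] * ((Q[2] * sa * sa - sb * sb) ^ 2 - e4h)
  - Q[1/12] * th (Q[2] * sa * sa - sb * sb).
Proof.
  transitivity (Q[1/72] * (Q[6] * th e2h) - Q[1/12] * th (Q[2] * sa * sa - sb * sb)).
  - unfold e2h. push_th. ring.
  - rewrite th_e2h. unfold e2h. ring.
Qed.

Lemma th_A4_sasb : th A4 = Q[2] * A4 * A4 - Q[1/8] * sa * sa * (sa * sa - sb * sb).
Proof. rewrite th_A4, e4h_sasb. th_sasb. ring. Qed.

Lemma Sg_phi_cancel (a b : ps) : Sg phi * a = Sg phi * b -> a = b.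
Proof. apply pmul_cancel. rewrite Sg_phi_0. lra. Qed.

Lemma th2_T4 : th (th (Sg phi)) = (th A4 + A4 * A4) * Sg phi.
Proof. rewrite th_T4, th_mul, th_T4. ring. Qed.

Lemma Lam1_A4 : Lam 1 = - (Q[1/2] * A4).
Proof. unfold A4; ring. Qed.

(** The moment identity for theta_4 divided by theta_4 and solved for the Lambert series; [Lam5_A4]
    is the next case. *)
Lemma Lam3_A4 : Lam 3 = A4 * A4 - Q[1/2] * th A4.
Proof.
  apply Sg_phi_cancel. pose proof th2_Sg_phi as H.
  rewrite th2_T4, th_T4, Lam1_A4 in H.
  transitivity (- (Q[1/2] * (- (Q[6] * (A4 * Sg phi * - (Q[1/2] * A4))
    + Q[2] * (Sg phi * Lam 3)))) + Q[3/2] * A4 * A4 * Sg phi); [ring|].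
  rewrite <- H. ring.
Qed.

Lemma Lam5_A4 : Lam 5 = - (Q[1/2] * th (th A4)) + Q[6] * A4 * th A4 - Q[8] * A4 ^ 3.
Proof.
  apply Sg_phi_cancel. pose proof th3_Sg_phi as H.
  rewrite th2_T4, th_mul, th_T4, Lam3_A4, Lam1_A4 in H. 
  match type of H with ?l = ?r =>
    transitivity (- (Q[1/2] * r) - Q[5] * (th A4 + A4 * A4) * Sg phi * - (Q[1/2] * A4)
      - Q[10] * A4 * Sg phi * (A4 * A4 - Q[1/2] * th A4)) end; [ring|].
  rewrite <- H. push_th. ring.
Qed.

Ltac th_all := repeat (rewrite ?th_add, ?th_sub, ?th_opp, ?th_mul, ?th_kq, ?th_K,
  ?th_A4_sasb, ?th_sa, ?th_sb, ?A3_sasb).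

(** [e4 - V e4] is 240 [V (Lam 3)], which by now is a polynomial in [A4], [sa], [sb]; so invariance
    of the difference under [V] is a ring identity. E_6 is treated likewise with [Lam 5]. *)
Lemma e4_e4h : e4 = e4h.
Proof.
  apply V_fixed.
  - rewrite V_sub.
    transitivity (e4 - (e4 - V e4) - V e4h); [ring|].
    replace (e4 - V e4) with (Q[240] * V (Lam 3)) by (unfold e4, Lam; push_V; ring).
    rewrite Lam3_A4. push_V. 
    replace (V (th A4)) with (Q[1/2] * th (V A4)) by (rewrite th_V; ring).
    rewrite V_e4h, e4h_sasb, V_A4. th_all. ring.
  - unfold e4, e4h, h2. rewrite h4_sb. unfold sb. coef0. rewrite Sg_phi_0.
    change (Sig 3 0%nat) with 0%R. change (X 0%nat) with 0%R. unfold Q2R; simpl; field.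
Qed.

Lemma e6_e6h : e6 = e6h.
Proof.
  apply V_fixed.
  - rewrite V_sub.
    transitivity (e6 - (e6 - V e6) - V e6h); [ring|].
    replace (e6 - V e6) with (- (Q[504] * V (Lam 5))) by (unfold e6, Lam; push_V; ring).
    rewrite Lam5_A4. unfold e6h. push_V. rewrite V_pow.
    replace (V (th (th A4))) with (Q[1/4] * th (th (V A4)))
      by (rewrite !th_V, th_mul, th_kq, th_V; ring).
    replace (V (th A4)) with (Q[1/2] * th (V A4)) by (rewrite th_V; ring).
    rewrite V_h2, h4_sb, V_sb_sqr, h2_sa_sb, V_A4. th_all. ring.
  - unfold e6, e6h, h2. rewrite h4_sb. unfold sb. coef0. rewrite Sg_phi_0.
    change (Sig 5 0%nat) with 0%R. change (X 0%nat) with 0%R. unfold Q2R; simpl; field.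
Qed.

(** The [e2] term is the one that the Serre derivative of weight 2 removes; with [th_h4] this makes
    Serre derivatives act on polynomials in [h2] and [h4]. *)
Lemma th_h2 : th h2 = Q[1/3] * e2 * h2 + Q[1/3] * (h2 * h2 + Q[2] * h2 * h4).
Proof.
  rewrite th_h2_A, e2_e2h. unfold e2h. rewrite h4_sb, h2_sa_sb, A3_sasb. ring.
Qed.

Lemma th_h4 : th h4 = Q[1/3] * e2 * h4 - Q[1/3] * (Q[2] * h2 * h4 + h4 * h4).
Proof.
  rewrite e2_e2h. unfold e2h. rewrite h4_sb, h2_sa_sb, th_mul, th_sb. ring.
Qed.

(* Legendre's four-triangular-numbers theorem. *)
Lemma h2_coef_odd (k : nat) :
  h2 (S (2 * k)) = (16 * INR (Defs.sigma 1 (2 * k + 1)))%R.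
Proof.
  assert (E : h2 = Q[4] * (A3 - A4)) by (rewrite A3_eq; ring).
  rewrite E. unfold kq. rewrite K_mul_coef.
  change ((A3 - A4) (S (2 * k)))
    with ((-1) ^ (S (2 * k)) * A4 (S (2 * k)) + - A4 (S (2 * k)))%R.
  rewrite pow_1_odd.
  change (A4 (S (2 * k))) with (- (Q[2] * Lam 1)%ps (S (2 * k)))%R.
  unfold kq; rewrite K_mul_coef.
  change (Lam 1 (S (2 * k))) with (Sig 1 (S (2 * k)) + - V (Sig 1) (S (2 * k)))%R.
  rewrite V_coef_odd, Nat.add_1_r. unfold Sig, coef, Q2R; simpl; field.
Qed.

Lemma h2_coef_even (k : nat) : h2 (2 * k)%nat = 0%R.
Proof.
  assert (E : h2 = Q[4] * (A3 - A4)) by (rewrite A3_eq; ring).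
  rewrite E. unfold kq. rewrite K_mul_coef.
  change ((A3 - A4) (2 * k)%nat) with ((-1) ^ (2 * k) * A4 (2 * k)%nat + - A4 (2 * k)%nat)%R.
  rewrite pow_1_even. ring.
Qed.

(** * Coefficients of polynomial growth *)

Open Scope R_scope.

(* Forces convergence on the unit disc, and is stable under all the operations. *)
Definition pg (a : ps) : Prop :=
  exists C d, 0 <= C /\ forall n, Rabs (a n) <= C * INR (S n) ^ d.

Lemma INR_S_ge_1 (n : nat) : 1 <= INR (S n).
Proof. rewrite S_INR; pose proof (pos_INR n); lra. Qed.

Lemma pow_INR_S_mono (n d d' : nat) : (d <= d')%nat -> INR (S n) ^ d <= INR (S n) ^ d'.
Proof. intro; apply Rle_pow; auto using INR_S_ge_1. Qed.

Lemma pow_INR_S_pos (n d : nat) : 0 < INR (S n) ^ d.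
Proof. apply pow_lt; pose proof (INR_S_ge_1 n); lra. Qed.

Lemma pg_add (a b : ps) : pg a -> pg b -> pg (a + b)%ps.
Proof.
  intros [C [d [HC Ha]]] [C' [d' [HC' Hb]]].
  exists (C + C'), (d + d')%nat. split; [lra|]. intro n; simpl coef.
  eapply Rle_trans; [apply Rabs_triang|]. specialize (Ha n); specialize (Hb n).
  pose proof (pow_INR_S_mono n d (d + d') ltac:(lia)).
  pose proof (pow_INR_S_mono n d' (d + d') ltac:(lia)). nra.
Qed.

Lemma pg_opp (a : ps) : pg a -> pg (- a)%ps.
Proof.
  intros [C [d [HC Ha]]]. exists C, d. split; [lra|]. intro n; simpl coef.
  now rewrite Rabs_Ropp.
Qed.

Lemma pg_sub (a b : ps) : pg a -> pg b -> pg (a - b)%ps.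
Proof. intros; unfold psub; auto using pg_add, pg_opp. Qed.

Lemma pg_K (r : R) : pg (K r).
Proof.
  exists (Rabs r), 0%nat. split; [apply Rabs_pos|]. intros [|n]; simpl; [lra|].
  rewrite Rabs_R0. pose proof (Rabs_pos r); lra.
Qed.

Lemma pg_kq (q : Q) : pg (kq q).
Proof. apply pg_K. Qed.

Lemma pg_X : pg X.
Proof.
  exists 1, 0%nat. split; [lra|]. intros [|[|n]]; simpl; rewrite ?Rabs_R0, ?Rabs_R1; lra.
Qed.

Lemma pg_mul (a b : ps) : pg a -> pg b -> pg (a * b)%ps.
Proof.
  intros [C [d [HC Ha]]] [C' [d' [HC' Hb]]].
  exists (C * C'), (S (d + d')). split; [nra|]. intro n; simpl coef.
  eapply Rle_trans; [apply Rsum_abs|].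
  eapply Rle_trans; [apply (sum_Rle _ (fun _ => C * C' * INR (S n) ^ (d + d')))|].
  - intros k Hk. rewrite Rabs_mult, pow_add.
    pose proof (Rabs_pos (a k)); pose proof (Rabs_pos (b (n - k)%nat)).
    pose proof (pow_INR_S_pos n d); pose proof (pow_INR_S_pos n d').
    assert (Rabs (a k) <= C * INR (S n) ^ d).
    { eapply Rle_trans; [apply Ha|]. apply Rmult_le_compat_l; [lra|].
      apply pow_incr. split; [apply pos_INR|apply le_INR; lia]. }
    assert (Rabs (b (n - k)%nat) <= C' * INR (S n) ^ d').
    { eapply Rle_trans; [apply Hb|]. apply Rmult_le_compat_l; [lra|].
      apply pow_incr. split; [apply pos_INR|apply le_INR; lia]. }
    replace (C * C' * (INR (S n) ^ d * INR (S n) ^ d'))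
      with ((C * INR (S n) ^ d) * (C' * INR (S n) ^ d')) by ring.
    apply Rmult_le_compat; auto.
  - rewrite sum_cte, <- tech_pow_Rmult. apply Req_le; ring.
Qed.

Lemma pg_pow (a : ps) (n : nat) : pg a -> pg (a ^ n)%ps.
Proof. intro; induction n; simpl; auto using pg_K, pg_mul. Qed.

Lemma pg_th (a : ps) : pg a -> pg (th a).
Proof.
  intros [C [d [HC Ha]]]. exists C, (S d). split; [lra|]. intro n; simpl coef.
  rewrite Rabs_mult, (Rabs_pos_eq (INR n)), <- tech_pow_Rmult by apply pos_INR.
  specialize (Ha n). pose proof (Rabs_pos (a n)).
  apply Rle_trans with (INR (S n) * (C * INR (S n) ^ d)); [|apply Req_le; ring].
  apply Rmult_le_compat; auto using pos_INR. apply le_INR; lia.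
Qed.

Lemma pg_V (a : ps) : pg a -> pg (V a).
Proof.
  intros [C [d [HC Ha]]]. exists C, d. split; [lra|]. intro n.
  destruct (even_odd_dec n) as [[m ->]|[m ->]].
  - rewrite V_coef_double. eapply Rle_trans; [apply Ha|].
    apply Rmult_le_compat_l; [lra|]. apply pow_incr.
    split; [apply pos_INR|apply le_INR; lia].
  - rewrite V_coef_odd, Rabs_R0. pose proof (pow_INR_S_pos (S (2 * m)) d). nra.
Qed.

Lemma pg_Sg (a : ps) : pg a -> pg (Sg a).
Proof.
  intros [C [d [HC Ha]]]. exists C, d. split; [lra|]. intro n; simpl coef.
  rewrite Rabs_mult, pow_1_abs, Rmult_1_l. apply Ha.
Qed.

Lemma pg_lac (s : nat -> nat) (c : nat -> R) : pg (Ps c) -> pg (lac s c).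
Proof.
  intros [C [d [HC Hc]]]. exists C, (S d). split; [lra|]. intro n; simpl coef.
  eapply Rle_trans; [apply Rsum_abs|].
  eapply Rle_trans; [apply (sum_Rle _ (fun _ => C * INR (S n) ^ d))|].
  - intros k Hk. assert (Rabs (c k) <= C * INR (S n) ^ d).
    { eapply Rle_trans; [apply Hc|]. apply Rmult_le_compat_l; [lra|].
      apply pow_incr. split; [apply pos_INR|apply le_INR; lia]. }
    destruct (s k =? n)%nat; [assumption|].
    rewrite Rabs_R0. pose proof (Rabs_pos (c k)); lra.
  - rewrite sum_cte, <- tech_pow_Rmult. apply Req_le; ring.
Qed.

Lemma pg_phi : pg phi.
Proof.
  apply pg_add; apply pg_lac; exists 1, 0%nat;
    (split; [lra|intro; simpl; rewrite Rabs_R1; lra]).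
Qed.

Lemma pg_psi : pg psi.
Proof.
  apply pg_add; apply pg_lac; exists 1, 0%nat;
    (split; [lra|intro; simpl; rewrite Rabs_R1; lra]).
Qed.

Lemma sigma_le (k n : nat) : (Defs.sigma k n <= n * n ^ k)%nat.
Proof.
  unfold Defs.sigma.
  set (l := filter _ _).
  assert (Hl : forall m, In m l -> (m <= n)%nat).
  { intros m Hm. apply filter_In in Hm as [Hm _]. apply in_seq in Hm. lia. }
  assert (Ll : (length l <= n)%nat).
  { unfold l. eapply Nat.le_trans; [apply filter_length_le|]. now rewrite length_seq. }
  apply (Nat.le_trans _ (length l * n ^ k)); [|now apply Nat.mul_le_mono_r].
  clear Ll. induction l as [|m l IH]; [apply Nat.le_0_l|].
  cbn [map length].
  change (list_sum (m ^ k :: map (fun m => m ^ k) l)%nat)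
    with (m ^ k + list_sum (map (fun m => m ^ k) l))%nat.
  rewrite Nat.mul_succ_l, Nat.add_comm. apply Nat.add_le_mono.
  - apply IH. intros; apply Hl; now right.
  - apply Nat.pow_le_mono_l, Hl. now left.
Qed.

Lemma pg_Sig (k : nat) : pg (Sig k).
Proof.
  exists 1, (S k). split; [lra|]. intro n; simpl coef.
  rewrite Rabs_pos_eq, Rmult_1_l, <- pow_INR by apply pos_INR.
  apply le_INR. eapply Nat.le_trans; [apply sigma_le|].
  apply (Nat.pow_le_mono_l n (S n) (S k)). lia.
Qed.

Lemma pg_Lam (k : nat) : pg (Lam k).
Proof. apply pg_sub; auto using pg_V, pg_Sig. Qed.

Create HintDb pg.
#[export] Hint Resolve pg_add pg_opp pg_sub pg_K pg_kq pg_X pg_mul pg_pow pg_th pg_V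
  pg_Sg pg_phi pg_psi pg_Sig pg_Lam : pg.

Lemma CV_radius_pow_INR (d : nat) : CV_radius (fun n => INR (S n) ^ d) = Finite 1.
Proof.
  rewrite (CV_radius_finite_DAlembert _ 1); [f_equal; field| |lra|].
  - intro n. apply Rgt_not_eq, pow_INR_S_pos.
  - apply (is_lim_seq_ext (fun n => (1 + / INR (S n)) ^ d)).
    + intro n. pose proof (INR_S_ge_1 n). rewrite Rabs_pos_eq.
      * unfold Rdiv. rewrite <- pow_inv, <- Rpow_mult_distr. f_equal.
        rewrite (S_INR (S n)). field; lra.
      * apply Rmult_le_pos; [left; apply pow_INR_S_pos|].
        left; apply Rinv_0_lt_compat, pow_INR_S_pos.
    + replace (Finite 1) with (Finite ((1 + 0) ^ d))
        by (rewrite Rplus_0_r, pow1; reflexivity).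
      induction d as [|d IH]; [apply is_lim_seq_const|].
      simpl pow. apply is_lim_seq_mult'; [|exact IH].
      apply is_lim_seq_plus'; [apply is_lim_seq_const|].
      apply (is_lim_seq_incr_1 (fun n => / INR n)).
      replace (Finite 0) with (Rbar_inv p_infty) by reflexivity.
      apply is_lim_seq_inv; [apply is_lim_seq_INR|easy].
Qed.

Lemma pg_ex_series (a : ps) (r : R) : pg a -> 0 <= r < 1 ->
  ex_series (fun n => Rabs (a n) * r ^ n).
Proof.
  intros [C [d [HC Ha]]] Hr.
  apply (ex_series_le (fun n => Rabs (a n) * r ^ n)
    (fun n => C * Rabs (INR (S n) ^ d * r ^ n))).
  - intro n. change norm with Rabs. rewrite !Rabs_mult, Rabs_Rabsolu.
    rewrite (Rabs_pos_eq (INR (S n) ^ d)) by (left; apply pow_INR_S_pos).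
    rewrite <- Rmult_assoc. apply Rmult_le_compat_r; [apply Rabs_pos|apply Ha].
  - apply (ex_series_scal_l (K := R_AbsRing) (V := R_NormedModule) C).
    apply (CV_disk_inside (fun n => INR (S n) ^ d)).
    rewrite CV_radius_pow_INR, Rabs_pos_eq; simpl; lra.
Qed.

Lemma pg_CV_radius (a : ps) (x : R) : pg a -> Rabs x < 1 ->
  Rbar_lt (Rabs x) (CV_radius a).
Proof.
  intros Ha Hx.
  destruct (Rbar_lt_le_dec (Rabs x) (CV_radius a)) as [H|H]; [exact H|exfalso].
  (* A point strictly between |x| and 1. The terms of the series tend to 0 there, so it cannot lie
     outside the disc of convergence. *)
  set (r := (1 + Rabs x) / 2). pose proof (Rabs_pos x).
  apply (CV_disk_outside a r).
  - eapply Rbar_le_lt_trans; [exact H|]. simpl. rewrite (Rabs_pos_eq r); unfold r; lra.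
  - apply is_lim_seq_abs_0. apply (is_lim_seq_ext (fun n => Rabs (a n) * r ^ n)).
    + intro n. rewrite Rabs_mult, <- RPow_abs, (Rabs_pos_eq r); [reflexivity|unfold r; lra].
    + apply ex_series_lim_0, pg_ex_series; [exact Ha|unfold r; lra].
Qed.

(** * Evaluation on the upper half-plane *)

Lemma qpow_eq (r x y : R) :
  qpow r (x, y) = (exp (- (2 * PI * r * y)) * cos (2 * PI * r * x),
                   exp (- (2 * PI * r * y)) * sin (2 * PI * r * x))%R.
Proof.
  unfold qpow, Cexp.
  assert (E : (2 * PI * Ci * r * (x, y))%C = (- (2 * PI * r * y), 2 * PI * r * x)%R).
  { unfold Ci, RtoC, Cmult; simpl; f_equal; ring. }
  rewrite E; reflexivity.
Qed.

Lemma qpow_add (r s : R) (z : C) : qpow (r + s) z = (qpow r z * qpow s z)%C.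
Proof.
  destruct z as [x y]. rewrite !qpow_eq. unfold Cmult; simpl.
  replace (- (2 * PI * (r + s) * y)) with (- (2 * PI * r * y) + - (2 * PI * s * y)) by ring.
  replace (2 * PI * (r + s) * x) with (2 * PI * r * x + 2 * PI * s * x) by ring.
  rewrite exp_plus, cos_plus, sin_plus. f_equal; ring.
Qed.

Definition nome (z : C) : R := exp (- (PI * Im z)).

Lemma nome_bounds (z : C) : upper z -> 0 < nome z < 1.
Proof.
  unfold upper, nome; intro H. split; [apply exp_pos|].
  rewrite <- exp_0. apply exp_increasing. pose proof PI_RGT_0. nra.
Qed.

Lemma exp_mult_INR (n : nat) (x : R) : exp (INR n * x) = exp x ^ n.
Proof.
  induction n as [|n IH]; [simpl; now rewrite Rmult_0_l, exp_0|].
  rewrite S_INR, Rmult_plus_distr_r, exp_plus, IH. simpl. rewrite Rmult_1_l; ring.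
Qed.

Definition xc (n : nat) (z : C) : R := nome z ^ n * cos (PI * INR n * Re z).
Definition xs (n : nat) (z : C) : R := nome z ^ n * sin (PI * INR n * Re z).

Lemma qpow_half (n : nat) (z : C) : qpow (INR n / 2) z = (xc n z, xs n z).
Proof.
  destruct z as [x y]. rewrite qpow_eq. unfold xc, xs, nome; simpl Re; simpl Im.
  rewrite <- exp_mult_INR.
  replace (- (2 * PI * (INR n / 2) * y)) with (INR n * - (PI * y)) by field.
  replace (2 * PI * (INR n / 2) * x) with (PI * INR n * x) by field. reflexivity.
Qed.

Definition Ev (a : ps) (z : C) : C := CSeries (fun n => RtoC (a n) * qpow (INR n / 2) z)%C.

Lemma Ev_eq (a : ps) (z : C) :
  Ev a z = (Series (fun n => a n * xc n z), Series (fun n => a n * xs n z)).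
Proof.
  unfold Ev, CSeries. f_equal; apply Series_ext; intro n;
    rewrite qpow_half; unfold Cmult, RtoC; simpl; ring.
Qed.

Lemma Rabs_trig (r t : R) : 0 <= r -> Rabs (r * cos t) <= r /\ Rabs (r * sin t) <= r.
Proof.
  intro Hr. rewrite !Rabs_mult, (Rabs_pos_eq r) by exact Hr.
  pose proof (COS_bound t); pose proof (SIN_bound t).
  assert (Rabs (cos t) <= 1) by (apply Rabs_le; lra).
  assert (Rabs (sin t) <= 1) by (apply Rabs_le; lra).
  split; nra.
Qed.

Lemma xcs_bound (n : nat) (z : C) : Rabs (xc n z) <= nome z ^ n /\ Rabs (xs n z) <= nome z ^ n.
Proof. apply Rabs_trig, pow_le. unfold nome. left; apply exp_pos. Qed.

Lemma ex_series_Ev_abs (a : ps) (z : C) : pg a -> upper z ->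
  ex_series (fun n => Rabs (a n * xc n z)) /\ ex_series (fun n => Rabs (a n * xs n z)).
Proof.
  intros Ha Hz. pose proof (nome_bounds z Hz).
  pose proof (pg_ex_series a (nome z) Ha ltac:(lra)) as S.
  split; (eapply (ex_series_le (fun n => Rabs _)); [|exact S]); intro n;
    change norm with Rabs; rewrite Rabs_Rabsolu, Rabs_mult;
    (apply Rmult_le_compat_l; [apply Rabs_pos|apply xcs_bound]).
Qed.

Lemma ex_series_Ev (a : ps) (z : C) : pg a -> upper z ->
  ex_series (fun n => a n * xc n z) /\ ex_series (fun n => a n * xs n z).
Proof.
  intros Ha Hz. destruct (ex_series_Ev_abs a z Ha Hz).
  split; now apply ex_series_Rabs.
Qed.

Lemma Ev_add (a b : ps) (z : C) : pg a -> pg b -> upper z ->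
  Ev (a + b)%ps z = (Ev a z + Ev b z)%C.
Proof.
  intros Ha Hb Hz. rewrite !Ev_eq. unfold Cplus; simpl.
  destruct (ex_series_Ev a z Ha Hz), (ex_series_Ev b z Hb Hz).
  f_equal; rewrite <- Series_plus by assumption; apply Series_ext; intro; ring.
Qed.

Lemma Ev_K_mul (r : R) (a : ps) (z : C) : Ev (K r * a)%ps z = (RtoC r * Ev a z)%C.
Proof.
  rewrite !Ev_eq. unfold Cmult, RtoC. cbn [fst snd].
  rewrite !Rmult_0_l, Rminus_0_r, Rplus_0_r, <- !Series_scal_l.
  f_equal; apply Series_ext; intro n; rewrite K_mul_coef; ring.
Qed.

Lemma Ev_K (r : R) (z : C) : upper z -> Ev (K r) z = RtoC r.
Proof.
  intro Hz. replace (K r) with (K r * K 1)%ps by ring. rewrite Ev_K_mul.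
  enough (E : Ev (K 1) z = 1%C) by (rewrite E; ring).
  rewrite Ev_eq.
  pose proof (ex_series_Ev (K 1) z (pg_K 1) Hz) as [E1 E2].
  unfold RtoC; f_equal; rewrite Series_incr_1 by assumption.
  - rewrite (Series_ext _ (fun n => 0 * xc (S n) z)) by reflexivity.
    rewrite Series_scal_l. unfold xc; simpl.
    rewrite Rmult_0_r, Rmult_0_l, cos_0. ring.
  - rewrite (Series_ext _ (fun n => 0 * xs (S n) z)) by reflexivity.
    rewrite Series_scal_l. unfold xs; simpl.
    rewrite Rmult_0_r, Rmult_0_l, sin_0. ring.
Qed.

Lemma Ev_opp (a : ps) (z : C) : Ev (- a)%ps z = (- Ev a z)%C.
Proof.
  replace (- a)%ps with (K (- (1)) * a)%ps by (rewrite K_opp; ring).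
  rewrite Ev_K_mul, RtoC_opp. ring.
Qed.

Lemma Ev_sub (a b : ps) (z : C) : pg a -> pg b -> upper z ->
  Ev (a - b)%ps z = (Ev a z - Ev b z)%C.
Proof.
  intros. unfold psub. rewrite Ev_add, Ev_opp; auto with pg. 
Qed.

Lemma xcs_add (k n : nat) (z : C) : (k <= n)%nat ->
  xc n z = xc k z * xc (n - k) z - xs k z * xs (n - k) z /\
  xs n z = xc k z * xs (n - k) z + xs k z * xc (n - k) z.
Proof.
  intro H. unfold xc, xs.
  replace (nome z ^ n) with (nome z ^ k * nome z ^ (n - k))
    by (rewrite <- pow_add; f_equal; lia).
  replace (PI * INR n * Re z) with (PI * INR k * Re z + PI * INR (n - k) * Re z)
    by (rewrite minus_INR by exact H; ring).
  rewrite cos_plus, sin_plus. split; ring.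
Qed.

Lemma Ev_mul (a b : ps) (z : C) : pg a -> pg b -> upper z ->
  Ev (a * b)%ps z = (Ev a z * Ev b z)%C.
Proof.
  intros Ha Hb Hz. rewrite !Ev_eq. unfold Cmult; cbn [fst snd].
  destruct (ex_series_Ev a z Ha Hz) as [ac as_], (ex_series_Ev b z Hb Hz) as [bc bs].
  destruct (ex_series_Ev_abs a z Ha Hz) as [ac' as'],
    (ex_series_Ev_abs b z Hb Hz) as [bc' bs'].
  apply Series_correct in ac, as_, bc, bs.
  f_equal; apply is_series_unique.
  - eapply is_series_ext;
      [|exact (is_series_minus _ _ _ _ (is_series_mult _ _ _ _ ac bc ac' bc')
          (is_series_mult _ _ _ _ as_ bs as' bs'))].
    intro n. cbn beta.
    transitivity (sum_f_R0 (fun k => a k * xc k z * (b (n - k)%nat * xc (n - k) z)) n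
      - sum_f_R0 (fun k => a k * xs k z * (b (n - k)%nat * xs (n - k) z)) n);
      [reflexivity|].
    rewrite <- minus_sum. simpl coef. rewrite Rmult_comm, scal_sum.
    apply sum_eq; intros k Hk. rewrite (proj1 (xcs_add k n z Hk)). ring.
  - eapply is_series_ext;
      [|exact (is_series_plus _ _ _ _ (is_series_mult _ _ _ _ ac bs ac' bs')
          (is_series_mult _ _ _ _ as_ bc as' bc'))].
    intro n. cbn beta.
    transitivity (sum_f_R0 (fun k => a k * xc k z * (b (n - k)%nat * xs (n - k) z)) n
      + sum_f_R0 (fun k => a k * xs k z * (b (n - k)%nat * xc (n - k) z)) n);
      [reflexivity|].
    rewrite <- plus_sum. simpl coef. rewrite Rmult_comm, scal_sum.
    apply sum_eq; intros k Hk. rewrite (proj2 (xcs_add k n z Hk)). ring.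
Qed.

Lemma Ev_pow (a : ps) (n : nat) (z : C) : pg a -> upper z ->
  Ev (a ^ n)%ps z = (Ev a z ^ n)%C.
Proof.
  intros Ha Hz. induction n as [|n IH]; simpl; [now apply Ev_K|].
  rewrite Ev_mul, IH; auto with pg.
Qed.

Lemma Series_incr_2 (u : nat -> R) : ex_series u ->
  Series u = u 0%nat + (u 1%nat + Series (fun n => u (S (S n)))).
Proof.
  intro H. rewrite Series_incr_1 by exact H. f_equal.
  apply (Series_incr_1 (fun n => u (S n))).
  now apply (ex_series_incr_1 (K := R_AbsRing) (V := R_NormedModule) u).
Qed.

Lemma Ev_X (z : C) : upper z -> Ev X z = qpow (1 / 2) z.
Proof.
  intro Hz. rewrite Ev_eq. change 1 with (INR 1) at 1. rewrite qpow_half.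
  destruct (ex_series_Ev X z pg_X Hz).
  f_equal; rewrite Series_incr_2 by assumption.
  - rewrite (Series_ext _ (fun n => 0 * xc (S (S n)) z)) by reflexivity.
    rewrite Series_scal_l. simpl; ring.
  - rewrite (Series_ext _ (fun n => 0 * xs (S (S n)) z)) by reflexivity.
    rewrite Series_scal_l. simpl; ring.
Qed.

(** * Termwise differentiation on the upper half-plane *)

Lemma trig_lipschitz (a b : R) : Rabs (cos b - cos a) <= Rabs (b - a)
  /\ Rabs (sin b - sin a) <= Rabs (b - a).
Proof.
  split.
  - destruct (MVT_gen cos a b (fun x => - sin x)) as [c [_ ->]].
    + intros x _. auto_derive; [easy|ring].
    + intros x _. apply continuity_pt_filterlim, continuous_cos.
    + rewrite Rabs_mult, Rabs_Ropp. pose proof (SIN_bound c).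
      assert (Rabs (sin c) <= 1) by (apply Rabs_le; lra).
      pose proof (Rabs_pos (b - a)). nra.
  - destruct (MVT_gen sin a b cos) as [c [_ ->]].
    + intros x _. auto_derive; [easy|ring].
    + intros x _. apply continuity_pt_filterlim, continuous_sin.
    + rewrite Rabs_mult. pose proof (COS_bound c).
      assert (Rabs (cos c) <= 1) by (apply Rabs_le; lra).
      pose proof (Rabs_pos (b - a)). nra.
Qed.

Lemma trig_taylor (u v : R) : Rabs (cos (u + v) - cos u + v * sin u) <= v ^ 2
  /\ Rabs (sin (u + v) - sin u - v * cos u) <= v ^ 2.
Proof.
  assert (B : forall c, Rmin u (u + v) <= c <= Rmax u (u + v) -> Rabs (c - u) <= Rabs v).
  { intros c. unfold Rmin, Rmax. destruct (Rle_dec u (u + v)); intro H;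
      [rewrite !Rabs_pos_eq|rewrite !Rabs_left1]; lra. }
  pose proof (Rabs_pos v). rewrite <- (pow2_abs v). split.
  - destruct (MVT_gen cos u (u + v) (fun x => - sin x)) as [c [Hc E]].
    + intros x _. auto_derive; [easy|ring].
    + intros x _. apply continuity_pt_filterlim, continuous_cos.
    + rewrite E. replace (- sin c * (u + v - u) + v * sin u)
        with (v * - (sin c - sin u)) by ring.
      rewrite Rabs_mult, Rabs_Ropp. simpl. rewrite Rmult_1_r.
      apply Rmult_le_compat_l; [easy|]. specialize (B c Hc).
      pose proof (proj2 (trig_lipschitz u c)). lra.
  - destruct (MVT_gen sin u (u + v) cos) as [c [Hc E]].
    + intros x _. auto_derive; [easy|ring].
    + intros x _. apply continuity_pt_filterlim, continuous_sin.
    + rewrite E. replace (cos c * (u + v - u) - v * cos u)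
        with (v * (cos c - cos u)) by ring.
      rewrite Rabs_mult. simpl. rewrite Rmult_1_r.
      apply Rmult_le_compat_l; [easy|]. specialize (B c Hc).
      pose proof (proj1 (trig_lipschitz u c)). lra.
Qed.

Lemma is_lim_quotient (f : R -> R) (x l M : R) :
  (forall h, Rabs (f (x + h) - f x - h * l) <= M * h ^ 2) ->
  is_lim (fun y => (f y - f x) / (y - x)) x l.
Proof.
  intro H. apply is_lim_spec. intro eps. simpl.
  assert (HM : 0 <= M).
  { specialize (H 1). pose proof (Rabs_pos (f (x + 1) - f x - 1 * l)). lra. }
  assert (Hd : 0 < eps / (M + 1)) by (apply Rdiv_lt_0_compat; [apply eps|lra]).
  exists (mkposreal _ Hd).
  enough (A : forall y : R, Rabs (y - x) < eps / (M + 1) -> y <> x ->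
    Rabs ((f y - f x) / (y - x) - l) < eps) by exact A.
  intros y Hy Hyx.
  assert (P : 0 < Rabs (y - x)) by (apply Rabs_pos_lt; lra).
  replace ((f y - f x) / (y - x) - l) with ((f y - f x - (y - x) * l) / (y - x))
    by (field; lra).
  specialize (H (y - x)). replace (x + (y - x)) with y in H by ring.
  unfold Rdiv. rewrite Rabs_mult, Rabs_inv.
  apply (Rmult_lt_reg_r (Rabs (y - x))); [exact P|].
  rewrite Rmult_assoc, Rinv_l, Rmult_1_r by lra.
  rewrite <- pow2_abs in H.
  apply (Rle_lt_trans _ _ _ H).
  assert (Rabs (y - x) * (M + 1) < eps).
  { apply (Rmult_lt_compat_r (M + 1)) in Hy; [|lra].
    unfold Rdiv in Hy. rewrite Rmult_assoc, Rinv_l in Hy; lra. }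
  simpl. nra.
Qed.

Lemma Lim_horizontal (f : R -> R) (x l M : R) :
  (forall h, Rabs (f (x + h) - f x - h * l) <= M * h ^ 2) ->
  real (Lim (fun y => (f y - f x) / (y - x)) x) = l.
Proof. intro H. now rewrite (is_lim_unique _ _ _ (is_lim_quotient f x l M H)). Qed.

Lemma Series_Taylor (u v w : nat -> R) (B : nat -> R) (h : R) :
  ex_series u -> ex_series v -> ex_series w -> ex_series B ->
  (forall n, Rabs (u n - v n - h * w n) <= B n * h ^ 2) ->
  Rabs (Series u - Series v - h * Series w) <= Series B * h ^ 2.
Proof.
  intros Hu Hv Hw HB H.
  rewrite <- Series_scal_l, <- !Series_minus, <- Series_scal_r; auto.
  - eapply Rle_trans; [apply Series_Rabs|apply Series_le].
    + apply (ex_series_le (fun n => Rabs (u n - v n - h * w n)) (fun n => B n * h ^ 2)).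
      * intro n. change norm with Rabs. rewrite Rabs_Rabsolu. apply H.
      * now apply (ex_series_scal_r (h ^ 2)).
    + intro n. split; [apply Rabs_pos|apply H].
    + now apply (ex_series_scal_r (h ^ 2)).
  - now apply (ex_series_minus (K := R_AbsRing) (V := R_NormedModule)).
  - now apply (ex_series_scal_l (K := R_AbsRing) (V := R_NormedModule) h).
Qed.

Lemma Cdiv_horizontal (p p' : C) (x x' y : R) : x' <> x ->
  ((p - p') / ((x', y) - (x, y)))%C
  = ((fst p - fst p') / (x' - x), (snd p - snd p') / (x' - x)).
Proof.
  intro H. destruct p as [p q], p' as [p' q'].
  unfold Cdiv, Cminus, Cplus, Copp, Cinv, Cmult. cbn [fst snd].
  f_equal; field; (split; [lra|]); nra.
Qed.

(** [C_derive] is a pair of real limits along the horizontal line through the point, so real Taylor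
    bounds with quadratic remainder determine it. *)
Lemma C_lim_horizontal (F : C -> C) (x y l l' M : R) :
  (forall h, Rabs (fst (F (x + h, y)) - fst (F (x, y)) - h * l) <= M * h ^ 2) ->
  (forall h, Rabs (snd (F (x + h, y)) - snd (F (x, y)) - h * l') <= M * h ^ 2) ->
  C_derive F (x, y) = (l, l').
Proof.
  intros H H'. unfold C_derive, C_lim. cbn [fst snd].
  f_equal.
  - rewrite <- (Lim_horizontal (fun x' => fst (F (x', y))) x l M H). f_equal.
    apply is_lim_unique. eapply is_lim_ext_loc; [|apply Lim_correct; exists l;
      exact (is_lim_quotient (fun x' => fst (F (x', y))) x l M H)].
    exists posreal_one. intros x' _ Hx'. cbn beta. now rewrite Cdiv_horizontal.
  - rewrite <- (Lim_horizontal (fun x' => snd (F (x', y))) x l' M H'). f_equal.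
    apply is_lim_unique. eapply is_lim_ext_loc; [|apply Lim_correct; exists l';
      exact (is_lim_quotient (fun x' => snd (F (x', y))) x l' M H')].
    exists posreal_one. intros x' _ Hx'. cbn beta. now rewrite Cdiv_horizontal.
Qed.

Lemma C_derive_Ev (a : ps) (z : C) : pg a -> upper z ->
  C_derive (Ev a) z = (PI * Ci * Ev (th a) z)%C.
Proof.
  intros Ha Hz. destruct z as [x y].
  assert (Hup : forall x', upper (x', y)) by (intro; exact Hz).
  set (r := nome (x, y)).
  assert (Hr : 0 <= r < 1) by (pose proof (nome_bounds _ Hz); unfold r; lra).
  (* Majorant of the second-order remainders. The modulus of q^(n/2) is r^n on the whole horizontal
     line, so one bound serves all h. *)
  set (B := fun n => PI ^ 2 * (Rabs (th (th a) n) * r ^ n)).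
  assert (HB : ex_series B).
  { apply (ex_series_scal_l (K := R_AbsRing) (V := R_NormedModule) (PI ^ 2)).
    apply pg_ex_series; auto with pg. }
  destruct (ex_series_Ev (th a) _ (pg_th _ Ha) Hz) as [tc ts].
  assert (T : forall n h, B n * h ^ 2 = Rabs (a n) * r ^ n * (PI * INR n * h) ^ 2).
  { intros n h. unfold B. simpl coef.
    rewrite !Rabs_mult, (Rabs_pos_eq (INR n)) by apply pos_INR. ring. }
  transitivity ((- PI * snd (Ev (th a) (x, y)), PI * fst (Ev (th a) (x, y))) : C).
  2:{ unfold Ci, RtoC, Cmult; simpl. f_equal; ring. }
  rewrite Ev_eq. cbn [fst snd]. rewrite <- !Series_scal_l.
  apply (C_lim_horizontal _ _ _ _ _ (Series B)); intro h; rewrite !Ev_eq; cbn [fst snd];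
    destruct (ex_series_Ev a _ Ha Hz) as [ac as_],
      (ex_series_Ev a _ Ha (Hup (x + h))) as [ac' as'];
    (apply Series_Taylor; [assumption|assumption| |exact HB|]).
  1,3: now apply (ex_series_scal_l (K := R_AbsRing) (V := R_NormedModule)).
  - intro n. rewrite T. unfold xc, xs. simpl Re. change (nome (x + h, y)) with r.
    fold r.
    replace (PI * INR n * (x + h)) with (PI * INR n * x + PI * INR n * h) by ring.
    set (u := PI * INR n * x). set (v := PI * INR n * h).
    match goal with |- Rabs ?e <= _ =>
      replace e with (a n * r ^ n * (cos (u + v) - cos u + v * sin u)) by (unfold v; simpl coef; ring) end.
    rewrite !Rabs_mult, (Rabs_pos_eq (r ^ n)) by (apply pow_le; lra).
    apply Rmult_le_compat_l; [|apply trig_taylor].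
    apply Rmult_le_pos; [apply Rabs_pos|apply pow_le; lra].
  - intro n. rewrite T. unfold xc, xs. simpl Re. change (nome (x + h, y)) with r.
    fold r.
    replace (PI * INR n * (x + h)) with (PI * INR n * x + PI * INR n * h) by ring.
    set (u := PI * INR n * x). set (v := PI * INR n * h).
    match goal with |- Rabs ?e <= _ =>
      replace e with (a n * r ^ n * (sin (u + v) - sin u - v * cos u)) by (unfold v; simpl coef; ring) end.
    rewrite !Rabs_mult, (Rabs_pos_eq (r ^ n)) by (apply pow_le; lra).
    apply Rmult_le_compat_l; [|apply trig_taylor].
    apply Rmult_le_pos; [apply Rabs_pos|apply pow_le; lra].
Qed.

(* [C_derive] only looks along horizontal lines. *)
Lemma C_derive_ext_upper (F G : C -> C) (z : C) : upper z ->
  (forall z', upper z' -> F z' = G z') -> C_derive F z = C_derive G z.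
Proof.
  intros Hz H. destruct z as [x y]. unfold C_derive, C_lim. cbn [fst snd].
  assert (Hup : forall x', upper (x', y)) by (intro; exact Hz).
  f_equal; f_equal; apply Lim_ext; intro x'; now rewrite !H.
Qed.

Lemma D_Ev (F : C -> C) (a : ps) (z : C) : pg a -> upper z ->
  (forall z', upper z' -> F z' = Ev a z') -> Defs.D F z = Ev (Q[1/2] * th a)%ps z.
Proof.
  intros Ha Hz H. unfold Defs.D.
  rewrite (C_derive_ext_upper _ _ _ Hz H), C_derive_Ev by assumption.
  unfold kq. rewrite Ev_K_mul.
  replace (RtoC (Q2R (1/2))) with (/ 2)%C
    by (unfold Q2R; simpl; rewrite RtoC_mult, RtoC_inv, Cmult_1_l; auto).
  assert (PI <> 0) by (pose proof PI_RGT_0; lra).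
  field. repeat split; intro E;
    solve [apply (f_equal snd) in E; simpl in E; lra
          |apply (f_equal fst) in E; simpl in E; lra].
Qed.

(** * The functions of the statement as power series in the nome *)

Lemma lac_le (s : nat -> nat) (m : nat) : (forall k, s k < s (S k))%nat -> (m <= s m)%nat.
Proof. intro Hs. induction m as [|m IH]; [lia|]. specialize (Hs m). lia. Qed.

Lemma lac_mono (s : nat -> nat) (m k : nat) : (forall k, s k < s (S k))%nat ->
  (m < k)%nat -> (s m < s k)%nat.
Proof.
  intros Hs H. induction H as [|k H IH]; [apply Hs|]. specialize (Hs k). lia.
Qed.

Lemma sum_lac (s : nat -> nat) (c u : nat -> R) (n : nat) :
  (forall k, s k < s (S k))%nat ->
  sum_f_R0 (fun k => lac s c k * u k) n
  = sum_f_R0 (fun m => if (s m <=? n)%nat then c m * u (s m) else 0) n.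
Proof.
  intro Hs. induction n as [|n IH].
  - simpl. destruct (Nat.eqb_spec (s 0%nat) 0) as [E|E], (Nat.leb_spec (s 0%nat) 0);
      try lia; [now rewrite E|ring].
  - rewrite tech5, IH.
    transitivity (sum_f_R0 (fun m => if (s m <=? n)%nat then c m * u (s m) else 0) (S n)
      + sum_f_R0 (fun m => (if (s m =? S n)%nat then c m else 0) * u (S n)) (S n)).
    + rewrite tech5. pose proof (lac_le s (S n) Hs).
      destruct (Nat.leb_spec (s (S n)) n); [lia|]. rewrite Rplus_0_r. f_equal.
      change (lac s c (S n)) with
        (sum_f_R0 (fun m => if (s m =? S n)%nat then c m else 0) (S n)).
      rewrite Rmult_comm, scal_sum. reflexivity.
    + rewrite <- plus_sum. apply sum_eq; intros m _.
      destruct (Nat.leb_spec (s m) n), (Nat.leb_spec (s m) (S n)),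
        (Nat.eqb_spec (s m) (S n)); try lia; try ring.
      rewrite e. ring.
Qed.

(** The partial sums of the sparse sum are the partial sums of the power series at the indices
    [s n], a subsequence of a convergent sequence. *)
Lemma is_series_lac (s : nat -> nat) (c u : nat -> R) (l : R) :
  (forall k, s k < s (S k))%nat ->
  is_series (fun n => lac s c n * u n) l -> is_series (fun m => c m * u (s m)) l.
Proof.
  intros Hs H.
  change (is_lim_seq (sum_n (fun n => lac s c n * u n)) l) in H.
  change (is_lim_seq (sum_n (fun m => c m * u (s m))) l).
  apply (is_lim_seq_subseq _ _ s) in H.
  - revert H. apply is_lim_seq_ext. intro n.
    rewrite !sum_n_Reals, sum_lac by exact Hs.
    pose proof (lac_le s n Hs).
    assert (E : forall k, (n <= k)%nat -> sum_f_R0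
      (fun m => if (s m <=? s n)%nat then c m * u (s m) else 0) k
      = sum_f_R0 (fun m => c m * u (s m)) n).
    { induction 1 as [|k Hk IH].
      - apply sum_eq. intros m Hm. destruct (Nat.leb_spec (s m) (s n)); [reflexivity|].
        destruct (Nat.eq_dec m n) as [->|]; [lia|].
        pose proof (lac_mono s m n Hs). lia.
      - rewrite tech5, IH. pose proof (lac_mono s n (S k) Hs).
        destruct (Nat.leb_spec (s (S k)) (s n)); [lia|ring]. }
    now apply E.
  - apply eventually_subseq. exact Hs.
Qed.

Lemma Ev_lac (s : nat -> nat) (c : nat -> R) (z : C) :
  (forall k, s k < s (S k))%nat -> pg (lac s c) -> upper z ->
  Ev (lac s c) z = CSeries (fun m => RtoC (c m) * qpow (INR (s m) / 2) z)%C /\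
  ex_series (fun m => c m * xc (s m) z) /\ ex_series (fun m => c m * xs (s m) z).
Proof.
  intros Hs Hc Hz. destruct (ex_series_Ev _ z Hc Hz) as [H1 H2].
  apply Series_correct in H1, H2. rewrite Ev_eq.
  pose proof (is_series_lac s c (fun n => xc n z) _ Hs H1) as L1.
  pose proof (is_series_lac s c (fun n => xs n z) _ Hs H2) as L2.
  split; [|split; eexists; eassumption].
  rewrite <- (is_series_unique _ _ L1), <- (is_series_unique _ _ L2).
  unfold CSeries. f_equal; apply Series_ext; intro m; rewrite qpow_half;
    unfold Cmult, RtoC; simpl; ring.
Qed.

Lemma pg_lac_bounded (s : nat -> nat) (c : nat -> R) :
  (forall m, Rabs (c m) <= 1) -> pg (lac s c).
Proof.
  intro H. apply pg_lac. exists 1, 0%nat. split; [lra|]. intro n. simpl. rewrite Rmult_1_r.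
  apply H.
Qed.

Lemma Ev_lacZ (s : Z -> nat) (c : Z -> R) (z : C) :
  (forall m, s (Z.of_nat m) < s (Z.of_nat (S m)))%nat ->
  (forall m, s (- Z.of_nat (S m))%Z < s (- Z.of_nat (S (S m)))%Z)%nat ->
  (forall k, Rabs (c k) <= 1) -> upper z ->
  Ev (lacZ s c) z = CSeriesZ (fun k => RtoC (c k) * qpow (INR (s k) / 2) z)%C.
Proof.
  intros H1 H2 Hc Hz. unfold lacZ, CSeriesZ.
  rewrite Ev_add by (try apply pg_lac_bounded; auto).
  f_equal.
  - apply (Ev_lac (fun m => s (Z.of_nat m)) (fun m => c (Z.of_nat m)));
      auto using pg_lac_bounded.
  - apply (Ev_lac (fun m => s (- Z.of_nat (S m))%Z) (fun m => c (- Z.of_nat (S m))%Z));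
      auto using pg_lac_bounded.
Qed.

Lemma CSeriesZ_ext (a b : Z -> C) : (forall k, a k = b k) -> CSeriesZ a = CSeriesZ b.
Proof.
  intro H. unfold CSeriesZ, CSeries. do 2 f_equal; apply Series_ext; intro; now rewrite H.
Qed.

Lemma Sg_phi_lacZ : Sg phi = lacZ sq sgn.
Proof.
  apply (gs_unique _ _ _ _ gs_Sg_phi). apply gs_lacZ; auto using le_sq_pos, le_sq_neg.
Qed.

Lemma Ev_Sg_phi (z : C) : upper z -> Ev (Sg phi) z = Theta4 z.
Proof.
  intro Hz. rewrite Sg_phi_lacZ, Ev_lacZ; auto.
  - apply CSeriesZ_ext. intro k. rewrite INR_sq. unfold sgn.
    replace (IZR k * IZR k / 2) with (IZR k ^ 2 / 2) by field.
    now destruct (Z.even k).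
  - intro m. pose proof (sq_Z (Z.of_nat m)); pose proof (sq_Z (Z.of_nat (S m))). nia.
  - intro m. pose proof (sq_Z (- Z.of_nat (S m))); pose proof (sq_Z (- Z.of_nat (S (S m)))).
    nia.
  - intro k. unfold sgn. destruct (Z.even k); unfold Rabs; destruct Rcase_abs; lra.
Qed.

Lemma V_psi_lacZ : V psi = lacZ (fun k => 2 * tri k)%nat (fun _ => 1).
Proof.
  apply (gs_unique _ _ _ _ (gs_V _ _ _ gs_psi)).
  apply gs_lacZ; intro m; [pose proof (le_tri_pos m)|pose proof (le_tri_neg m)]; lia.
Qed.

Lemma CSeries_scal_l (k : C) (a : nat -> C) :
  ex_series (fun n => Re (a n)) -> ex_series (fun n => Im (a n)) ->
  CSeries (fun n => k * a n)%C = (k * CSeries a)%C.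
Proof.
  intros H1 H2. destruct k as [p q]. unfold CSeries, Cmult. simpl. f_equal.
  - rewrite <- !Series_scal_l, <- Series_minus; [reflexivity| |];
      now apply (ex_series_scal_l (K := R_AbsRing) (V := R_NormedModule)).
  - rewrite <- !Series_scal_l, <- Series_plus; [reflexivity| |];
      now apply (ex_series_scal_l (K := R_AbsRing) (V := R_NormedModule)).
Qed.

Lemma Ev_V_psi (z : C) : upper z -> Theta2 z = (qpow (1 / 8) z * Ev (V psi) z)%C.
Proof.
  intro Hz. unfold Theta2.
  (* Uses (k + 1/2)^2 / 2 = 1/8 + k (k + 1) / 2. *)
  assert (E : forall k : Z, qpow ((IZR k + 1 / 2) ^ 2 / 2) z
    = (qpow (1 / 8) z * (RtoC 1 * qpow (INR (2 * tri k) / 2) z))%C).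
  { intro k. rewrite Cmult_1_l, <- qpow_add. f_equal.
    rewrite INR_IZR_INZ, Nat2Z.inj_mul. change (Z.of_nat 2) with 2%Z.
    rewrite tri_Z, mult_IZR, plus_IZR. field. }
  rewrite V_psi_lacZ. unfold lacZ, CSeriesZ.
  assert (I1 : forall m, (2 * tri (Z.of_nat m) < 2 * tri (Z.of_nat (S m)))%nat).
  { intro m. pose proof (tri_Z (Z.of_nat m)); pose proof (tri_Z (Z.of_nat (S m))). nia. }
  assert (I2 : forall m, (2 * tri (- Z.of_nat (S m))
                          < 2 * tri (- Z.of_nat (S (S m))))%nat).
  { intro m. pose proof (tri_Z (- Z.of_nat (S m)));
      pose proof (tri_Z (- Z.of_nat (S (S m)))). nia. }
  assert (B : forall m : nat, Rabs ((fun _ => 1) m) <= 1) by (intro; rewrite Rabs_R1; lra).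
  rewrite Ev_add by (try apply pg_lac_bounded; auto).
  destruct (Ev_lac (fun m => 2 * tri (Z.of_nat m))%nat (fun _ => 1) z I1
    (pg_lac_bounded _ _ B) Hz) as [-> [C1 S1]].
  destruct (Ev_lac (fun m => 2 * tri (- Z.of_nat (S m)))%nat (fun _ => 1) z I2
    (pg_lac_bounded _ _ B) Hz) as [-> [C2 S2]].
  rewrite Cmult_plus_distr_l, <- !CSeries_scal_l.
  - unfold CSeries. do 2 f_equal; apply Series_ext; intro m; now rewrite E.
  - revert C2. apply ex_series_ext. intro m. rewrite qpow_half. simpl. ring.
  - revert S2. apply ex_series_ext. intro m. rewrite qpow_half. simpl. ring.
  - revert C1. apply ex_series_ext. intro m. rewrite qpow_half. simpl. ring.
  - revert S1. apply ex_series_ext. intro m. rewrite qpow_half. simpl. ring.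
Qed.

Lemma pg_h2 : pg h2.
Proof. unfold h2; auto with pg. Qed.

Lemma pg_h4 : pg h4.
Proof. unfold h4; auto with pg. Qed.

Lemma H2_Ev (z : C) : upper z -> H2 z = Ev h2 z.
Proof.
  intro Hz. unfold H2, h2. rewrite Ev_V_psi by assumption.
  rewrite Ev_mul, Ev_pow, Ev_X; auto with pg.
  replace (1 / 2) with (1 / 8 + 1 / 8 + (1 / 8 + 1 / 8)) by field.
  rewrite !qpow_add. ring.
Qed.

Lemma H4_Ev (z : C) : upper z -> H4 z = Ev h4 z.
Proof.
  intro Hz. unfold H4, h4. rewrite Ev_pow, Ev_Sg_phi; auto with pg.
Qed.

Lemma gs_id (a : ps) : gs (fun m => m) a a.
Proof.
  intro n. exists (n :: nil). split; [|split].
  - constructor; [easy|constructor].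
  - intro x; simpl. intuition.
  - simpl; ring.
Qed.

Lemma V_Sig_lac (k : nat) :
  V (Sig k) = lac (fun m => 2 * S m)%nat (fun m => INR (Defs.sigma k (S m))).
Proof.
  pose proof (gs_embed S Nat.pred (fun m => 2 * m)%nat (Sig k) (V (Sig k)) Nat.eq_dec ltac:(reflexivity)
    ltac:(intros [|x]; [now left|now right])
    (gs_V _ _ _ (gs_id (Sig k)))) as H.
  apply (gs_unique _ _ _ _ H).
  apply (gs_lac (fun m => 2 * S m)%nat). intro; lia.
Qed.

Lemma sigma_series_Ev (k : nat) (z : C) : upper z -> sigma_series k z = Ev (V (Sig k)) z.
Proof.
  intro Hz. pose proof (pg_V _ (pg_Sig k)) as H. rewrite V_Sig_lac in *.
  destruct (Ev_lac (fun m => 2 * S m)%nat _ z ltac:(intro; cbv beta; lia) H Hz) as [-> _].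
  unfold sigma_series, CSeries. f_equal; apply Series_ext; intro n;
    replace (INR (2 * S n) / 2) with (INR (S n)) by (rewrite mult_INR; simpl (INR 2); field);
    reflexivity.
Qed.

Lemma pg_e2 : pg e2.
Proof. unfold e2; auto with pg. Qed.

Lemma pg_e4 : pg e4.
Proof. unfold e4; auto with pg. Qed.

Lemma pg_e6 : pg e6.
Proof. unfold e6; auto with pg. Qed.

#[export] Hint Resolve pg_h2 pg_h4 pg_e2 pg_e4 pg_e6 : pg.

Lemma Ev_kq_Z (n : Z) (z : C) : upper z -> Ev (kq (inject_Z n)) z = RtoC (IZR n).
Proof. intro Hz. unfold kq. now rewrite Ev_K, Q2R_Z. Qed.

Lemma E2_Ev (z : C) : upper z -> E2 z = Ev e2 z.
Proof.
  intro Hz. unfold E2, e2. rewrite Ev_sub, Ev_mul, Ev_K by auto with pg.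
  change (24%Q) with (inject_Z 24). now rewrite Ev_kq_Z, <- sigma_series_Ev.
Qed.

Lemma E4_Ev (z : C) : upper z -> E4 z = Ev e4 z.
Proof.
  intro Hz. unfold E4, e4. rewrite Ev_add, Ev_mul, Ev_K by auto with pg.
  change (240%Q) with (inject_Z 240). now rewrite Ev_kq_Z, <- sigma_series_Ev.
Qed.

Lemma E6_Ev (z : C) : upper z -> E6 z = Ev e6 z.
Proof.
  intro Hz. unfold E6, e6. rewrite Ev_sub, Ev_mul, Ev_K by auto with pg.
  change (504%Q) with (inject_Z 504). now rewrite Ev_kq_Z, <- sigma_series_Ev.
Qed.

Definition ell : ps :=
  lac (fun k => 2 * k + 1)%nat
      (fun k => -16 * (INR (Defs.sigma 1 (2 * k + 1)) / INR (2 * k + 1))).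

Lemma gs_ell : gs (fun k => 2 * k + 1)%nat
  (fun k => -16 * (INR (Defs.sigma 1 (2 * k + 1)) / INR (2 * k + 1))) ell.
Proof. apply (gs_lac (fun k => 2 * k + 1)%nat). intro; lia. Qed.

(** Differentiating cancels the denominators 2 k + 1, and the coefficients left are those of
    theta_2^4 found in [h2_coef_odd]. *)
Lemma th_ell : th ell = (- h2)%ps.
Proof.
  apply (gs_unique _ _ _ _ (gs_th _ _ _ gs_ell)).
  pose proof (gs_embed (fun k => 2 * k + 1)%nat (fun n => Nat.div2 (n - 1))
    (fun n => n) h2 h2 Nat.eq_dec
    ltac:(intro y; cbv beta; rewrite Nat.add_sub; apply Nat.div2_double)
    ltac:(intro x; destruct (even_odd_dec x) as [[m ->]|[m ->]];
      [left; apply h2_coef_even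
      |right; cbv beta; rewrite Nat.sub_succ, Nat.sub_0_r, Nat.div2_double; lia])
    (gs_id h2)) as H.
  generalize (gs_scal _ (-1) _ _ H).
  replace (K (-1) * h2)%ps with (- h2)%ps
    by (change (-1) with (- (1)); rewrite K_opp; ring).
  apply gs_ext; [easy|]. intro k.
  replace (2 * k + 1)%nat with (S (2 * k)) at 1 by lia. rewrite h2_coef_odd.
  field. apply not_0_INR. lia.
Qed.

Lemma pg_ell : pg ell.
Proof.
  apply pg_lac. exists 32, 1%nat. split; [lra|]. intro k. cbn [coef].
  pose proof (sigma_le 1 (2 * k + 1)) as H. apply le_INR in H.
  rewrite Nat.pow_1_r, mult_INR in H.
  assert (P : 0 < INR (2 * k + 1)) by (apply lt_0_INR; lia).
  rewrite pow_1, Rabs_mult, Rabs_left, Rabs_pos_eq by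
    (lra || (apply Rdiv_le_0_compat; [apply pos_INR|exact P])).
  assert (INR (Defs.sigma 1 (2 * k + 1)) / INR (2 * k + 1) <= INR (2 * k + 1)).
  { apply (Rmult_le_reg_r (INR (2 * k + 1))); [exact P|].
    unfold Rdiv. rewrite Rmult_assoc, Rinv_l; lra. }
  assert (INR (2 * k + 1) <= 2 * INR (S k)).
  { replace (2 * INR (S k)) with (INR (2 * S k))
      by (rewrite mult_INR; simpl (INR 2); ring).
    apply le_INR. lia. }
  lra.
Qed.

#[export] Hint Resolve pg_ell : pg.

Lemma fst_sum_n (a : nat -> C) (n : nat) :
  fst (sum_n (G := C_AbelianMonoid) a n) = sum_n (fun k => fst (a k)) n /\
  snd (sum_n (G := C_AbelianMonoid) a n) = sum_n (fun k => snd (a k)) n.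
Proof.
  induction n as [|n [IH1 IH2]]; [now rewrite !sum_O|].
  rewrite !sum_Sn, <- IH1, <- IH2. split; reflexivity.
Qed.

Lemma is_series_C (a : nat -> C) (l : C) :
  is_series (K := C_AbsRing) (V := C_NormedModule) a l -> l = CSeries a.
Proof.
  intro H. unfold is_series in H. rewrite (surjective_pairing l) in *.
  unfold CSeries, Re, Im. f_equal; symmetry; apply is_series_unique; unfold is_series.
  - eapply filterlim_ext; [intro n; apply fst_sum_n|].
    apply (filterlim_comp _ _ _ _ (fun p : C => fst p) _ _ _ H).
    apply (continuous_fst (fst l) (snd l)).
  - eapply filterlim_ext; [intro n; apply fst_sum_n|].
    apply (filterlim_comp _ _ _ _ (fun p : C => snd p) _ _ _ H).
    apply (continuous_snd (fst l) (snd l)).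
Qed.

Lemma LS_Ev (L : C -> C) (z : C) : is_LS L -> upper z -> L z = Ev ell z.
Proof.
  intros HL Hz. destruct (HL z Hz) as [_ [_ H]]. apply is_series_C in H. rewrite H.
  destruct (Ev_lac (fun k => 2 * k + 1)%nat _ z ltac:(intro; cbv beta; lia) pg_ell Hz) as [E _].
  refine (eq_trans _ (eq_sym E)).
  unfold CSeries. f_equal; apply Series_ext; intro k;
    replace (INR (2 * k + 1) / 2) with (INR k + 1 / 2)
      by (rewrite plus_INR, mult_INR; simpl (INR 2); simpl (INR 1); field);
    rewrite RtoC_mult, RtoC_div, Cmult_assoc by (apply not_0_INR; lia);
    reflexivity.
Qed.

(** * Serre derivatives *)

Local Open Scope ps_scope.

(* The Serre derivative of weight [k] on expansions in the nome; D = theta / 2. *)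
Definition ds (k : nat) (a : ps) : ps := Q[1/2] * th a - kq (Z.of_nat k # 12) * e2 * a.

Lemma pg_ds (k : nat) (a : ps) : pg a -> pg (ds k a).
Proof. unfold ds; auto with pg. Qed.

#[export] Hint Resolve pg_ds : pg.

Lemma kq_add (p q : Q) : kq (p + q) = kq p + kq q.
Proof. unfold kq. now rewrite Q2R_plus, K_add. Qed.

Lemma kq_weight_add (k l : nat) :
  kq (Z.of_nat (k + l) # 12) = kq (Z.of_nat k # 12) + kq (Z.of_nat l # 12).
Proof.
  rewrite <- kq_add. unfold kq. f_equal. apply Qeq_eqR.
  rewrite Nat2Z.inj_add. unfold Qeq, Qplus. simpl. ring.
Qed.

Lemma ds_mul (k l : nat) (a b : ps) : ds (k + l) (a * b) = ds k a * b + a * ds l b.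
Proof. unfold ds. rewrite kq_weight_add, th_mul. ring. Qed.

Lemma ds_add (k : nat) (a b : ps) : ds k (a + b) = ds k a + ds k b.
Proof. unfold ds. rewrite th_add. ring. Qed.

Lemma ds_sub (k : nat) (a b : ps) : ds k (a - b) = ds k a - ds k b.
Proof. unfold ds. rewrite th_sub. ring. Qed.

Lemma ds_K (k : nat) (r : R) (a : ps) : ds k (K r * a) = K r * ds k a.
Proof. unfold ds. rewrite th_mul, th_K. ring. Qed.

Lemma ds_kq (k : nat) (q : Q) (a : ps) : ds k (kq q * a) = kq q * ds k a.
Proof. apply ds_K. Qed.

Definition delta : ps := Q[1/1728] * (e4 ^ 3 - e6 ^ 2).

Lemma delta_h : delta = Q[1/256] * (h2 * h4 * (h2 + h4)) ^ 2.
Proof. unfold delta. rewrite e4_e4h, e6_e6h. unfold e4h, e6h. ring. Qed.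

Ltac ds_ring := unfold ds, ppow;
  repeat (rewrite ?th_add, ?th_sub, ?th_opp, ?th_mul, ?th_kq, ?th_K,
    ?th_h2, ?th_h4, ?th_ell); ring.

Lemma ds_e4 : ds 4 e4 = - (Q[1/3] * e6).
Proof. rewrite e4_e4h, e6_e6h. unfold e4h, e6h. ds_ring. Qed.

Lemma ds_e6 : ds 6 e6 = - (Q[1/2] * e4 * e4).
Proof. rewrite e4_e4h, e6_e6h. unfold e4h, e6h. ds_ring. Qed.

Lemma ds_delta : ds 12 delta = K 0.
Proof. rewrite delta_h. ds_ring. Qed.

Definition p12 : ps := h2 ^ 3 * (h2 ^ 3 + Q[3] * h2 ^ 2 * h4 + Q[3] * h2 * h4 ^ 2 + Q[2] * h4 ^ 3).
Definition p14 : ps := h2 ^ 5 * (Q[2] * h2 ^ 2 + Q[7] * h2 * h4 + Q[7] * h4 ^ 2).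
Definition p16 : ps := h2 ^ 3 * (Q[5] * h2 ^ 5 + Q[20] * h2 ^ 4 * h4 + Q[42] * h2 ^ 3 * h4 ^ 2
  + Q[68] * h2 ^ 2 * h4 ^ 3 + Q[60] * h2 * h4 ^ 4 + Q[24] * h4 ^ 5).
Definition p18 : ps := h2 ^ 3 * (Q[10] * h2 ^ 6 + Q[45] * h2 ^ 5 * h4 + Q[68] * h2 ^ 4 * h4 ^ 2
  + Q[34] * h2 ^ 3 * h4 ^ 3 - Q[13] * h2 ^ 2 * h4 ^ 4 - Q[36] * h2 * h4 ^ 5 - Q[12] * h4 ^ 6).

Definition g8 : ps := Q[1/(2^13)] * (h2 ^ 3 * (h2 + Q[2] * h4)).
Definition g10 : ps :=
  Q[1/(2^12*5)] * (h2 ^ 3 * (Q[2] * h2 ^ 2 + Q[5] * h2 * h4 + Q[5] * h4 ^ 2)).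
Definition g12 : ps := Q[3/(2^11*7)] * (delta * ell) + Q[3/(2^20*7)] * p12.
Definition g14 : ps := Q[1/(2^20*7)] * p14.
Definition g16 : ps := Q[5/(2^18*11)] * (e4 * delta * ell) + Q[5/(2^29*3*11)] * p16.
Definition g18 : ps := Q[5/(2^27*3*11*13)] * p18 - Q[5/(2^17*11*13)] * (e6 * delta * ell).

(** * The modular differential equation *)

Local Open Scope ps_scope.

Lemma ds_e4_delta_ell :
  ds 16 (e4 * delta * ell) = - (Q[1/3] * (e6 * delta * ell)) - Q[1/2] * e4 * delta * h2.
Proof.
  (* The logarithm has weight 0 and the discriminant is annihilated in weight 12. *)
  change 16%nat with (4 + 12 + 0)%nat. rewrite !ds_mul, ds_e4, ds_delta.
  replace (ds 0 ell) with (- (Q[1/2] * h2)) by ds_ring. ring.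
Qed.

Lemma ds_p16 : ds 16 p16 = h2 ^ 3 * (Q[20/3] * h2 ^ 6 + Q[30] * h2 ^ 5 * h4
  + Q[172/3] * h2 ^ 4 * h4 ^ 2 + Q[176/3] * h2 ^ 3 * h4 ^ 3 + Q[118/3] * h2 ^ 2 * h4 ^ 4
  + Q[12] * h2 * h4 ^ 5 + Q[4] * h4 ^ 6).
Proof. unfold p16. ds_ring. Qed.

(** The case w = 12 of d_w G_w = (w-3)/6 G_(w+2). The logarithm disappears because [ds 12 delta] is
    0. *)
Lemma ds_g12 : ds 12 g12 = Q[3/2] * g14.
Proof. unfold g12, g14, p12, p14. rewrite delta_h. ds_ring. Qed.


Lemma ode_12 : ds 16 (ds 14 (ds 12 g12)) = Q[14/9] * e4 * ds 12 g12.
Proof.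
  rewrite ds_g12, e4_e4h. unfold g14, p14, e4h. rewrite !ds_kq. ds_ring.
Qed.

Lemma ds_g16 : ds 16 g16 = Q[13/6] * g18.
Proof.
  unfold g16, g18. rewrite ds_add, !ds_kq, ds_e4_delta_ell, ds_p16.
  generalize (e6 * delta * ell); intro t.
  rewrite delta_h, e4_e4h. unfold e4h, p18. ring.
Qed.

(** The logarithmic parts are proportional, so the identity is checked with [delta * ell] as an
    indeterminate. It starts the induction in [gpair_pos]. *)
Lemma g14_g12 : e4 * g14 - e6 * g12 = Q[27456/35] * g18.
Proof.
  unfold g12, g14, g18, p12, p14, p18.
  replace (e6 * delta * ell) with (e6 * (delta * ell)) by ring.
  generalize (delta * ell); intro t.
  rewrite e4_e4h, e6_e6h. unfold e4h, e6h. ring.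
Qed.

Definition kn (w : nat) : ps := kq (inject_Z (Z.of_nat w)).

Lemma kn_add (m n : nat) : kn (m + n) = kn m + kn n.
Proof. unfold kn. rewrite Nat2Z.inj_add, inject_Z_plus. apply kq_add. Qed.

(* The third-order modular differential equation satisfied by [G_w] for
   [w = 0 mod 4]; its exponents at infinity are 0, 1 and (w - 2) / 4. *)
Definition ode (w : nat) (f : ps) : Prop :=
  ds (w + 4) (ds (w + 2) (ds w f))
  = Q[1/144] * (Q[3] * kn w * kn w - Q[24] * kn w + Q[80]) * e4 * ds w f
    + Q[1/864] * kn w * (kn w - Q[12]) * (kn w - Q[3]) * e6 * f.

(** The bracket of [step4]. *)
Definition raise (w : nat) (f : ps) : ps :=
  Q[1/36] * (kn w - Q[4]) * (kn w - Q[3]) * e4 * f - ds (w + 2) (ds w f).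

Lemma ds_kn (k w : nat) (a : ps) : ds k (kn w * a) = kn w * ds k a.
Proof. apply ds_kq. Qed.

Lemma ds_raise (w : nat) (f : ps) : ode w f ->
  ds (w + 4) (raise w f) = Q[1/144] * (kn w - Q[8]) * (kn w + Q[4])
    * (e4 * ds w f - Q[1/6] * (kn w - Q[3]) * e6 * f).
Proof.
  intro H. unfold raise. rewrite ds_sub, H.
  replace (Q[1 / 36] * (kn w - Q[4]) * (kn w - Q[3]) * e4 * f)
    with (Q[1/36] * (kn w * (kn w * (f * e4))) - Q[7/36] * (kn w * (f * e4))
          + Q[1/3] * (f * e4)) by ring.
  rewrite ds_add, ds_sub, !ds_kq, !ds_kn, ds_mul, ds_e4. ring.
Qed.

Lemma ds_comb (k : nat) (a b f g : ps) : th a = K 0 -> th b = K 0 ->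
  ds k (a * f + b * g) = a * ds k f + b * ds k g.
Proof. intros Ha Hb. unfold ds. rewrite th_add, !th_mul, Ha, Hb. ring. Qed.

(** By [ds_raise] the first derivative of [raise w f] already has order 1 in f. Two more
    derivatives, with the equation for f replacing its third derivative, leave an identity in f, its
    first two derivatives, E_4, E_6 and w. *)
Lemma ode_raise (w : nat) (f : ps) : ode w f -> ode (w + 4) (raise w f).
Proof.
  intro H. unfold ode. rewrite ds_raise by exact H.
  set (u := Q[1/144] * (kn w - Q[8]) * (kn w + Q[4])).
  set (v := Q[1/6] * (kn w - Q[3])).
  assert (Hk : th (kn w) = K 0) by apply th_kq.
  assert (Hu : th u = K 0) by (unfold u; push_th; rewrite ?Hk; ring).
  assert (Huv : th (- (u * v)) = K 0)
    by (unfold v; push_th; rewrite ?Hu, ?Hk; ring).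
  replace (u * (e4 * ds w f - v * e6 * f))
    with (u * (ds w f * e4) + - (u * v) * (f * e6)) by ring.
  replace (w + 4 + 2)%nat with (w + 2 + 4)%nat by lia.
  rewrite ds_comb, ds_mul by assumption.
  replace (w + 2 + 4)%nat with (w + 6)%nat by lia. rewrite ds_mul, ds_e4, ds_e6.
  replace (u * (ds (w + 2) (ds w f) * e4 + ds w f * - (Q[1 / 3] * e6))
      + - (u * v) * (ds w f * e6 + f * - (Q[1 / 2] * e4 * e4)))
    with (u * (ds (w + 2) (ds w f) * e4)
          + (K 1) * ((- (Q[1/3] * u) - u * v) * (ds w f * e6)
          + Q[1/2] * u * v * (f * (e4 * e4)))) by ring.
  assert (Hu2 : th (Q[1/2] * u * v) = K 0)
    by (unfold v; push_th; rewrite ?Hu, ?Hk; ring).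
  assert (Hu3 : th (- (Q[1/3] * u) - u * v) = K 0)
    by (unfold v; push_th; rewrite ?Hu, ?Hk; ring).
  rewrite ds_comb, ds_comb by (assumption || apply th_K).
  replace (ds (w + 4 + 4) (ds (w + 2) (ds w f) * e4))
    with (ds (w + 4) (ds (w + 2) (ds w f)) * e4 + ds (w + 2) (ds w f) * ds 4 e4)
    by (rewrite <- ds_mul; reflexivity).
  replace (ds (w + 4 + 4) (ds w f * e6))
    with (ds (w + 2) (ds w f) * e6 + ds w f * ds 6 e6)
    by (rewrite <- ds_mul; f_equal; lia).
  replace (ds (w + 4 + 4) (f * (e4 * e4)))
    with (ds w f * (e4 * e4) + f * (ds 4 e4 * e4 + e4 * ds 4 e4))
    by (rewrite <- ds_mul; change (4 + 4)%nat with 8%nat; rewrite <- ds_mul; f_equal; lia).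
  rewrite H, ds_e4, ds_e6. unfold raise, u, v.
  rewrite kn_add. change (kn 4) with Q[4].
  change (kn 4) with Q[4].
  generalize (ds (w + 2) (ds w f)) (ds w f) (kn w). intros f2 f1 x. ring.
Qed.

Lemma ode_K (w : nat) (r : R) (f : ps) : ode w f -> ode w (K r * f).
Proof. unfold ode. intro H. rewrite !ds_K, H. ring. Qed.

Lemma ode_g12 : ode 12 g12.
Proof.
  unfold ode. change (12 + 4)%nat with 16%nat. change (12 + 2)%nat with 14%nat.
  rewrite ode_12. change (kn 12) with Q[12]. ring.
Qed.

(** The constant is [c4 12]: the recurrence of [step4] also holds at w = 12, so the differential
    equation passes from [g12] to [g16]. *)
Lemma raise_g12 : g16 = Q[35/8448] * raise 12 g12.
Proof.
  unfold raise. change (12 + 2)%nat with 14%nat. rewrite ds_g12, ds_kq.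
  unfold g14. rewrite ds_kq. unfold p14.
  unfold g12, g16, p12, p16.
  replace (e4 * delta * ell) with (e4 * (delta * ell)) by ring.
  generalize (delta * ell); intro t. change (kn 12) with Q[12].
  rewrite e4_e4h. unfold e4h. ds_ring.
Qed.

Lemma ode_g16 : ode 16 g16.
Proof. rewrite raise_g12. apply (ode_K 16), (ode_raise 12), ode_g12. Qed.

(** * The recurrences on power series *)

Definition c4 (x : R) : R :=
  3 * (x - 2) * (x + 2) / (16 * (x - 8) * (x - 3) * (x - 1) * (x + 4)).
Definition c2 (x : R) : R :=
  3 * (x - 6) * (x - 2) / (16 * (x - 16) * (x - 5) * (x - 4) * (x - 3)).

(* [gpair j] is the pair [(G_w, G_(w+2))] with [w = 16 + 4 j]. *)
Fixpoint gpair (j : nat) : ps * ps :=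
  match j with
  | O => (g16, g18)
  | S j =>
      let w := (16 + 4 * j)%nat in
      let (f, g) := gpair j in
      (K (c4 (INR w)) * raise w f,
       K (c2 (INR w + 4))
         * (Q[1/36] * (kn w - Q[5]) * (kn w - Q[4]) * e4 * g
            - ds (w + 4) (ds (w + 2) g)))
  end.

Lemma kn_K (w : nat) : kn w = K (INR w).
Proof. unfold kn, kq. now rewrite Q2R_Z, INR_IZR_INZ. Qed.

Lemma INR_16_le (j : nat) : (16 <= INR (16 + 4 * j))%R.
Proof. replace 16%R with (INR 16) by (simpl; ring). apply le_INR. lia. Qed.

(** The bracket of [step2] for g = G_(w+2). Since g is a multiple of [ds w f], the third-order
    equation for f expresses the second derivative of g through g and f, which removes all
    derivatives. *)
Lemma raise_next (w : nat) (f g : ps) : (16 <= INR w)%R -> ode w f ->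
  ds w f = Q[1/6] * (kn w - Q[3]) * g ->
  Q[1/36] * (kn w - Q[5]) * (kn w - Q[4]) * e4 * g - ds (w + 4) (ds (w + 2) g)
  = Q[1/144] * kn w * (kn w - Q[12]) * (e4 * g - e6 * f).
Proof.
  intros Hw Ho H1. unfold ode in Ho. rewrite H1 in Ho.
  set (c := Q[1/6] * (kn w - Q[3])) in *.
  assert (Hk : th (kn w) = K 0) by apply th_kq.
  assert (Hc : forall k a, ds k (c * a) = c * ds k a).
  { intros k a. unfold c, ds. push_th. rewrite Hk. ring. }
  rewrite !Hc in Ho.
  apply (pmul_cancel c).
  { unfold c. rewrite kn_K. coef0. unfold Q2R; simpl. apply Rgt_not_eq; lra. }
  transitivity (Q[1/36] * (kn w - Q[5]) * (kn w - Q[4]) * e4 * (c * g)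
                - c * ds (w + 4) (ds (w + 2) g)); [ring|].
  rewrite Ho. unfold c. ring.
Qed.

Lemma gpair_ode (j : nat) : let w := (16 + 4 * j)%nat in
  ode w (fst (gpair j)) /\
  ds w (fst (gpair j)) = Q[1/6] * (kn w - Q[3]) * snd (gpair j).
Proof.
  induction j as [|j IH].
  - split; [exact ode_g16|]. change (ds 16 g16 = Q[1/6] * (Q[16] - Q[3]) * g18).
    rewrite ds_g16. ring.
  - cbv zeta in *. cbn [gpair]. destruct (gpair j) as [f g]. cbn [fst snd] in *.
    pose proof (INR_16_le j) as Hw. destruct IH as [Ho H1].
    replace (16 + 4 * S j)%nat with (16 + 4 * j + 4)%nat by lia.
    generalize dependent (16 + 4 * j)%nat. intros w Ho H1 Hw.
    split; [now apply ode_K, ode_raise|].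
    rewrite ds_K, ds_raise, (raise_next w f g), H1 by assumption.
    transitivity (K (c4 (INR w)) * (Q[1/144] * (kn w - Q[8]) * (kn w + Q[4])
      * (Q[1/6] * (kn w - Q[3]))) * (e4 * g - e6 * f)); [ring|].
    transitivity (Q[1/6] * (kn (w + 4) - Q[3]) * K (c2 (INR w + 4))
      * (Q[1/144] * kn w * (kn w - Q[12])) * (e4 * g - e6 * f)); [|ring].
    (* The normalisations of both recurrences are such that these constants agree; their
       denominators have no zero at w >= 16. *)
    f_equal. rewrite kn_add, !kn_K. unfold kq.
    repeat (rewrite <- ?K_add, <- ?K_sub, <- ?K_mul).
    f_equal. unfold c4, c2, Q2R; simpl. field. repeat split; lra.
Qed.

Lemma gpair_next (j : nat) : let w := (16 + 4 * j)%nat in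
  snd (gpair (S j)) = K (c2 (INR w + 4) * (INR w * (INR w - 12) / 144))
    * (e4 * snd (gpair j) - e6 * fst (gpair j)).
Proof.
  cbv zeta. destruct (gpair_ode j) as [Ho H1]. cbv zeta in *.
  cbn [gpair]. destruct (gpair j) as [f g]. cbn [fst snd] in *.
  rewrite (raise_next _ f g) by (auto using INR_16_le).
  rewrite kn_K. rewrite K_mul.
  replace (K (INR (16 + 4 * j) * (INR (16 + 4 * j) - 12) / 144))
    with (Q[1/144] * K (INR (16 + 4 * j)) * (K (INR (16 + 4 * j)) - Q[12])); [ring|].
  unfold kq. rewrite <- K_sub, <- !K_mul. f_equal. unfold Q2R; simpl; field.
Qed.

(** Order at least 3 in the nome, which rules out the exponents 0 and 1 in q, that is 0 and 2 in the
    nome. *)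
Definition ord3 (a : ps) : Prop := exists b, a = X ^ 3 * b.

Lemma coef_0_X (a : ps) : a 0%nat = 0%R -> exists b, a = X * b.
Proof.
  intro H. exists (Ps (fun n => a (S n))). apply ps_ext; intros [|n];
    rewrite X_mul_coef; [exact H|reflexivity].
Qed.

Lemma ord3_ds (k : nat) (a : ps) : ord3 a -> ord3 (ds k a).
Proof.
  intros [b ->]. exists (Q[3/2] * b + ds k b).
  unfold ds, ppow. push_th. rewrite th_X. ring.
Qed.

Lemma ord3_raise (w : nat) (a : ps) : ord3 a -> ord3 (raise w a).
Proof.
  intro H. destruct (ord3_ds (w + 2) _ (ord3_ds w _ H)) as [c Hc].
  destruct H as [b Hb]. unfold raise. rewrite Hc, Hb.
  exists (Q[1/36] * (kn w - Q[4]) * (kn w - Q[3]) * e4 * b - c). ring.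
Qed.

Lemma ord3_K (r : R) (a : ps) : ord3 a -> ord3 (K r * a).
Proof. intros [b ->]. exists (K r * b). ring. Qed.

(** [delta] contains [h2] squared and [ell] has no constant term, which gives order 3 together; the
    polynomial part contains the cube of [h2]. *)
Lemma ord3_g12 : ord3 g12.
Proof.
  destruct (coef_0_X ell) as [b Hb]; [unfold ell, lac; simpl; ring|].
  unfold g12, p12. rewrite delta_h, Hb.
  assert (H : h2 = X * V psi ^ 4) by reflexivity. generalize dependent h2. intros h H.
  rewrite H. set (v := V psi ^ 4).
  eexists (Q[3/(2^11*7)] * Q[1/256] * (v * h4 * (X * v + h4)) ^ 2 * b
    + Q[3/(2^20*7)] * v ^ 3 * ((X * v) ^ 3 + Q[3] * (X * v) ^ 2 * h4
        + Q[3] * (X * v) * h4 ^ 2 + Q[2] * h4 ^ 3)). ring.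
Qed.

Lemma ord3_gpair (j : nat) : ord3 (fst (gpair j)).
Proof.
  induction j as [|j IH]; cbn [gpair].
  - change (ord3 g16). rewrite raise_g12. apply ord3_K, ord3_raise, ord3_g12.
  - destruct (gpair j) as [f g]. cbn [fst] in *. now apply ord3_K, ord3_raise.
Qed.

Lemma pg_delta : pg delta.
Proof. unfold delta; auto 6 with pg. Qed.

#[export] Hint Resolve pg_delta : pg.

Lemma pg_kn (w : nat) : pg (kn w).
Proof. apply pg_kq. Qed.

#[export] Hint Resolve pg_kn : pg.

Lemma pg_g12 : pg g12.
Proof. unfold g12, p12; auto 20 with pg. Qed.

Lemma pg_g14 : pg g14.
Proof. unfold g14, p14; auto 20 with pg. Qed.

Lemma pg_g16 : pg g16.
Proof. unfold g16, p16; auto 20 with pg. Qed.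

Lemma pg_g18 : pg g18.
Proof. unfold g18, p18; auto 20 with pg. Qed.

#[export] Hint Resolve pg_g12 pg_g14 pg_g16 pg_g18 : pg.

Lemma pg_gpair (j : nat) : pg (fst (gpair j)) /\ pg (snd (gpair j)).
Proof.
  induction j as [|j IH]; cbn [gpair].
  - split; [apply pg_g16|apply pg_g18].
  - destruct (gpair j) as [f g]. cbn [fst snd] in *. destruct IH.
    unfold raise. split; auto 20 with pg.
Qed.

(** * The functions G_w as power series in the nome *)

Local Open Scope R_scope.

Lemma RtoC_kq (q : Q) (z : C) : upper z -> Ev (kq q) z = RtoC (Q2R q).
Proof. apply Ev_K. Qed.

Lemma serre_Ev (k : nat) (F : C -> C) (a : ps) (z : C) : pg a -> upper z ->
  (forall z', upper z' -> F z' = Ev a z') -> serre k F z = Ev (ds k a) z.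
Proof.
  intros Ha Hz H. unfold serre, ds.
  rewrite (D_Ev F a z Ha Hz H), Ev_sub, !Ev_mul, (E2_Ev z Hz), (H z Hz), !RtoC_kq
    by auto with pg.
  do 3 f_equal. rewrite <- RtoC_div by lra. f_equal.
  unfold Q2R; simpl. now rewrite INR_IZR_INZ.
Qed.

Lemma serre2_Ev (k : nat) (F : C -> C) (a : ps) (z : C) : pg a -> upper z ->
  (forall z', upper z' -> F z' = Ev a z') -> serre2 k F z = Ev (ds (k + 2) (ds k a)) z.
Proof.
  intros Ha Hz H. unfold serre2. apply serre_Ev; auto with pg.
  intros z' Hz'. now apply serre_Ev.
Qed.

Lemma Delta_Ev (z : C) : upper z -> Defs.Delta z = Ev delta z.
Proof.
  intro Hz. unfold Defs.Delta, delta.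
  rewrite Ev_mul, Ev_sub, !Ev_pow, RtoC_kq, (E4_Ev z Hz), (E6_Ev z Hz) by auto with pg.
  unfold Cdiv. replace (/ 1728)%C with (RtoC (Q2R (1/1728))); [ring|].
  unfold Q2R; simpl. rewrite <- RtoC_inv by lra. f_equal. field.
Qed.

Ltac Ev_push := repeat first
  [ rewrite Ev_add by auto 20 with pg | rewrite Ev_sub by auto 20 with pg
  | rewrite Ev_mul by auto 20 with pg | rewrite Ev_pow by auto 20 with pg
  | rewrite RtoC_kq by assumption ].

Ltac C_const := unfold Q2R; cbn -[Rmult Rinv Rplus pow Cpow IZR];
  repeat (rewrite <- ?RtoC_pow, <- ?RtoC_mult);
  rewrite <- ?RtoC_inv, <- ?RtoC_mult by (apply Rgt_not_eq; lra); f_equal; field.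

Ltac C_numerals := repeat match goal with
  | |- context [Q2R (Qmake ?n 1)] =>
      replace (Q2R (Qmake n 1)) with (IZR n) by (symmetry; apply Q2R_Z)
  end.

Lemma G8_Ev (z : C) : upper z -> G8 z = Ev g8 z.
Proof.
  intro Hz. unfold G8, g8. cbv zeta. rewrite (H2_Ev z Hz), (H4_Ev z Hz). Ev_push.
  replace (RtoC (Q2R (1 / 2 ^ 13))) with (/ 2 ^ 13)%C by C_const.
  C_numerals. unfold Cdiv. ring.
Qed.

Lemma G10_Ev (z : C) : upper z -> G10 z = Ev g10 z.
Proof.
  intro Hz. unfold G10, g10. cbv zeta. rewrite (H2_Ev z Hz), (H4_Ev z Hz). Ev_push.
  replace (RtoC (Q2R (1 / (2 ^ 12 * 5)))) with (/ (2 ^ 12 * 5))%C by C_const.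
  C_numerals. unfold Cdiv. ring.
Qed.

Lemma G14_Ev (z : C) : upper z -> G14 z = Ev g14 z.
Proof.
  intro Hz. unfold G14, g14, p14. cbv zeta. rewrite (H2_Ev z Hz), (H4_Ev z Hz). Ev_push.
  replace (RtoC (Q2R (1 / (2 ^ 20 * 7)))) with (/ (2 ^ 20 * 7))%C by C_const.
  C_numerals. unfold Cdiv. ring.
Qed.

Section Link.

Variable L : C -> C.
Hypothesis HL : is_LS L.

Lemma G12_Ev (z : C) : upper z -> G12 L z = Ev g12 z.
Proof.
  intro Hz. unfold G12, g12, p12. cbv zeta.
  rewrite (H2_Ev z Hz), (H4_Ev z Hz), (Delta_Ev z Hz), (LS_Ev L z HL Hz). Ev_push.
  replace (RtoC (Q2R (3 / (2 ^ 11 * 7)))) with (3 * / (2 ^ 11 * 7))%C by C_const.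
  replace (RtoC (Q2R (3 / (2 ^ 20 * 7)))) with (3 * / (2 ^ 20 * 7))%C by C_const.
  C_numerals. unfold Cdiv. ring.
Qed.

Lemma G16_Ev (z : C) : upper z -> G16 L z = Ev g16 z.
Proof.
  intro Hz. unfold G16, g16, p16. cbv zeta.
  rewrite (H2_Ev z Hz), (H4_Ev z Hz), (Delta_Ev z Hz), (E4_Ev z Hz), (LS_Ev L z HL Hz).
  Ev_push.
  replace (RtoC (Q2R (5 / (2 ^ 18 * 11)))) with (5 * / (2 ^ 18 * 11))%C by C_const.
  replace (RtoC (Q2R (5 / (2 ^ 29 * 3 * 11)))) with (5 * / (2 ^ 29 * 3 * 11))%C by C_const.
  C_numerals. unfold Cdiv. ring.
Qed.

Lemma G18_Ev (z : C) : upper z -> G18 L z = Ev g18 z.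
Proof.
  intro Hz. unfold G18, g18, p18. cbv zeta.
  rewrite (H2_Ev z Hz), (H4_Ev z Hz), (Delta_Ev z Hz), (E6_Ev z Hz), (LS_Ev L z HL Hz).
  Ev_push.
  replace (RtoC (Q2R (5 / (2 ^ 17 * 11 * 13)))) with (5 * / (2 ^ 17 * 11 * 13))%C by C_const.
  replace (RtoC (Q2R (5 / (2 ^ 27 * 3 * 11 * 13))))
    with (5 * / (2 ^ 27 * 3 * 11 * 13))%C by C_const.
  C_numerals. unfold Cdiv. ring.
Qed.

Lemma G_unfold (v : nat) : (15 <= v)%nat -> G L (4 + v) =
  if Nat.eqb (Nat.modulo v 4) 0 then step4 v (G L v)
  else if Nat.eqb (Nat.modulo v 4) 2 then step2 (v + 2) (G L v)
  else fun _ => RtoC 0.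
(* From 4 + 15 = 19 on, no explicit case of the [match] applies. *)
Proof. intro H. do 15 (destruct v as [|v]; [lia|]). reflexivity. Qed.

Lemma step4_Ev (w : nat) (F : C -> C) (f : ps) (z : C) : pg f -> upper z ->
  (forall z', upper z' -> F z' = Ev f z') ->
  step4 w F z = Ev (K (c4 (INR w)) * raise w f)%ps z.
Proof.
  intros Hf Hz H. unfold step4, raise. cbv zeta.
  rewrite (serre2_Ev w F f z Hf Hz H), (E4_Ev z Hz), (H z Hz).
  replace (Q[1/36] * (kn w - Q[4]) * (kn w - Q[3]) * e4 * f)%ps
    with (K ((INR w - 4) * (INR w - 3) / 36) * (e4 * f))%ps.
  - rewrite Ev_K_mul, Ev_sub, Ev_K_mul, Ev_mul by auto with pg.
    unfold c4. ring.
  - unfold Rdiv. rewrite kn_K, !K_mul, !K_sub. unfold kq, Q2R; simpl.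
    replace (1 * / 36) with (/ 36) by field.
    replace (4 * / 1) with 4 by field. replace (3 * / 1) with 3 by field. ring.
Qed.

Lemma step2_Ev (w : nat) (F : C -> C) (f : ps) (z : C) : pg f -> upper z ->
  (forall z', upper z' -> F z' = Ev f z') ->
  step2 (w + 4) F z = Ev (K (c2 (INR w + 4)) * (Q[1/36] * (kn w - Q[5]) * (kn w - Q[4])
    * e4 * f - ds (w + 4) (ds (w + 2) f)))%ps z.
Proof.
  intros Hf Hz H. unfold step2. cbv zeta.
  replace (w + 4 - 2)%nat with (w + 2)%nat by lia.
  rewrite (serre2_Ev (w + 2) F f z Hf Hz H), (E4_Ev z Hz), (H z Hz).
  replace (w + 2 + 2)%nat with (w + 4)%nat by lia.
  replace (INR (w + 4)) with (INR w + 4) by (rewrite plus_INR; simpl; ring).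
  replace (Q[1/36] * (kn w - Q[5]) * (kn w - Q[4]) * e4 * f)%ps
    with (K ((INR w + 4 - 9) * (INR w + 4 - 8) / 36) * (e4 * f))%ps.
  - rewrite Ev_K_mul, Ev_sub, Ev_K_mul, Ev_mul by auto with pg.
    unfold c2. ring.
  - replace (INR w + 4 - 9) with (INR w - 5) by ring.
    replace (INR w + 4 - 8) with (INR w - 4) by ring.
    unfold Rdiv. rewrite kn_K, !K_mul, !K_sub. unfold kq, Q2R; simpl.
    replace (1 * / 36) with (/ 36) by field.
    replace (5 * / 1) with 5 by field. replace (4 * / 1) with 4 by field. ring.
Qed.

Lemma G_gpair (j : nat) (z : C) : upper z ->
  G L (16 + 4 * j) z = Ev (fst (gpair j)) z /\
  G L (18 + 4 * j) z = Ev (snd (gpair j)) z.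
Proof.
  revert z. induction j as [|j IH]; intros z Hz.
  - split; [now apply G16_Ev|now apply G18_Ev].
  - destruct (pg_gpair j) as [Pf Pg].
    replace (16 + 4 * S j)%nat with (4 + (16 + 4 * j))%nat by lia.
    replace (18 + 4 * S j)%nat with (4 + (18 + 4 * j))%nat by lia.
    rewrite !G_unfold by lia.
    replace ((16 + 4 * j) mod 4)%nat with 0%nat
      by (rewrite Nat.mul_comm, Nat.Div0.mod_add; reflexivity).
    replace ((18 + 4 * j) mod 4)%nat with 2%nat
      by (rewrite Nat.mul_comm, Nat.Div0.mod_add; reflexivity).
    cbn [Nat.eqb].
    replace (18 + 4 * j + 2)%nat with (16 + 4 * j + 4)%nat by lia.
    cbn [gpair]. destruct (gpair j) as [f g]. cbn [fst snd] in *. split.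
    + apply step4_Ev; auto. intros z' Hz'. now apply IH.
    + apply step2_Ev; auto. intros z' Hz'. now apply IH.
Qed.

End Link.

Lemma Ev_axis (a : ps) (t : R) : Ev a (0, t) = RtoC (PSeries a (exp (- (PI * t)))).
Proof.
  rewrite Ev_eq. unfold RtoC, PSeries. f_equal.
  - apply Series_ext; intro n. unfold xc, nome; simpl Re; simpl Im.
    rewrite Rmult_0_r, cos_0. ring.
  - rewrite (Series_ext _ (fun n => 0 * 0)).
    + rewrite Series_scal_l. ring.
    + intro n. unfold xs, nome; simpl Re; simpl Im. rewrite Rmult_0_r, sin_0. ring.
Qed.

(** * Values on the imaginary axis *)

Local Open Scope R_scope.

Definition val (a : ps) (x : R) : R := PSeries a x.

Lemma pg_CV (a : ps) (x : R) : pg a -> 0 <= x < 1 -> Rbar_lt (Rabs x) (CV_radius a).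
Proof. intros Ha Hx. apply pg_CV_radius; [exact Ha|]. rewrite Rabs_pos_eq; lra. Qed.

Lemma val_add (a b : ps) (x : R) : pg a -> pg b -> 0 <= x < 1 ->
  val (a + b)%ps x = val a x + val b x.
Proof.
  intros. apply (PSeries_plus a b x); apply CV_radius_inside, pg_CV; assumption.
Qed.

Lemma val_mul (a b : ps) (x : R) : pg a -> pg b -> 0 <= x < 1 ->
  val (a * b)%ps x = val a x * val b x.
Proof. intros. apply (PSeries_mult a b x); apply pg_CV; assumption. Qed.

Lemma val_K (r x : R) : val (K r) x = r.
Proof.
  unfold val, PSeries. rewrite (Series_ext _ (fun n => if (n =? 0)%nat then r else 0)).
  - apply is_series_unique.
    apply (is_series_decr_1 (K := R_AbsRing) (V := R_NormedModule)).
    unfold plus, opp; simpl. replace (r + - r) with 0 by ring.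
    apply (is_series_ext (fun _ => 0 * 1)); [intro; simpl; ring|].
    apply filterlim_ext with (fun _ => 0); [|apply filterlim_const].
    intro n. rewrite sum_n_const. ring.
  - intros [|n]; simpl; ring.
Qed.

Lemma val_kq (q : Q) (x : R) : val (kq q) x = Q2R q.
Proof. apply val_K. Qed.

Lemma val_opp (a : ps) (x : R) : val (- a)%ps x = - val a x.
Proof. apply (PSeries_opp a x). Qed.

Lemma val_sub (a b : ps) (x : R) : pg a -> pg b -> 0 <= x < 1 ->
  val (a - b)%ps x = val a x - val b x.
Proof. intros. unfold psub. rewrite val_add, val_opp by auto with pg. ring. Qed.

Lemma val_pow (a : ps) (n : nat) (x : R) : pg a -> 0 <= x < 1 ->
  val (a ^ n)%ps x = val a x ^ n.
Proof.
  intros Ha Hx. induction n as [|n IH]; simpl; [apply val_K|].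
  rewrite val_mul, IH; auto with pg.
Qed.

Lemma val_0 (a : ps) : val a 0 = a 0%nat.
Proof. apply PSeries_0. Qed.

Lemma PSeries_shift (a : nat -> R) (b : ps) (x : R) : (b 0%nat = 0) ->
  (forall n, b (S n) = a n) -> val b x = x * PSeries a x.
Proof.
  intros H0 H. rewrite <- PSeries_incr_1. apply PSeries_ext.
  intros [|n]; simpl; auto.
Qed.

Lemma val_X (x : R) : val X x = x.
Proof.
  rewrite (PSeries_shift (K 1) X) by (intros; reflexivity || (now destruct n)).
  change (PSeries (K 1) x) with (val (K 1) x). rewrite val_K; ring.
Qed.

Lemma val_V (a : ps) (x : R) : pg a -> 0 <= x < 1 -> val (V a) x = val a (x ^ 2).
Proof.
  intros Ha Hx. unfold val, PSeries.
  assert (H : is_series (fun n => V a n * x ^ n) (Series (fun n => V a n * x ^ n))).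
  { apply Series_correct. pose proof (CV_radius_inside (V a) x (pg_CV _ _ (pg_V _ Ha) Hx)) as [l Hl].
    exists l. revert Hl. apply is_series_ext. intro n.
    rewrite pow_n_pow. unfold scal; simpl. apply Rmult_comm. }
  pose proof (gs_unique _ _ _ _ (gs_V _ _ _ (gs_id a))
    (gs_lac (fun m => 2 * m)%nat a ltac:(intro; cbv beta; lia))) as E.
  set (l := Series (fun n => V a n * x ^ n)) in *. clearbody l. rewrite E in H.
  apply (is_series_lac (fun m => 2 * m)%nat a) in H; [|intro; lia].
  symmetry. rewrite (Series_ext _ (fun m => a m * x ^ (2 * m))); [now apply is_series_unique|].
  intro n. now rewrite pow_mult.
Qed.

Lemma val_ge_coef_0 (a : ps) (x : R) : (forall n, 0 <= a n) -> pg a -> 0 <= x < 1 ->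
  a 0%nat <= val a x.
Proof.
  intros Hp Ha Hx. unfold val, PSeries.
  pose proof (CV_radius_inside a x (pg_CV _ _ Ha Hx)) as [l Hl].
  assert (E : ex_series (fun n => a n * x ^ n)).
  { exists l. revert Hl. apply is_series_ext. intro n.
    rewrite pow_n_pow. unfold scal; simpl. apply Rmult_comm. }
  rewrite Series_incr_1 by exact E. simpl (x ^ 0). rewrite Rmult_1_r.
  enough (0 <= Series (fun n => a (S n) * x ^ S n)) by lra.
  replace 0 with (Series (fun _ => 0 * 0)) by (rewrite Series_scal_l; ring).
  apply Series_le.
  - intro n. rewrite Rmult_0_l. split; [lra|]. apply Rmult_le_pos; [apply Hp|].
    apply pow_le; lra.
  - now apply (ex_series_incr_1 (K := R_AbsRing) (V := R_NormedModule) (fun n => a n * x ^ n)).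
Qed.

Lemma val_continuous (a : ps) (x : R) : pg a -> 0 <= x < 1 -> continuity_pt (val a) x.
Proof. intros. now apply PSeries_continuity, pg_CV. Qed.

Definition dval (a : ps) (x : R) : R := PSeries (PS_derive a) x.

Lemma val_derive (a : ps) (x : R) : pg a -> 0 <= x < 1 ->
  is_derive (val a) x (dval a x).
Proof. intros Ha Hx. now apply is_derive_PSeries, pg_CV. Qed.

Lemma dval_eq (a : ps) (x : R) : 0 < x -> dval a x = val (th a) x / x.
Proof.
  intro Hx. rewrite (PSeries_shift (PS_derive a) (th a)); [|simpl; ring|reflexivity].
  unfold dval. field; lra.
Qed.

Lemma mono_le (f df : R -> R) (a b : R) : a <= b ->
  (forall x, a <= x <= b -> is_derive f x (df x)) ->
  (forall x, a < x < b -> 0 <= df x) -> f a <= f b.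
Proof.
  intros Hab Hd Hp. destruct (Req_dec a b) as [->|Hne]; [lra|].
  destruct (MVT_cor2 f df a b) as [c [E Hc]]; [lra| |].
  - intros c Hc. now apply is_derive_Reals, Hd.
  - specialize (Hp c Hc). nra.
Qed.

Lemma coef_nonneg_gs {A : Type} (s : A -> nat) (c : A -> R) (a : ps) :
  (forall x, 0 <= c x) -> gs s c a -> forall n, 0 <= a n.
Proof.
  intros Hc Ha n. destruct (Ha n) as [l [_ [_ ->]]].
  induction l as [|x l IH]; simpl; [lra|]. specialize (Hc x). lra.
Qed.

Lemma coef_nonneg_mul (a b : ps) : (forall n, 0 <= a n) -> (forall n, 0 <= b n) ->
  forall n, 0 <= (a * b)%ps n.
Proof.
  intros Ha Hb n. simpl. apply cond_pos_sum. intro k. now apply Rmult_le_pos.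
Qed.

Lemma coef_nonneg_pow (a : ps) (m : nat) : (forall n, 0 <= a n) ->
  forall n, 0 <= (a ^ m)%ps n.
Proof.
  intro Ha. induction m as [|m IH]; simpl ppow.
  - intros [|n]; simpl; lra.
  - now apply coef_nonneg_mul.
Qed.

Lemma coef_nonneg_V_psi (n : nat) : 0 <= V psi n.
Proof. eapply coef_nonneg_gs; [|apply gs_V, gs_psi]. intro; simpl; lra. Qed.

Lemma coef_nonneg_h2 (n : nat) : 0 <= h2 n.
Proof.
  unfold h2. rewrite X_mul_coef. destruct n as [|n]; [lra|].
  apply coef_nonneg_pow, coef_nonneg_V_psi.
Qed.

Lemma val_h2_ge (x : R) : 0 <= x < 1 -> 16 * x <= val h2 x.
Proof.
  intro Hx. unfold h2. rewrite val_mul, val_pow, val_X by auto with pg.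
  pose proof (val_ge_coef_0 (V psi) x coef_nonneg_V_psi (pg_V _ pg_psi) Hx) as H.
  change (V psi 0%nat) with (psi 0%nat) in H. rewrite psi_0 in H.
  assert (2 ^ 4 <= val (V psi) x ^ 4) by (apply pow_incr; lra). nra.
Qed.

(** By theta_3(x) theta_4(x) = theta_4(x^2)^2, a zero at x gives zeros at x^2, x^4 and so on; these
    tend to 0, where theta_4 is 1. *)
Lemma val_Sg_phi_neq_0 (x : R) : 0 <= x < 1 -> val (Sg phi) x <> 0.
Proof.
  assert (C0 : continuity_pt (val (Sg phi)) 0) by (apply val_continuous; auto with pg; lra).
  apply continuity_pt_filterlim in C0. rewrite val_0, Sg_phi_0 in C0.
  destruct (proj1 (filterlim_locally _ _) C0 (mkposreal 1 Rlt_0_1)) as [e He].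
  assert (Hsq : forall x, 0 <= x < 1 -> val (Sg phi) x = 0 -> val (Sg phi) (x ^ 2) = 0).
  { intros y Hy H0. pose proof (f_equal (fun a => val a y) phi_mul_Sg_phi) as E.
    cbn beta in E. rewrite !val_mul, H0, val_V in E by auto with pg.
    rewrite Rmult_0_r in E. symmetry in E. now apply Rmult_integral in E as [E|E]. }
  intros Hx H0.
  assert (It : forall n, val (Sg phi) (x ^ (2 ^ n)%nat) = 0).
  { induction n as [|n IH]; [now rewrite pow_1|].
    replace (2 ^ S n)%nat with (2 ^ n * 2)%nat by (simpl; lia). rewrite pow_mult.
    apply Hsq; [|exact IH]. split; [apply pow_le; lra|].
    apply pow_lt_1_compat; [lra|]. pose proof (Nat.pow_nonzero 2 n). lia. }
  destruct (pow_lt_1_zero x ltac:(rewrite Rabs_pos_eq; lra) e (cond_pos e)) as [N HN].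
  specialize (It N). specialize (HN (2 ^ N)%nat).
  assert (HN' : (2 ^ N >= N)%nat) by (pose proof (Nat.pow_gt_lin_r 2 N); lia).
  specialize (HN HN').
  assert (B : Rabs (val (Sg phi) (x ^ (2 ^ N)%nat) - 1) < 1).
  { apply He. change (Rabs (x ^ (2 ^ N)%nat - 0) < e). now rewrite Rminus_0_r. }
  rewrite It in B. unfold Rabs in B. destruct (Rcase_abs (0 - 1)); lra.
Qed.

Lemma val_h4_pos (x : R) : 0 <= x < 1 -> 0 < val h4 x.
Proof.
  intro Hx. unfold h4. rewrite val_pow by auto with pg.
  pose proof (val_Sg_phi_neq_0 x Hx).
  replace (val (Sg phi) x ^ 4) with ((val (Sg phi) x ^ 2) ^ 2) by ring.
  apply pow2_gt_0, pow_nonzero. assumption.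
Qed.

Lemma h4_nonincreasing (x y : R) : 0 <= x <= y -> y < 1 -> val h4 y <= val h4 x.
Proof.
  intros Hx Hy.
  enough (- val h4 x <= - val h4 y) by lra.
  apply (mono_le (fun x => - val h4 x) (fun x => - dval h4 x)); [lra| |].
  - intros c Hc. apply (is_derive_opp (val h4)), val_derive; [apply pg_h4|lra].
  - intros c Hc. rewrite dval_eq by lra.
    assert (E : th h4 = (- (Q[8] * Lam 1 * h4))%ps).
    { rewrite h4_sb, th_mul, th_sb. unfold A4. ring. }
    rewrite E, val_opp, !val_mul, val_kq by (auto with pg || lra).
    assert (L : Lam 1 0%nat <= val (Lam 1) c).
    { apply val_ge_coef_0; [|apply pg_Lam|lra].
      eapply coef_nonneg_gs; [|apply gs_Lam]. intro; apply pow_le, pos_INR. }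
    rewrite Lam_0 in L. pose proof (val_h4_pos c ltac:(lra)).
    unfold Q2R; simpl.
    apply Rle_trans with (8 * (val (Lam 1) c * val h4 c * / c));
      [|apply Req_le; field; lra].
    apply Rmult_le_pos; [lra|].
    apply Rmult_le_pos; [apply Rmult_le_pos; lra|].
    left; apply Rinv_0_lt_compat; lra.
Qed.

Lemma h2_nondecreasing (x y : R) : 0 <= x <= y -> y < 1 -> val h2 x <= val h2 y.
Proof.
  intros Hx Hy. apply (mono_le (val h2) (dval h2)); [lra| |].
  - intros c Hc. apply val_derive; [apply pg_h2|lra].
  - intros c Hc. rewrite dval_eq by lra. apply Rdiv_le_0_compat; [|lra].
    pose proof (val_ge_coef_0 (th h2) c) as H. simpl (th h2 0%nat) in H.
    rewrite Rmult_0_l in H. apply H; [|auto with pg|lra].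
    intro n. simpl coef. apply Rmult_le_pos; [apply pos_INR|apply coef_nonneg_h2].
Qed.

(* [x0] is the nome of i. *)
Lemma e6_sign : exists x0, 0 < x0 < 1 /\
  (forall x, 0 < x <= x0 -> 0 <= val e6 x) /\ (forall x, x0 <= x < 1 -> val e6 x <= 0).
Proof.
  (* E_6 has the sign of h4 - h2. This is 1 at x = 0, and negative at 1/2, where h2 is at least 8
     and h4 at most 1; monotonicity of both makes the sign change unique. *)
  destruct (Ranalysis5.IVT_interv (fun x => val h2 x - val h4 x) 0 (1 / 2)) as [x0 [H0 E0]].
  - intros a Ha. apply continuity_pt_minus; apply val_continuous; auto with pg; lra.
  - lra.
  - rewrite !val_0. unfold h2. rewrite X_mul_coef. unfold h4. rewrite ppow_coef_0, Sg_phi_0.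
    lra.
  - pose proof (val_h2_ge (1 / 2) ltac:(lra)).
    enough (val h4 (1 / 2) <= 1) by lra.
    replace 1 with (val h4 0) at 2 by
      (rewrite val_0; unfold h4; rewrite ppow_coef_0, Sg_phi_0; ring).
    apply h4_nonincreasing; lra.
  - assert (Hx0 : 0 < x0 < 1).
    { destruct (Req_dec x0 0) as [->|]; [|lra]. rewrite !val_0 in E0.
      unfold h2, h4 in E0. rewrite X_mul_coef, ppow_coef_0, Sg_phi_0 in E0. lra. }
    assert (E6 : forall x, 0 < x < 1 -> val e6 x =
      / 2 * (val h2 x + 2 * val h4 x) * (2 * val h2 x + val h4 x) * (val h4 x - val h2 x)).
    { intros x Hx. rewrite e6_e6h. unfold e6h.
      rewrite !val_mul, val_sub, !val_add, !val_mul, !val_kq by (auto 20 with pg || lra).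
      unfold Q2R; simpl. field. }
    assert (P : forall x, 0 < x < 1 ->
      0 < / 2 * (val h2 x + 2 * val h4 x) * (2 * val h2 x + val h4 x)).
    { intros x Hx. pose proof (val_h4_pos x ltac:(lra)).
      pose proof (val_h2_ge x ltac:(lra)).
      apply Rmult_lt_0_compat; [apply Rmult_lt_0_compat|]; lra. }
    exists x0. split; [exact Hx0|split]; intros x Hx.
    + rewrite E6 by lra. pose proof (P x ltac:(lra)).
      pose proof (h4_nonincreasing x x0 ltac:(lra) ltac:(lra)).
      pose proof (h2_nondecreasing x x0 ltac:(lra) ltac:(lra)).
      apply Rmult_le_pos; lra.
    + rewrite E6 by lra. pose proof (P x ltac:(lra)).
      pose proof (h4_nonincreasing x0 x ltac:(lra) ltac:(lra)).
      pose proof (h2_nondecreasing x0 x ltac:(lra) ltac:(lra)).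
      nra.
Qed.

(** * Positivity *)

Local Open Scope R_scope.

Lemma val_h2_pos (x : R) : 0 < x < 1 -> 0 < val h2 x.
Proof. intro Hx. pose proof (val_h2_ge x ltac:(lra)). lra. Qed.

Lemma val_delta_pos (x : R) : 0 < x < 1 -> 0 < val delta x.
Proof.
  intro Hx. rewrite delta_h, val_mul, val_pow, !val_mul, val_add, val_kq
    by (auto with pg || lra).
  pose proof (val_h2_pos x Hx). pose proof (val_h4_pos x ltac:(lra)).
  apply Rmult_lt_0_compat; [unfold Q2R; simpl; lra|].
  apply pow_lt. repeat apply Rmult_lt_0_compat; lra.
Qed.

Lemma val_e4_pos (x : R) : 0 < x < 1 -> 0 < val e4 x.
Proof.
  intro Hx. rewrite e4_e4h. unfold e4h. rewrite !val_add, !val_mul by (auto with pg || lra).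
  pose proof (val_h2_pos x Hx). pose proof (val_h4_pos x ltac:(lra)). nra.
Qed.

(* Since D Delta = E_2 Delta, dividing by Delta^(k/12) turns the Serre
   derivative of weight [k] into the ordinary derivative. *)
Definition normalized (k : nat) (f : ps) (x : R) : R :=
  val f x * exp (- (INR k / 12) * ln (val delta x)).

Lemma th_delta : th delta = (Q[2] * e2 * delta)%ps.
Proof.
  pose proof ds_delta as H. unfold ds in H.
  transitivity (Q[2] * (Q[1/2] * th delta - kq (Z.of_nat 12 # 12) * e2 * delta)
                + Q[2] * e2 * delta)%ps; [ring|rewrite H; ring].
Qed.

(** The factor 2 / x appears because D is half of x d/dx. *)
Lemma normalized_derive (k : nat) (f : ps) (x : R) : pg f -> 0 < x < 1 ->
  is_derive (normalized k f) x (2 / x * normalized k (ds k f) x).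
Proof.
  intros Hf Hx. pose proof (val_delta_pos x Hx) as Hd.
  pose proof (val_derive delta x pg_delta ltac:(lra)) as D1.
  pose proof (val_derive f x Hf ltac:(lra)) as D2.
  unfold normalized.
  evar_last.
  - apply (is_derive_mult (val f)); [exact D2| |apply Rmult_comm].
    apply (is_derive_comp exp); [apply is_derive_exp|].
    apply (is_derive_scal (fun x => ln (val delta x))).
    apply (is_derive_comp ln); [apply is_derive_ln; exact Hd|exact D1].
  - unfold plus, mult, scal; simpl. unfold mult; simpl.
    rewrite !dval_eq, th_delta by lra. unfold ds.
    rewrite val_sub, !val_mul, !val_kq by (auto 20 with pg || lra).
    unfold Q2R; simpl. rewrite <- INR_IZR_INZ. field. lra.
Qed.

Lemma normalized_pos (k : nat) (f : ps) (x : R) : 0 < normalized k f x <-> 0 < val f x.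
Proof.
  unfold normalized. set (e := exp _). assert (0 < e) by apply exp_pos.
  split; intro H'; [|now apply Rmult_lt_0_compat].
  destruct (Rlt_le_dec 0 (val f x)) as [|N]; [assumption|nra].
Qed.

Lemma normalized_nonneg (k : nat) (f : ps) (x : R) :
  0 <= val f x -> 0 <= normalized k f x.
Proof. intro H. apply Rmult_le_pos; [exact H|left; apply exp_pos]. Qed.

Lemma serre_propagate (k : nat) (f : ps) (a b : R) : pg f -> 0 < a <= b -> b < 1 ->
  0 < val f a -> (forall x, a < x < b -> 0 <= val (ds k f) x) -> 0 < val f b.
Proof.
  intros Hf Ha Hb H0 H. apply (normalized_pos k). apply (normalized_pos k) in H0.
  apply (Rlt_le_trans _ _ _ H0).
  apply (mono_le _ (fun x => 2 / x * normalized k (ds k f) x)); [lra| |].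
  - intros x Hx. apply normalized_derive; [exact Hf|lra].
  - intros x Hx. apply Rmult_le_pos; [|now apply normalized_nonneg, H].
    apply Rdiv_le_0_compat; lra.
Qed.

(** Continuous induction: at the supremum m of the y with h > 0 on (0, y], the last hypothesis gives
    h m > 0, and continuity would carry positivity past m unless m = b. *)
Lemma positive_continuation (h : R -> R) (c b : R) : 0 < c <= b ->
  (forall x, 0 < x <= b -> continuity_pt h x) ->
  (forall x, 0 < x <= c -> 0 < h x) ->
  (forall y, c < y <= b -> (forall x, 0 < x < y -> 0 < h x) -> 0 < h y) ->
  forall x, 0 < x <= b -> 0 < h x.
Proof.
  intros Hc Hcont H0 Hstep.
  set (E := fun y => c <= y <= b /\ forall x, 0 < x <= y -> 0 < h x).
  assert (Ec : E c) by (split; [lra|exact H0]).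
  destruct (completeness E) as [m [Hub Hlub]].
  { exists b. intros y [Hy _]. lra. }
  { now exists c. }
  assert (Hcm : c <= m) by now apply Hub.
  assert (Hmb : m <= b) by (apply Hlub; intros y [Hy _]; lra).
  assert (Hbelow : forall x, 0 < x < m -> 0 < h x).
  { intros x Hx. destruct (classic (exists y, E y /\ x <= y)) as [[y [[_ Hy] Hxy]]|N].
    - apply Hy; lra.
    - exfalso. assert (m <= x); [|lra]. apply Hlub. intros y Hy.
      destruct (Rle_lt_dec y x); [assumption|exfalso; apply N; exists y; split; [auto|lra]]. }
  assert (Hm : 0 < h m).
  { destruct (Req_dec m c) as [->|]; [apply H0; lra|]. apply Hstep; [lra|exact Hbelow]. }
  assert (Em : E m).
  { split; [lra|]. intros x Hx. destruct (Req_dec x m) as [->|]; [exact Hm|apply Hbelow; lra]. }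
  destruct (Req_dec m b) as [<-|Hne]; [apply Em|exfalso].
  pose proof (Hcont m ltac:(lra)) as Cm. apply continuity_pt_filterlim in Cm.
  destruct (proj1 (filterlim_locally _ _) Cm (mkposreal _ Hm)) as [e He].
  pose proof (cond_pos e) as He0.
  set (m' := Rmin b (m + e / 2)).
  assert (Hm' : m < m' <= b /\ m' <= m + e / 2)
    by (unfold m', Rmin; destruct (Rle_dec b (m + e / 2)); lra).
  assert (m' <= m); [|lra]. apply Hub. split; [lra|]. intros x Hx.
  destruct (Rle_lt_dec x m) as [|Hxm]; [apply Em; lra|].
  assert (B : Rabs (h x - h m) < h m).
  { apply He. change (Rabs (x - m) < e). rewrite Rabs_pos_eq; lra. }
  apply Rabs_def2 in B. lra.
Qed.

Lemma val_kn (w : nat) (x : R) : val (kn w) x = INR w.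
Proof. rewrite kn_K. apply val_K. Qed.

(* The equation is cooperative where E_4, E_6 >= 0: positivity of the solution and
   its first two Serre derivatives near infinity propagates. *)
Lemma ode_cooperative (w : nat) (f : ps) (c b : R) : 12 <= INR w -> pg f -> ode w f ->
  0 < c <= b -> b < 1 -> (forall x, 0 < x <= b -> 0 <= val e6 x) ->
  (forall x, 0 < x <= c ->
     0 < val f x /\ 0 < val (ds w f) x /\ 0 < val (ds (w + 2) (ds w f)) x) ->
  forall x, 0 < x <= b -> 0 < val f x /\ 0 < val (ds w f) x.
Proof.
  intros Hw Hf Ho Hc Hb H6 H0.
  (* A positive second derivative up to y gives a positive first derivative, and then a positive f,
     each by one propagation from c. *)
  assert (L : forall y, 0 < y <= b ->
    (forall x, 0 < x < y -> 0 < val (ds (w + 2) (ds w f)) x) ->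
    forall x, 0 < x <= y -> 0 < val f x /\ 0 < val (ds w f) x).
  { intros y Hy H2.
    assert (H1 : forall x, 0 < x <= y -> 0 < val (ds w f) x).
    { intros x Hx. destruct (Rle_lt_dec x c) as [|Hxc]; [apply H0; lra|].
      apply (serre_propagate (w + 2) _ c); auto with pg; try lra.
      - apply H0; lra.
      - intros u Hu. left. apply H2. lra. }
    intros x Hx. split; [|now apply H1].
    destruct (Rle_lt_dec x c) as [|Hxc]; [apply H0; lra|].
    apply (serre_propagate w _ c); auto with pg; try lra.
    - apply H0; lra.
    - intros u Hu. left. apply H1. lra. }
  assert (H2 : forall x, 0 < x <= b -> 0 < val (ds (w + 2) (ds w f)) x).
  { apply (positive_continuation _ c); [exact Hc| | |].
    - intros x Hx. apply val_continuous; auto with pg; lra.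
    - intros x Hx. now apply H0.
    - intros y Hy H2. specialize (L y ltac:(lra) H2).
      apply (serre_propagate (w + 4) _ c); auto with pg; try lra.
      + apply H0; lra.
      + intros x Hx. rewrite Ho.
        destruct (L x ltac:(lra)) as [Lf L1].
        pose proof (val_e4_pos x ltac:(lra)). pose proof (H6 x ltac:(lra)).
        rewrite !val_add, !val_mul, val_add, !val_sub, !val_mul, !val_kn, !val_kq
          by (auto 20 with pg || lra).
        unfold Q2R; simpl.
        (* Both 3 w^2 - 24 w + 80 and w (w - 12) (w - 3) are nonnegative for w >= 12. *)
        apply Rplus_le_le_0_compat; repeat apply Rmult_le_pos; try lra; nra. }
  intros x Hx. apply (L b); try lra. intros u Hu. apply H2. lra.
Qed.

(** * Leading coefficients and the indicial equation *)

Lemma leading_coef (f : ps) : f <> K 0 -> exists n, f n <> 0 /\ forall k, (k < n)%nat -> f k = 0.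
Proof.
  intro H. destruct (classic (exists n, f n <> 0)) as [[n Hn]|N].
  - revert Hn. induction n as [n IH] using lt_wf_ind. intro Hn.
    destruct (classic (exists k, (k < n)%nat /\ f k <> 0)) as [[k [Hk Hk']]|M].
    + now apply (IH k).
    + exists n. split; [exact Hn|]. intros k Hk.
      destruct (Req_dec (f k) 0); [assumption|exfalso; eauto].
  - exfalso. apply H. apply ps_ext; intro n.
    replace (K 0 n) with 0 by (simpl; now destruct n).
    destruct (Req_dec (f n) 0); [assumption|exfalso; eauto].
Qed.

Definition lead (n : nat) (r : R) (f : ps) : Prop :=
  f n = r /\ forall k, (k < n)%nat -> f k = 0.

Lemma lead_mul (n : nat) (r : R) (a f : ps) :
  lead n r f -> lead n (a 0%nat * r) (a * f)%ps.
Proof.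
  intros [H1 H2]. split.
  - unfold pmul, coef at 1. rewrite (sum_f_R0_single _ n 0); [now rewrite Nat.sub_0_r, H1|lia|].
    intros k Hk Hk0. rewrite H2 by lia. ring.
  - intros k Hk. unfold pmul, coef at 1. apply sum_f_R0_zero.
    intros i Hi. rewrite H2 by lia. ring.
Qed.

Lemma lead_add (n : nat) (r s : R) (f g : ps) :
  lead n r f -> lead n s g -> lead n (r + s) (f + g)%ps.
Proof.
  intros [H1 H2] [H3 H4]. split; [simpl; now rewrite H1, H3|].
  intros k Hk. simpl. rewrite H2, H4 by exact Hk. ring.
Qed.

Lemma lead_ds (k n : nat) (r : R) (f : ps) :
  lead n r f -> lead n ((INR n / 2 - INR k / 12) * r) (ds k f).
Proof.
  intro H.
  assert (T : lead n (INR n * r) (th f)).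
  { destruct H as [H1 H2]. split; [simpl; now rewrite H1|].
    intros i Hi. simpl. rewrite H2 by exact Hi. ring. }
  pose proof (lead_add _ _ _ _ _ (lead_mul n _ Q[1/2]%ps _ T)
    (lead_mul n r (- (kq (Z.of_nat k # 12) * e2))%ps f H)) as L.
  replace (ds k f) with (Q[1 / 2] * th f + - (kq (Z.of_nat k # 12) * e2) * f)%ps
    by (unfold ds; ring).
  replace ((INR n / 2 - INR k / 12) * r) with
    (Q[1/2]%ps 0%nat * (INR n * r) + (- (kq (Z.of_nat k # 12) * e2))%ps 0%nat * r);
    [exact L|].
  coef0. unfold e2. coef0. change (Sig 1 0%nat) with 0.
  unfold Q2R; simpl. rewrite <- INR_IZR_INZ. field.
Qed.

Lemma lead_unique (n : nat) (r s : R) (f g : ps) : lead n r f -> lead n s g -> f = g -> r = s.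
Proof. intros [H _] [H' _] ->. congruence. Qed.

(** E_2, E_4 and E_6 have constant term 1, so the leading coefficients give the indicial polynomial
    n (n - 2) (n - (w - 2) / 2) / 8, and n >= 3 leaves one root. *)
Lemma ode_indicial (w n : nat) (r : R) (f : ps) : ode w f -> lead n r f -> r <> 0 ->
  (3 <= n)%nat -> INR n = (INR w - 2) / 2.
Proof.
  intros Ho Hl Hr Hn.
  pose proof (lead_ds (w + 4) n _ _ (lead_ds (w + 2) n _ _ (lead_ds w n _ _ Hl))) as L3.
  pose proof (lead_add _ _ _ _ _
    (lead_mul n _ (Q[1/144] * (Q[3] * kn w * kn w - Q[24] * kn w + Q[80]) * e4)%ps _
      (lead_ds w n _ _ Hl))
    (lead_mul n _ (Q[1/864] * kn w * (kn w - Q[12]) * (kn w - Q[3]) * e6)%ps _ Hl)) as R3.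
  pose proof (lead_unique _ _ _ _ _ L3 R3 Ho) as E.
  rewrite kn_K in E. revert E. coef0. unfold e4, e6. coef0.
  change (Sig 3 0%nat) with 0. change (Sig 5 0%nat) with 0.
  rewrite !plus_INR. simpl (INR 4). simpl (INR 2). unfold Q2R; simpl. intro E.
  assert (N3 : 3 <= INR n) by (replace 3 with (INR 3) by (simpl; ring); now apply le_INR).
  assert (F : r * (INR n * (INR n - 2) * (INR n - (INR w - 2) / 2)) = 0) by
    (apply Rminus_diag_eq in E; apply (Rmult_eq_reg_l (/ 8)); [|lra];
     rewrite Rmult_0_r, <- E; field).
  apply Rmult_integral in F as [F|F]; [easy|].
  apply Rmult_integral in F as [F|F]; [|lra].
  apply Rmult_integral in F as [F|F]; lra.
Qed.

Lemma lead_positive (n : nat) (r : R) (f : ps) : pg f -> lead n r f -> 0 < r ->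
  exists c, 0 < c < 1 /\ forall x, 0 < x <= c -> 0 < val f x.
Proof.
  intros Hf [H1 H2] Hr.
  set (b := Ps (fun k => f (n + k)%nat)).
  assert (E : f = (X ^ n * b)%ps).
  { clear H1 Hf Hr. revert f H2 b. induction n as [|n IH]; intros f H2 b.
    - simpl. rewrite pmul_1_l. apply ps_ext; intro k. reflexivity.
    - simpl ppow.
      transitivity (X * Ps (fun k => f (S k)))%ps.
      + apply ps_ext; intros [|k]; rewrite X_mul_coef; [apply H2; lia|reflexivity].
      + rewrite (IH (Ps (fun k => f (S k)))) by (intros k Hk; simpl; apply H2; lia).
        unfold b. simpl. ring. }
  (* The shifted bound uses n + k + 1 <= (n + 1) (k + 1). *)
  assert (Hb : pg b).
  { destruct Hf as [C [d [HC Hf]]]. exists (C * INR (S n) ^ d), d. split.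
    - apply Rmult_le_pos; [exact HC|left; apply pow_INR_S_pos].
    - intro k. unfold b; simpl coef. eapply Rle_trans; [apply Hf|].
      rewrite Rmult_assoc, <- Rpow_mult_distr. apply Rmult_le_compat_l; [exact HC|].
      apply pow_incr. split; [apply pos_INR|]. rewrite <- mult_INR. apply le_INR. nia. }
  pose proof (val_continuous b 0 Hb ltac:(lra)) as Cb. apply continuity_pt_filterlim in Cb.
  rewrite val_0 in Cb.
  assert (b0 : b 0%nat = r) by (unfold b; simpl; now rewrite Nat.add_0_r).
  rewrite b0 in Cb.
  destruct (proj1 (filterlim_locally _ _) Cb (mkposreal _ Hr)) as [e He].
  pose proof (cond_pos e) as He0.
  exists (Rmin (1 / 2) (e / 2)).
  assert (M : 0 < Rmin (1 / 2) (e / 2) <= 1 / 2 /\ Rmin (1 / 2) (e / 2) <= e / 2)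
    by (unfold Rmin; destruct Rle_dec; lra).
  split; [lra|]. intros x Hx.
  rewrite E, val_mul, val_pow, val_X by (auto with pg || lra).
  apply Rmult_lt_0_compat; [apply pow_lt; lra|].
  assert (B : Rabs (val b x - r) < r).
  { apply He. change (Rabs (x - 0) < e). rewrite Rabs_pos_eq; lra. }
  apply Rabs_def2 in B. lra.
Qed.

Lemma ode_positive_lead (w n : nat) (r : R) (f : ps) (b : R) : 12 <= INR w -> pg f ->
  ode w f -> (3 <= n)%nat -> lead n r f -> 0 < r -> 0 < b < 1 ->
  (forall x, 0 < x <= b -> 0 <= val e6 x) ->
  forall x, 0 < x <= b -> 0 < val f x /\ 0 < val (ds w f) x.
Proof.
  intros Hw Hf Ho Hn Hl Hr Hb H6.
  pose proof (ode_indicial w n r f Ho Hl ltac:(lra) Hn) as En.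
  pose proof (lead_ds w n _ _ Hl) as L1.
  pose proof (lead_ds (w + 2) n _ _ L1) as L2.
  (* At this n the two factors n/2 - w/12 and n/2 - (w + 2)/12 are (w - 3)/6 and (w - 4)/6, so f and
     both derivatives are positive near infinity. *)
  rewrite plus_INR in L2. simpl (INR 2) in L2. rewrite En in L1, L2.
  destruct (lead_positive n _ f Hf Hl Hr) as [c0 [Hc0 P0]].
  destruct (lead_positive n _ _ (pg_ds w f Hf) L1 ltac:(nra)) as [c1 [Hc1 P1]].
  destruct (lead_positive n _ _ (pg_ds (w + 2) _ (pg_ds w f Hf)) L2) as [c2 [Hc2 P2]].
  { apply Rmult_lt_0_compat; [lra|nra]. }
  set (c := Rmin b (Rmin c0 (Rmin c1 c2))).
  assert (Hc : 0 < c <= b /\ c <= c0 /\ c <= c1 /\ c <= c2)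
    by (unfold c, Rmin; repeat destruct Rle_dec; lra).
  apply (ode_cooperative w f c b); auto; try lra.
  intros x Hx. repeat split; [apply P0|apply P1|apply P2]; lra.
Qed.

Lemma ord3_lead (n : nat) (r : R) (f : ps) : ord3 f -> lead n r f -> r <> 0 -> (3 <= n)%nat.
Proof.
  intros [b ->] [H _] Hr.
  destruct n as [|[|[|n]]]; [| | |lia]; exfalso; apply Hr; rewrite <- H; clear H.
  all: replace (X ^ 3 * b)%ps with (X * (X * (X * b)))%ps by ring.
  all: now rewrite !X_mul_coef.
Qed.

(* By the cooperative property, the leading coefficient has the sign of the Serre
   derivative at any single point above i. *)
Lemma ode_positive (w : nat) (f : ps) (b : R) : 12 <= INR w -> pg f -> ode w f ->
  ord3 f -> 0 < b < 1 -> (forall x, 0 < x <= b -> 0 <= val e6 x) ->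
  0 < val (ds w f) b ->
  forall x, 0 < x <= b -> 0 < val f x /\ 0 < val (ds w f) x.
Proof.
  intros Hw Hf Ho H3 Hb H6 H1.
  assert (Hf0 : f <> K 0).
  { intros ->. replace (ds w (K 0)) with (K 0) in H1
      by (unfold ds; rewrite th_K; ring). rewrite val_K in H1. lra. }
  destruct (leading_coef f Hf0) as [n [Hn Hl]].
  assert (L : lead n (f n) f) by (split; auto).
  pose proof (ord3_lead n _ f H3 L Hn) as N3.
  destruct (Rlt_le_dec 0 (f n)) as [P|P].
  - now apply (ode_positive_lead w n (f n)).
  - exfalso.
    (* A negative leading coefficient would make the derivative of -f positive at b, against the
       hypothesis. *)
    destruct (ode_positive_lead w n (- 1 * f n) (K (-1) * f)%ps b Hw
      (pg_mul _ _ (pg_K _) Hf) (ode_K _ _ _ Ho) N3 (lead_mul _ _ (K (-1)) _ L)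
      ltac:(lra) Hb H6 b ltac:(lra)) as [_ Q].
    rewrite ds_K, val_mul, val_K in Q by (auto with pg || lra). lra.
Qed.

(** Positivity of g from i downwards suffices: its value at i settles both signs above i, and then f
    stays positive below i because its Serre derivative is a positive multiple of g. *)
Lemma pair_positive (w : nat) (f g : ps) (a x0 : R) : 12 <= INR w -> pg f -> pg g ->
  ode w f -> ord3 f -> 0 < a -> ds w f = (K a * g)%ps -> 0 < x0 < 1 ->
  (forall x, 0 < x <= x0 -> 0 <= val e6 x) ->
  (forall x, x0 <= x < 1 -> 0 < val g x) ->
  forall x, 0 < x < 1 -> 0 < val f x /\ 0 < val g x.
Proof.
  intros Hw Hf Hg Ho H3 Ha E Hx0 H6 Hpos.
  assert (Eg : forall x, 0 < x < 1 -> val (ds w f) x = a * val g x).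
  { intros x Hx. rewrite E, val_mul, val_K by (auto with pg || lra). reflexivity. }
  assert (Hl := ode_positive w f x0 Hw Hf Ho H3 Hx0 H6
    ltac:(rewrite Eg by lra; apply Rmult_lt_0_compat; [lra|apply Hpos; lra])).
  assert (G : forall x, 0 < x < 1 -> 0 < val g x).
  { intros x Hx. destruct (Rle_lt_dec x x0) as [Hxx|]; [|apply Hpos; lra].
    destruct (Hl x ltac:(lra)) as [_ P]. rewrite Eg in P by lra.
    apply (Rmult_lt_reg_l a); lra. }
  intros x Hx. split; [|now apply G].
  destruct (Rle_lt_dec x x0) as [Hxx|Hxx]; [apply Hl; lra|].
  apply (serre_propagate w f x0); auto; try lra.
  - apply Hl; lra.
  - intros u Hu. rewrite Eg by lra. pose proof (G u ltac:(lra)). nra.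
Qed.

Ltac val_push := repeat first
  [ rewrite val_add by (auto 20 with pg || lra) | rewrite val_sub by (auto 20 with pg || lra)
  | rewrite val_mul by (auto 20 with pg || lra) | rewrite val_pow by (auto 20 with pg || lra)
  | rewrite val_kq ]; unfold Q2R; simpl Qnum; simpl Qden.

Lemma val_g14_pos (x : R) : 0 < x < 1 -> 0 < val g14 x.
Proof.
  intro Hx. unfold g14, p14. val_push.
  pose proof (val_h2_pos x Hx). pose proof (val_h4_pos x ltac:(lra)).
  generalize dependent (val h2 x). generalize dependent (val h4 x). intros v Hv u Hu.
  assert (0 < u ^ 5) by now apply pow_lt.
  repeat apply Rmult_lt_0_compat; try lra; nra.
Qed.

Lemma val_g8_pos (x : R) : 0 < x < 1 -> 0 < val g8 x.
Proof.
  intro Hx. unfold g8. val_push.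
  pose proof (val_h2_pos x Hx). pose proof (val_h4_pos x ltac:(lra)).
  generalize dependent (val h2 x). generalize dependent (val h4 x). intros v Hv u Hu.
  assert (0 < u ^ 3) by now apply pow_lt.
  repeat apply Rmult_lt_0_compat; try lra; nra.
Qed.

Lemma val_g10_pos (x : R) : 0 < x < 1 -> 0 < val g10 x.
Proof.
  intro Hx. unfold g10. val_push.
  pose proof (val_h2_pos x Hx). pose proof (val_h4_pos x ltac:(lra)).
  generalize dependent (val h2 x). generalize dependent (val h4 x). intros v Hv u Hu.
  assert (0 < u ^ 3) by now apply pow_lt.
  repeat apply Rmult_lt_0_compat; try lra; nra.
Qed.

(** [g14] is visibly positive as a polynomial in [h2] and [h4], so the logarithm in [g12] needs no
    estimate. *)
Lemma val_g12_pos (x : R) : 0 < x < 1 -> 0 < val g12 x.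
Proof.
  destruct e6_sign as [x0 [Hx0 [H6 _]]]. intro Hx.
  apply (pair_positive 12 g12 g14 (Q2R (3/2)) x0); auto using pg_g12, pg_g14, ode_g12, ord3_g12.
  - simpl; lra.
  - unfold Q2R; simpl; lra.
  - exact ds_g12.
  - intros y Hy. apply val_g14_pos. lra.
Qed.

Lemma c2_pos (y : R) : 16 < y -> 0 < c2 y.
Proof.
  intro H. unfold c2. apply Rdiv_lt_0_compat; repeat apply Rmult_lt_0_compat; lra.
Qed.

(** Each stage needs the second component from i downwards only, where it is a positive multiple of
    E_4 g - E_6 f for the preceding pair (f, g); for j = 0 that pair is ([g12], [g14]). *)
Lemma gpair_pos (j : nat) (x : R) : 0 < x < 1 ->
  0 < val (fst (gpair j)) x /\ 0 < val (snd (gpair j)) x.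
Proof.
  destruct e6_sign as [x0 [Hx0 [H6 H6']]].
  assert (Step : forall j, (forall x, x0 <= x < 1 -> 0 < val (snd (gpair j)) x) ->
    forall x, 0 < x < 1 -> 0 < val (fst (gpair j)) x /\ 0 < val (snd (gpair j)) x).
  { clear j x. intros j H. destruct (gpair_ode j) as [Ho E], (pg_gpair j) as [Pf Pg].
    pose proof (INR_16_le j).
    apply (pair_positive (16 + 4 * j) _ _ (Q2R (1/6) * (INR (16 + 4 * j) - Q2R 3)) x0);
      auto using ord3_gpair; try lra.
    - unfold Q2R; simpl Qnum; simpl Qden. apply Rmult_lt_0_compat; lra.
    - rewrite E, kn_K, K_mul, K_sub. reflexivity. }
  assert (Comb : forall f g x, pg f -> pg g -> x0 <= x < 1 -> 0 < val f x -> 0 < val g x ->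
    0 < val (e4 * g - e6 * f)%ps x).
  { intros f g y Hf Hg Hy Pf Pg. rewrite val_sub, !val_mul by (auto with pg || lra).
    pose proof (val_e4_pos y ltac:(lra)). pose proof (H6' y Hy). nra. }
  revert x. induction j as [|j IH]; apply Step; intros x Hx.
  - pose proof (Comb g12 g14 x pg_g12 pg_g14 Hx (val_g12_pos x ltac:(lra))
      (val_g14_pos x ltac:(lra))) as P.
    rewrite g14_g12, val_mul, val_kq in P by (auto with pg || lra).
    change (0 < val g18 x). unfold Q2R in P. simpl Qnum in P. simpl Qden in P.
    apply (Rmult_lt_reg_l (27456 * / 35)); lra.
  - destruct (pg_gpair j) as [Pf Pg]. destruct (IH x ltac:(lra)) as [If Ig].
    pose proof (Comb _ _ x Pf Pg Hx If Ig) as P.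
    rewrite (gpair_next j), val_mul, val_K by (auto 20 with pg || lra).
    apply Rmult_lt_0_compat; [|exact P].
    pose proof (INR_16_le j). apply Rmult_lt_0_compat; [apply c2_pos; lra|].
    apply Rdiv_lt_0_compat; [|lra]. apply Rmult_lt_0_compat; lra.
Qed.

Theorem corollary4p19 :
  forall LS : C -> C, is_LS LS ->
  forall w : nat, Nat.Even w -> (8 <= w)%nat ->
  forall t : R, (0 < t)%R ->
  Im (G LS w (0%R, t)) = 0%R /\ (0 < Re (G LS w (0%R, t)))%R.
Proof.
  intros LS HLS w [m Hm] Hw t Ht.
  assert (Hz : upper (0, t)) by exact Ht.
  assert (Hx : 0 < exp (- (PI * t)) < 1) by (exact (nome_bounds _ Hz)).
  enough (E : exists g, G LS w (0, t) = Ev g (0, t) /\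
    forall x, 0 < x < 1 -> 0 < val g x).
  { destruct E as [g [-> P]]. rewrite Ev_axis. split; [reflexivity|apply P, Hx]. }
  assert (Hc : (w = 8 \/ w = 10 \/ w = 12 \/ w = 14 \/
    exists j, w = 16 + 4 * j \/ w = 18 + 4 * j)%nat).
  (* With w = 2 m, an even m = 2 i gives w = 16 + 4 (i - 4) and an odd m = 2 i + 1 gives w = 18 + 4
     (i - 4). *)
  { destruct (le_lt_dec w 14); [lia|]. do 4 right.
    destruct (even_odd_dec m) as [[i ->]|[i ->]]; exists (i - 4)%nat; lia. }
  destruct Hc as [->|[->|[->|[->|[j [->| ->]]]]]].
  - exists g8. split; [now apply G8_Ev|apply val_g8_pos].
  - exists g10. split; [now apply G10_Ev|apply val_g10_pos].
  - exists g12. split; [now apply G12_Ev|apply val_g12_pos].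
  - exists g14. split; [now apply G14_Ev|apply val_g14_pos].
  - exists (fst (gpair j)). split; [now apply G_gpair|apply gpair_pos].
  - exists (snd (gpair j)). split; [now apply G_gpair|apply gpair_pos].
Qed.
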